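(* Assume the elliptical model and asymptotic regime described in the context. Let $$IE(X_1,\dots,X_k)=\frac{n-p}{n-2p+\dfrac{1}{\sum_{i=1}^k\frac{1}{\operatorname{tr}[(X_i^\top X_i)^{-1}X^\top X]}}}.$$ Then, almost surely, $$IE(X_1,\dots,X_k)\to\frac{1-\gamma}{1-2\gamma+\dfrac{1}{\sum_{i=1}^k\psi(\gamma_i,G_i)}},\qquad \psi(\gamma_i,G_i)=\frac{1}{\gamma+\left(\mathbb{E}_GT-\frac{\gamma}{\gamma_i}\mathbb{E}_{G_i}T\right)f(\gamma_i,G_i)}.$$ In the special case of Marchenko-Pastur models ($\Gamma=I_n$ for all $n$), the almost sure limit of $IE(X_1,\dots,X_k)$ equals $$\frac{1-\gamma}{1-2\gamma+\frac{\gamma(1-\gamma)}{1-k\gamma}}=\frac{1}{1+\frac{(k-1)\gamma^2}{(1-k\gamma)(1-\gamma)}}.$$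
   Context: Model. The $n\times p$ random data matrix is $X=\Gamma^{1/2}Z\Sigma^{1/2}$, where $Z$ is $n\times p$, $\Gamma$ is a deterministic $n\times n$ diagonal matrix with nonnegative entries and $\Sigma$ is a deterministic $p\times p$ positive definite matrix. The rows of $X$ are partitioned into $k$ blocks ($k$ fixed), $X=[X_1;\dots;X_k]$ stacked vertically, where $X_i=\Gamma_i^{1/2}Z_i\Sigma^{1/2}$ is $n_i\times p$, $Z_i$ and $\Gamma_i$ are the corresponding submatrices of $Z$ and $\Gamma$, and $n=\sum_i n_i$. Assumptions. (1) The entries of $Z$ are iid (from a fixed distribution) with mean zero, unit variance and finite $(8+c)$-th moment for some $c>0$. (2) The eigenvalues of $\Sigma$ and the entries of $\Gamma$ are uniformly bounded away from zero and infinity. (3) $n_i\to\infty$, $p\to\infty$ with $p/n_i\to\gamma_i\in(0,1)$ for each $i$; consequently $p/n\to\gamma$ with $1/\gamma=\sum_i 1/\gamma_i$. (4) The empirical spectral distribution (uniform distribution on the eigenvalues) of $\Gamma$ converges weakly to $G$, that of each $\Gamma_i$ converges weakly to $G_i$, and that of $\Sigma$ converges weakly to $H$. $H$ is compactly supported away from the origin; $G$ is compactly supported and has no point mass at the origin. Notation. $\mathbb{E}_GT$ is the mean of $T\sim G$. $\eta_G(x)=\mathbb{E}_{T\sim G}\frac{1}{1+xT}$ (the $\eta$-transform), and $f(\gamma,G)=\eta_G^{-1}(1-\gamma)$, where $\eta_G^{-1}$ is the functional inverse of $\eta_G$ on $[0,\infty)$. Interpretation: in the linear model $Y=X\beta+\varepsilon$,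 $IE$ is the ratio of the expected training errors $\mathbb{E}\|Y-X\hat\beta\|^2$ of full-data least squares and of the optimally weighted average of local least squares estimators.
   Formalization: The sequence of problems is assumed to be indexed so that the total sample size n grows at least linearly in the index (as when indexed by n, p or some n_i); for arbitrarily slowly growing sizes with independent arrays almost sure convergence fails. *)

(* Defs.v *)
From HB Require Import structures.
From mathcomp Require Import all_boot all_order all_algebra.
From mathcomp Require Import all_classical all_reals all_analysis.
From mathcomp Require Import polyrcf.

Set Implicit Arguments.
Unset Strict Implicit.
Unset Printing Implicit Defensive.

Import Order.TTheory GRing.Theory Num.Theory.
Import numFieldNormedType.Exports.

Local Open Scope classical_set_scope.
Local Open Scope ring_scope.

Section Matrices.
Variable R : realType.

Definition possemidef n (A : 'M[R]_n) : Prop :=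
  A^T = A /\ forall v : 'rV[R]_n, 0 <= (v *m A *m v^T) 0 0.

Definition posdef n (A : 'M[R]_n) : Prop :=
  A^T = A /\ forall v : 'rV[R]_n, v != 0 -> 0 < (v *m A *m v^T) 0 0.

(* A positive semidefinite matrix has exactly one positive semidefinite square
   root, so the choice is canonical there; sqrtmx A = 0 if there is none. *)
Definition sqrtmx n (A : 'M[R]_n) : 'M[R]_n :=
  xget 0 [set S : 'M[R]_n | possemidef S /\ S *m S = A].

(* The real eigenvalues, listed with algebraic multiplicity. *)
Definition spectrum n (A : 'M[R]_n) : seq R :=
  flatten [seq nseq (mup x (char_poly A)) x | x <- rootsR (char_poly A)].

(* The uniform distribution on the eigenvalues. It is a probability measure
   when A is symmetric and n > 0. *)
Definition esd n (A : 'M[R]_n) : {measure set R -> \bar R} :=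
  mscale (n%:R^-1)%:nng
    (msum (fun j : nat => \d_((spectrum A)`_j)) (size (spectrum A))).

End Matrices.

Section Measures.
Variable R : realType.

Definition weakly_cvg (mu_ : nat -> {measure set R -> \bar R})
    (mu : {measure set R -> \bar R}) : Prop :=
  forall h : R -> R, continuous h -> (exists M : R, forall x, `|h x| <= M) ->
    Rintegral (mu_ N) setT h @[N --> \oo] --> Rintegral mu setT h.

Definition compactly_supported (mu : {measure set R -> \bar R}) : Prop :=
  exists2 K : set R, compact K & mu (~` K) = 0%E.

Definition compactly_supported_off0 (mu : {measure set R -> \bar R}) : Prop :=
  exists K : set R, [/\ compact K, ~ K 0 & mu (~` K) = 0%E].

Definition mean (mu : {measure set R -> \bar R}) : R :=
  Rintegral mu setT id.

Definition eta (mu : {measure set R -> \bar R}) (x : R) : R :=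
  Rintegral mu setT (fun t => (1 + x * t)^-1).

Definition eta_inv (mu : {measure set R -> \bar R}) : R -> R :=
  'pinv_(fun=> 0) `[0, +oo[ (eta mu).

Definition f_eta (gam : R) (mu : {measure set R -> \bar R}) : R :=
  eta_inv mu (1 - gam).

Definition psi (gam : R) (G : {measure set R -> \bar R})
    (gami : R) (Gi : {measure set R -> \bar R}) : R :=
  (gam + (mean G - gam / gami * mean Gi) * f_eta gami Gi)^-1.

End Measures.

Section Probability.
Context d (T : measurableType d) (R : realType) (P : probability T R).

Definition mutually_independent (I : finType) (X : I -> {RV P >-> R}) : Prop :=
  forall (J : {set I}) (B : I -> set R), (forall i, measurable (B i)) ->
    P (\bigcap_(i in [set` J]) (X i @^-1` B i)) =
    (\prod_(i in J) P (X i @^-1` B i))%E.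

Definition iid_with_law (mu : {measure set R -> \bar R})
    (I : finType) (X : I -> {RV P >-> R}) : Prop :=
  mutually_independent X /\
  forall i (B : set R), measurable B -> distribution P (X i) B = mu B.

End Probability.

Section Model.
Variables (R : realType) (k : nat) (nn : 'I_k -> nat) (p : nat).

Definition elliptical_data (g : 'rV[R]_(\sum_(i < k) nn i))
    (Z : 'M[R]_(\sum_(i < k) nn i, p)) (Sigma : 'M[R]_p) :
    'M[R]_(\sum_(i < k) nn i, p) :=
  diag_mx (map_mx Num.sqrt g) *m Z *m sqrtmx Sigma.

Definition IE (X_ : forall i : 'I_k, 'M[R]_(nn i, p)) : R :=
  let n : R := (\sum_(i < k) nn i)%:R in
  let X := \mxcol_(i < k) X_ i in
  (n - p%:R) /
  (n - 2 * p%:R +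
   (\sum_(i < k) (\tr (invmx ((X_ i)^T *m X_ i) *m (X^T *m X)))^-1)^-1).

End Model.

(* Main.v *)
(* Proof idea. The square root of Sigma is symmetric and invertible, so it
   cancels from every trace: tr [(X_i^T X_i)^-1 X^T X] = sum_j tr (S_i^-1 S_j),
   where S_i = Z_i^T Gamma_i Z_i and the term j = i equals p. For j <> i the
   matrix S_j is independent of S_i, and concentration of quadratic forms gives
   tr (S_i^-1 S_j) = tr Gamma_j * tr S_i^-1 + o(n).
   It remains to see that x = tr S_i^-1 tends to f (gamma_i, G_i). Let
   R_t = (S_i + t)^-1. At the level t = tau n_i, rank one row updates and
   concentration of z_j^T R z_j around tr R give
   eta_{Gamma_i} (tr R_t) = 1 - p / n_i + O(tau). No bound on the smallest
   singular value is used to let t decrease to 0: the inverse of (R_t)_ll is a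
   Schur complement, that is t plus a quadratic form in the l-th column whose
   matrix is independent of that column, and it is at least c n_i except with
   probability O(n_i^-3). Hence tr R_t stays bounded down to t = 1 / n_i, and the
   same Schur complements show that it moves by O(tau) between the two levels.
   Eighth moments give bad events of probability O(n_i^-2), and Borel-Cantelli
   applies. The denominator of the limit is positive by Jensen's inequality for
   the eta transform. *)

Require Import Defs.
From HB Require Import structures.
From mathcomp Require Import all_boot all_order all_algebra.
From mathcomp Require Import all_classical all_reals all_analysis.
From mathcomp Require Import measurable_realfun ring lra.
From mathcomp Require Import polyrcf complex spectral.

Set Implicit Arguments.
Unset Strict Implicit.
Unset Printing Implicit Defensive.

Import Order.TTheory GRing.Theory Num.Theory.
Import numFieldNormedType.Exports.

Local Open Scope classical_set_scope.
Local Open Scope ring_scope.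

(** * Decoupling of independent families *)

Section Decoupling.
Local Open Scope ereal_scope.
Context d (T : measurableType d) (R : realType) (P : probability T R).

(** Problems of different index share only the law of their entries. Every estimate is therefore a
    probability bound summable in the index, and the moment bounds fix their constants before the
    probability space. Two levels of [t] are forced by an asymmetry between rows and columns.
    Removing a row moves the trace of the resolvent by up to [1/t], and row fluctuations involve the
    Frobenius bound [p/t^2]: harmless for [t] of order [n], worthless for [t] near 0. Removing a
    column leads to [1 - V R V^T], a contraction of trace at least [n - p] at every level, so column
    fluctuations do not see [t]. Rows identify the limit at the high level and columns carry it
    down. From [t = 1/n] to [t = 0] nothing random is left: a bound on the trace of an inverse is
    already a lower bound on the smallest eigenvalue. Only the lower bound on the Schur complements
    must hold for all columns at once. All other deviations are controlled on average, where fourth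
    moments give a summable rate without a union bound. *)

Lemma g_sigma_algebra_sub (G : set (set T)) :
  G `<=` measurable -> <<s G >> `<=` (measurable : set (set T)).
Proof. by move=> Gm; apply: smallest_sub => //; exact: sigma_algebra_measurable. Qed.

Lemma dynkin_indep (G : set (set T)) (B : set T) :
  G `<=` measurable -> setI_closed G -> measurable B ->
  (forall A, G A -> P (A `&` B) = P A * P B) ->
  forall A, <<s G >> A -> P (A `&` B) = P A * P B.
Proof.
move=> Gm GI mB GB.
have sGm := g_sigma_algebra_sub Gm.
have fP A : measurable A -> P A \is a fin_num by move=> ?; exact: fin_num_measure.
apply: (@dynkin_induction _ (g_sigma_algebraType G) G
  (fun A => P (A `&` B) = P A * P B)) => //.
- by rewrite setTI probability_setT mul1e.
- move=> S /sGm mS IH.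
  rewrite (probability_setC P mS) setIC -setDE measureD //; last first.
    by rewrite ltey_eq fP.
  rewrite setIC [X in _ - X]IH -(fineK (fP _ mS)) -(fineK (fP _ mB)).
  by rewrite -EFinM -!EFinB -EFinM mulrBl mul1r EFinB fineK ?fP.
- move=> F mF tF IH.
  have mF' n : measurable (F n : set T) by apply: sGm; exact: mF.
  rewrite setI_bigcupl !measure_bigcup //=.
  + rewrite [RHS]muleC -(fineK (fP _ mB)) -nneseriesZl //.
    by apply: eq_eseriesr => n _; rewrite IH fineK ?fP// muleC.
  + by move=> n _; exact: measurableI.
  + exact: trivIset_setIr.
Qed.

Variables G1 G2 : set (set T).
Hypotheses (G1m : G1 `<=` measurable) (G2m : G2 `<=` measurable).
Hypotheses (G1I : setI_closed G1) (G2I : setI_closed G2).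
Hypothesis G12 : forall A B, G1 A -> G2 B -> P (A `&` B) = P A * P B.

Lemma g_sigma_indep A B : <<s G1 >> A -> <<s G2 >> B -> P (A `&` B) = P A * P B.
Proof.
move=> sA sB; apply: (dynkin_indep G1m G1I) => //.
  exact: (g_sigma_algebra_sub G2m).
move=> A' GA'; rewrite setIC muleC; apply: (dynkin_indep G2m G2I) => //.
  exact: G1m.
by move=> B' GB'; rewrite setIC muleC; exact: G12.
Qed.

Local Notation T1 := (g_sigma_algebraType G1).
Local Notation T2 := (g_sigma_algebraType G2).

(** The sample space itself, carrying each sigma-algebra in turn, serves as value space.
    Independence says that [w] to [(w, w)] pushes [P] to the product of its two restrictions, since
    they agree on rectangles; Tonelli then separates the variables. *)
Lemma decoupling (h : T1 * T2 -> \bar R) :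
  measurable_fun [set: T1 * T2] h -> (forall z, 0 <= h z) ->
  \int[P]_w h (w, w) = \int[P]_w \int[P]_u h (u, w).
Proof.
move=> mh h0.
have m1 : measurable_fun [set: T] (id : T -> T1).
  by move=> _ A mA; rewrite setTI; exact: (g_sigma_algebra_sub G1m).
have m2 : measurable_fun [set: T] (id : T -> T2).
  by move=> _ A mA; rewrite setTI; exact: (g_sigma_algebra_sub G2m).
have m12 : measurable_fun [set: T] (fun w : T => (w : T1, w : T2)).
  exact: (measurable_fun_pair m1 m2).
pose X1 : {RV P >-> T1} := HB.pack (id : T -> T1) (isMeasurableFun.Build _ _ _ _ _ m1).
pose X2 : {RV P >-> T2} := HB.pack (id : T -> T2) (isMeasurableFun.Build _ _ _ _ _ m2).
pose X12 : {RV P >-> (T1 * T2)%type} :=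
  HB.pack (fun w : T => (w : T1, w : T2)) (isMeasurableFun.Build _ _ _ _ _ m12).
transitivity (\int[distribution P X12]_z h z).
  by rewrite ge0_integral_distribution.
transitivity (\int[distribution P X1 \x distribution P X2]_z h z).
  apply: eq_measure_integral => /= A mA _; apply/esym.
  apply: product_measure_unique => //= A1 A2 mA1 mA2.
  exact: g_sigma_indep.
rewrite fubini_tonelli1 // fubini_tonelli // ge0_integral_distribution //=.
- by apply: eq_integral => w _; rewrite /fubini_G ge0_integral_distribution//; exact: measurableT_comp.
- exact: measurable_fun_fubini_tonelli_G.
- by move=> ?; exact: integral_ge0.
Qed.

End Decoupling.

Section Cylinders.
Local Open Scope ereal_scope.
Context d (T : measurableType d) (R : realType) (P : probability T R).
Variables (I : finType) (X : I -> {RV P >-> R}).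

(** A pi-system that generates the sigma-algebra of the variables indexed by [J]. Keeping it on [T]
    lets random matrices stay functions of the sample point. *)
Definition cyl (J : {set I}) : set (set T) :=
  [set A | exists2 B : I -> set R, (forall i, measurable (B i)) &
     A = \bigcap_(i in [set` J]) (X i @^-1` B i)].

Definition sigma_of (J : {set I}) := g_sigma_algebraType (cyl J).

Lemma measurable_RV_preimage i (B : set R) : measurable B -> measurable (X i @^-1` B).
Proof. by move=> mB; rewrite -[_ @^-1` _]setTI; exact: measurable_funP. Qed.

Lemma cyl_measurable J : cyl J `<=` measurable.
Proof.
move=> _ [B mB ->]; apply: fin_bigcap_measurable; first exact: finite_finset.
by move=> i _; exact: measurable_RV_preimage.
Qed.

Lemma cyl_setI J : setI_closed (cyl J).
Proof.
move=> _ _ [B mB ->] [C mC ->]; exists (fun i => B i `&` C i).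
  by move=> i; exact: measurableI.
by rewrite -bigcapI; apply: eq_bigcapr => i _; rewrite preimage_setI.
Qed.

Lemma cyl_indep (J1 J2 : {set I}) : mutually_independent X ->
  {in J1, forall i, i \notin J2} -> forall A B, cyl J1 A -> cyl J2 B ->
  P (A `&` B) = P A * P B.
Proof.
move=> indX J12 _ _ [B mB ->] [C mC ->].
(* The index sets are disjoint, so one family [D] describes both cylinders and their intersection is
   again a cylinder. *)
pose D i := if i \in J1 then B i else C i.
have mD i : measurable (D i) by rewrite /D; case: ifP.
have -> : \bigcap_(i in [set` J1]) (X i @^-1` B i) =
    \bigcap_(i in [set` J1]) (X i @^-1` D i).
  by apply: eq_bigcapr => i /= iJ; rewrite /D iJ.
have -> : \bigcap_(i in [set` J2]) (X i @^-1` C i) =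
    \bigcap_(i in [set` J2]) (X i @^-1` D i).
  apply: eq_bigcapr => i /= iJ; rewrite /D ifF //.
  by apply/negP => /J12; rewrite iJ.
rewrite -bigcap_setU.
have -> : [set` J1] `|` [set` J2] = [set` J1 :|: J2] :> set I.
  by apply/seteqP; split => i /=; rewrite inE => /orP.
rewrite !indX // -bigU /=; last by rewrite disjoint_subset; apply/fintype.subsetP => i /J12; rewrite !inE.
by apply: eq_bigl => i; rewrite !inE.
Qed.

Lemma measurable_coord (J : {set I}) i : i \in J ->
  measurable_fun [set: sigma_of J] (X i : sigma_of J -> R).
Proof.
move=> iJ _ A mA; rewrite setTI; apply: sub_sigma_algebra.
exists (fun j => if j == i then A else setT).
  by move=> j; case: ifP.
apply/seteqP; split => w /=.
  by move=> Aw j _; case: eqP => [->|].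
by move=> /(_ i iJ) /=; rewrite eqxx.
Qed.

Lemma sub_measurable_fun (J : {set I}) d' (U : measurableType d') (f : T -> U) :
  measurable_fun [set: sigma_of J] (f : sigma_of J -> U) -> measurable_fun setT f.
Proof.
move=> mf _ A mA; rewrite setTI.
apply: (g_sigma_algebra_sub (@cyl_measurable J)).
by rewrite -[_ @^-1` _]setTI; exact: mf.
Qed.

Lemma decoupling_family (J1 J2 : {set I}) (h : T * T -> \bar R) :
  mutually_independent X -> {in J1, forall i, i \notin J2} ->
  measurable_fun [set: sigma_of J1 * sigma_of J2] h -> (forall z, 0 <= h z) ->
  \int[P]_w h (w, w) = \int[P]_w \int[P]_u h (u, w).
Proof.
move=> indX J12; apply: decoupling; try exact: cyl_measurable; try exact: cyl_setI.
exact: cyl_indep.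
Qed.

End Cylinders.

(** * Moments of linear and quadratic forms *)

Section PointwiseStep.
Variable R : realType.
Implicit Types q y l u s th : R.

(** The term linear in [y] is kept exact, because it will integrate to zero; everything else is
    absorbed into the two extreme even terms. The constants 39 and 18 are chosen to serve both
    exponents, the difference being a sum of squares. *)
Lemma pow_step_ineq k q y : (k \in [:: 2; 3])%N ->
  (q + y) ^+ (2 * k) <= q ^+ (2 * k) + (2 * k)%:R * q ^+ (2 * k).-1 * y +
    39 * (q ^+ (2 * k.-1) * y ^+ 2) + 18 * y ^+ (2 * k).
Proof.
rewrite !inE => /orP[] /eqP -> /=; rewrite -subr_ge0.
  rewrite [X in 0 <= X](_ : _ =
    2 * (y * (q - y)) ^+ 2 + 31 * (q * y) ^+ 2 + 15 * (y ^+ 2) ^+ 2); last by ring.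
  by rewrite !addr_ge0// mulr_ge0// sqr_ge0.
rewrite [X in 0 <= X](_ : _ =
    10 * (q * y * (q - y)) ^+ 2 + 3 * (y ^+ 2 * (q - y)) ^+ 2 +
    14 * (y * (q ^+ 2 - y ^+ 2)) ^+ 2); last by ring.
by rewrite !addr_ge0// mulr_ge0// sqr_ge0.
Qed.

(** According to whether [l^2 <= th * q^2] or not, the first or the second term on the right
    suffices alone. *)
Lemma young_pow k q l th : 0 < th -> (0 < k)%N ->
  q ^+ (2 * k.-1) * l ^+ 2 <= th * q ^+ (2 * k) + th^-1 ^+ k.-1 * l ^+ (2 * k).
Proof.
move=> th0; case: k => // k _ /=; rewrite ![_ ^+ (2 * _)]exprM.
have q0 := sqr_ge0 q; have l0 := sqr_ge0 l.
move: (q ^+ 2) (l ^+ 2) q0 l0 => {}q {}l q0 l0.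
have [lq|/ltW ql] := leP l (th * q).
  rewrite (@le_trans _ _ (th * q ^+ k.+1))//.
    by rewrite exprS mulrCA mulrA mulrC ler_wpM2r ?exprn_ge0// mulrC.
  by rewrite lerDl mulr_ge0 ?exprn_ge0// invr_ge0 ltW.
rewrite (@le_trans _ _ (th^-1 ^+ k * l ^+ k.+1))//.
  rewrite exprSr mulrA ler_wpM2r// -exprMn lerXn2r ?nnegrE//.
    by rewrite mulr_ge0// invr_ge0 ltW.
  by rewrite ler_pdivlMl.
by rewrite lerDr mulr_ge0 ?exprn_ge0// ltW.
Qed.

(** At [th = s / u] the two terms of Young's inequality balance: each equals [u^(k-1) * s]. *)
Lemma young_pow_sum k u s : 0 < u -> 0 < s -> (0 < k)%N ->
  (s / u) * u ^+ k + (s / u)^-1 ^+ k.-1 * s ^+ k = 2 * (u ^+ k.-1 * s).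
Proof.
move=> u0 s0; case: k => // k _ /=.
rewrite invf_div exprMn exprVn !exprS.
have un : u != 0 by rewrite gt_eqF.
have sn : s ^+ k != 0 by rewrite expf_neq0// gt_eqF.
by field; rewrite un sn.
Qed.

Lemma pow_sum_ge k u (v : R) : (k \in [:: 2; 3])%N -> 0 <= u -> 0 <= v ->
  u ^+ k + u ^+ k.-1 * v + v ^+ k <= (u + v) ^+ k.
Proof.
rewrite !inE => /orP[] /eqP -> /= u0 v0; rewrite -subr_ge0.
  by rewrite [X in 0 <= X](_ : _ = u * v); [rewrite mulr_ge0|ring].
rewrite [X in 0 <= X](_ : _ = 2 * (u ^+ 2 * v) + 3 * (u * v ^+ 2)); last by ring.
by rewrite addr_ge0// !mulr_ge0// exprn_ge0.
Qed.

(** The balanced Young parameter [s / u] requires positive [u] and [s]; this passes to the boundary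
    by continuity. *)
Lemma le_pow_eps k (x v : R) : (forall e, 0 < e -> x <= (v + e) ^+ k) -> x <= v ^+ k.
Proof.
move=> H.
have ve0 : v + e @[e --> 0^'+] --> v + 0.
  by apply: cvgD; [exact: cvg_cst|exact: cvg_at_right_filter].
have ve := @continuous_cvg _ _ _ _ _ _ (fun z : R => z ^+ k) _ (@exprn_continuous _ k _) ve0.
rewrite -[v]addr0.
have xx : (cst x : R -> R) e @[e --> 0^'+] --> x by exact: cvg_cst.
apply: (ler_cvg_to xx (ve _)).
by near=> e; apply: H; near: e; exact: nbhs_right_gt.
Unshelve. all: by end_near. Qed.

End PointwiseStep.

Section MomentStep.
Local Open Scope ereal_scope.
Context d (T : measurableType d) (R : realType) (P : probability T R).

Lemma integral_cst_prob (A : R) : \int[P]_w A%:E = A%:E.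
Proof. by rewrite -[RHS]mule1 -(@probability_setT _ _ _ P) -integral_cst. Qed.

Lemma integral_pow_step (k : nat) (c : T -> R) (q l m : R) :
  (k \in [:: 2; 3])%N -> P.-integrable setT (EFin \o c) ->
  \int[P]_w (c w)%:E = 0 ->
  \int[P]_w (c w ^+ 2)%:E <= m%:E -> \int[P]_w (c w ^+ (2 * k))%:E <= m%:E ->
  \int[P]_w ((q + c w * l) ^+ (2 * k))%:E <=
  (q ^+ (2 * k) + 39 * m * (q ^+ (2 * k.-1) * l ^+ 2) + 18 * m * l ^+ (2 * k))%:E.
Proof.
move=> hk ic c0 c2 c2k.
have mc : measurable_fun setT c by apply/measurable_EFinP; case/integrableP: ic.
have even_ge0 (x : R) j : (0 <= x ^+ (2 * j))%R by rewrite exprM exprn_ge0// sqr_ge0.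
have m2 : measurable_fun setT (fun w => c w ^+ 2)%R by exact: measurable_funX.
have m2k : measurable_fun setT (fun w => c w ^+ (2 * k))%R by exact: measurable_funX.
have i2 : P.-integrable setT (EFin \o (fun w => c w ^+ 2)%R).
  apply/integrableP; split; first exact/measurable_EFinP.
  under eq_integral do rewrite /= ger0_norm ?sqr_ge0//.
  exact: le_lt_trans c2 (ltry _).
have i2k : P.-integrable setT (EFin \o (fun w => c w ^+ (2 * k))%R).
  apply/integrableP; split; first exact/measurable_EFinP.
  under eq_integral do rewrite /= ger0_norm ?even_ge0//.
  exact: le_lt_trans c2k (ltry _).
pose A := (q ^+ (2 * k))%R; pose B := ((2 * k)%:R * q ^+ (2 * k).-1 * l)%R.
pose C := (39 * (q ^+ (2 * k.-1) * l ^+ 2))%R; pose D := (18 * l ^+ (2 * k))%R.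
have iA : P.-integrable setT (EFin \o cst A) by exact: finite_measure_integrable_cst.
have iB : P.-integrable setT (fun w => B%:E * (c w)%:E) by exact: integrableZl.
have iC : P.-integrable setT (fun w => C%:E * (c w ^+ 2)%:E) by exact: integrableZl.
have iD : P.-integrable setT (fun w => D%:E * (c w ^+ (2 * k))%:E) by exact: integrableZl.
have iAB : P.-integrable setT (fun w => (EFin \o cst A) w + B%:E * (c w)%:E).
  exact: integrableD.
have iABC : P.-integrable setT (fun w => (EFin \o cst A) w + B%:E * (c w)%:E + C%:E * (c w ^+ 2)%:E).
  exact: (integrableD _ iAB iC).
have iABCD := integrableD measurableT iABC iD.
apply: (@le_trans _ _ (\int[P]_w ((EFin \o cst A) w + B%:E * (c w)%:E +
    C%:E * (c w ^+ 2)%:E + D%:E * (c w ^+ (2 * k))%:E))).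
  apply: ge0_le_integral => //.
  - by move=> w _; rewrite lee_fin even_ge0.
  - apply/measurable_EFinP; apply: measurable_funX; apply: measurable_funD => //.
    exact: measurable_funM.
  - exact: (measurable_int _ iABCD).
  - move=> w _; rewrite -!EFinM -!EFinD lee_fin /=.
    apply: le_trans (pow_step_ineq _ _ hk) _.
    rewrite le_eqVlt; apply/orP; left; apply/eqP.
    by rewrite /A /B /C /D !exprMn; ring.
rewrite (integralD measurableT iABC iD) (integralD measurableT iAB iC).
rewrite (integralD measurableT iA iB) !integralZl // c0 mule0 adde0.
rewrite integral_cst_prob.
rewrite !EFinD; apply: leeD; first apply: leeD => //.
- apply: (@le_trans _ _ (C%:E * m%:E)).
    apply: lee_wpmul2l; rewrite // lee_fin /C; apply: mulr_ge0 => //.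
    by apply: mulr_ge0; [exact: even_ge0|exact: sqr_ge0].
  by rewrite -EFinM lee_fin /C le_eqVlt; apply/orP; left; apply/eqP; ring.
- apply: (@le_trans _ _ (D%:E * m%:E)).
    by apply: lee_wpmul2l; rewrite // lee_fin /D; apply: mulr_ge0 => //; exact: even_ge0.
  by rewrite -EFinM lee_fin /D le_eqVlt; apply/orP; left; apply/eqP; ring.
Qed.

Variables (I : finType) (X : I -> {RV P >-> R}).
Hypothesis indX : mutually_independent X.

(** A step of Burkholder type. The numbers [u] and [s] bound squares of L^(2k) norms, and these
    squares add up to a constant factor; iterating over the variables thus yields sums of squares,
    as for variances. Decoupling freezes [Q] and [L] while the centred [c] is integrated. *)
Lemma moment_step (k : nat) (J1 J2 : {set I}) (c Q L : T -> R) (m u s : R) :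
  (k \in [:: 2; 3])%N -> {in J1, forall i, i \notin J2} ->
  measurable_fun [set: sigma_of X J1] (c : sigma_of X J1 -> R) ->
  measurable_fun [set: sigma_of X J2] (Q : sigma_of X J2 -> R) ->
  measurable_fun [set: sigma_of X J2] (L : sigma_of X J2 -> R) ->
  P.-integrable setT (EFin \o c) -> \int[P]_w (c w)%:E = 0 ->
  \int[P]_w (c w ^+ 2)%:E <= m%:E -> \int[P]_w (c w ^+ (2 * k))%:E <= m%:E ->
  (0 <= u)%R -> (0 <= s)%R ->
  \int[P]_w (Q w ^+ (2 * k))%:E <= (u ^+ k)%:E ->
  \int[P]_w (L w ^+ (2 * k))%:E <= (s ^+ k)%:E ->
  \int[P]_w ((Q w + c w * L w) ^+ (2 * k))%:E <= ((u + (78 * m + 1) * s) ^+ k)%:E.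
Proof.
move=> hk J12 mc mQ mL ic c0 c2 c2k u0 s0 Qu Ls.
have even_ge0 (x : R) j : (0 <= x ^+ (2 * j))%R by rewrite exprM exprn_ge0// sqr_ge0.
have k0 : (0 < k)%N by move: hk; rewrite !inE => /orP[] /eqP ->.
have m0 : (0 <= m)%R.
  by rewrite -lee_fin (le_trans _ c2)// integral_ge0// => w _; rewrite lee_fin sqr_ge0.
have mQ' : measurable_fun setT Q by exact: sub_measurable_fun mQ.
have mL' : measurable_fun setT L by exact: sub_measurable_fun mL.
pose h (z : T * T) : \bar R := ((Q z.2 + c z.1 * L z.2) ^+ (2 * k))%:E.
rewrite [leLHS](_ : _ = \int[P]_w \int[P]_u h (u, w)); last first.
  apply: (decoupling_family (h := h) indX J12) => [|z]; last by rewrite lee_fin even_ge0.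
  apply/measurable_EFinP; apply: measurable_funX; apply: measurable_funD.
    exact: (measurableT_comp mQ).
  apply: measurable_funM; [exact: (measurableT_comp mc)|exact: (measurableT_comp mL)].
pose g w := (Q w ^+ (2 * k) + 39 * m * (Q w ^+ (2 * k.-1) * L w ^+ 2) +
             18 * m * L w ^+ (2 * k))%R.
have g0 w : (0 <= g w)%R.
  rewrite /g; apply: addr_ge0; first apply: addr_ge0; first exact: even_ge0.
    apply: mulr_ge0; first exact: mulr_ge0.
    by apply: mulr_ge0; [exact: even_ge0|exact: sqr_ge0].
  by apply: mulr_ge0; [exact: mulr_ge0|exact: even_ge0].
apply: (@le_trans _ _ (\int[P]_w (g w)%:E)).
  apply: ge0_le_integral => //.
  - by move=> w _; apply: integral_ge0 => v _; rewrite lee_fin even_ge0.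
  - apply: measurable_fun_fubini_tonelli_G => [|z]; last by rewrite lee_fin even_ge0.
    apply/measurable_EFinP; apply: measurable_funX; apply: measurable_funD.
      exact: (measurableT_comp mQ').
    apply: measurable_funM; last exact: (measurableT_comp mL').
    exact: (measurableT_comp (sub_measurable_fun mc)).
  - apply/measurable_EFinP; rewrite /g.
    apply: measurable_funD; first apply: measurable_funD; first exact: measurable_funX.
      by apply: measurable_funM => //; apply: measurable_funM; exact: measurable_funX.
    by apply: measurable_funM => //; exact: measurable_funX.
  - by move=> w _; rewrite /h /g /=; apply: integral_pow_step.
have mQk : measurable_fun setT (fun w => (Q w ^+ (2 * k))%:E).
  by apply/measurable_EFinP; exact: measurable_funX.
have mLk : measurable_fun setT (fun w => (L w ^+ (2 * k))%:E).
  by apply/measurable_EFinP; exact: measurable_funX.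
have gle u' s' : (0 < u')%R -> (0 < s')%R ->
    \int[P]_w (Q w ^+ (2 * k))%:E <= (u' ^+ k)%:E ->
    \int[P]_w (L w ^+ (2 * k))%:E <= (s' ^+ k)%:E ->
    \int[P]_w (g w)%:E <= ((u' + (78 * m + 1) * s') ^+ k)%:E.
  (* The balanced parameter of [young_pow_sum]; its factor 2 turns 39 into 78. *)
  move=> u'0 s'0 Qu' Ls'; pose th := (s' / u')%R.
  have th0 : (0 < th)%R by rewrite divr_gt0.
  pose al := (1 + 39 * m * th)%R.
  pose be := (39 * m * th^-1 ^+ k.-1 + 18 * m)%R.
  have m39 : (0 <= 39 * m)%R by exact: mulr_ge0.
  have m18 : (0 <= 18 * m)%R by exact: mulr_ge0.
  have al0 : (0 <= al)%R by apply: addr_ge0 => //; apply: mulr_ge0 => //; exact: ltW.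
  have be0 : (0 <= be)%R.
    by apply: addr_ge0 => //; apply: mulr_ge0 => //; rewrite exprn_ge0// invr_ge0 ltW.
  apply: (@le_trans _ _ (\int[P]_w (al%:E * (Q w ^+ (2 * k))%:E + be%:E * (L w ^+ (2 * k))%:E))).
    apply: ge0_le_integral => //.
    - by move=> w _; rewrite lee_fin.
    - apply/measurable_EFinP; rewrite /g.
      apply: measurable_funD; first apply: measurable_funD; first exact: measurable_funX.
        by apply: measurable_funM => //; apply: measurable_funM; exact: measurable_funX.
      by apply: measurable_funM => //; exact: measurable_funX.
    - by apply: emeasurable_funD; apply: measurable_funeM.
    - move=> w _; rewrite -!EFinM -EFinD lee_fin /g.
      have := ler_wpM2l m39 (young_pow (Q w) (L w) th0 k0).
      by rewrite /al /be; lra.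
  rewrite ge0_integralD //; last 4 first.
    - by move=> w _; rewrite mule_ge0// lee_fin.
    - exact: measurable_funeM.
    - by move=> w _; rewrite mule_ge0// lee_fin.
    - exact: measurable_funeM.
  rewrite !ge0_integralZl // ?lee_fin //; try by (move=> w _; rewrite lee_fin).
  apply: (@le_trans _ _ (al%:E * (u' ^+ k)%:E + be%:E * (s' ^+ k)%:E)).
    by apply: leeD; apply: lee_wpmul2l; rewrite ?lee_fin.
  rewrite -!EFinM -EFinD lee_fin.
  have Y := young_pow_sum u'0 s'0 k0.
  have v0 : (0 <= (78 * m + 1) * s')%R by rewrite mulr_ge0// ?addr_ge0 ?mulr_ge0// ltW.
  apply: le_trans (pow_sum_ge hk (ltW u'0) v0).
  rewrite (_ : al * u' ^+ k + be * s' ^+ k =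
     u' ^+ k + 78 * m * (u' ^+ k.-1 * s') + 18 * m * s' ^+ k)%R; last first.
    rewrite /al /be /th; transitivity (u' ^+ k + 39 * m * ((s' / u') * u' ^+ k + (s' / u')^-1 ^+ k.-1 * s' ^+ k) + 18 * m * s' ^+ k)%R; first by ring.
    by rewrite Y; ring.
  have us0 : (0 <= u' ^+ k.-1 * s')%R by rewrite mulr_ge0 ?exprn_ge0// ltW.
  have sk0 : (0 <= s' ^+ k)%R by rewrite exprn_ge0// ltW.
  (* The [+ 1] in the constant is there for this: a base at least 1 is below its powers, so the top
     order term is absorbed as well. *)
  have mk : (18 * m <= (78 * m + 1) ^+ k)%R.
    apply: (@le_trans _ _ (78 * m + 1)%R); first lra.
    by rewrite ler_eXnr// lerDr mulr_ge0.
  rewrite exprMn; apply: lerD; last by rewrite ler_wpM2r.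
  by rewrite lerD2l; move: us0; lra.
have gfin : \int[P]_w (g w)%:E \is a fin_num.
  rewrite ge0_fin_numE ?integral_ge0//; last first.
    by move=> w _; rewrite lee_fin.
  apply: le_lt_trans (ltry _); apply: (gle (u + 1)%R (s + 1)%R).
  - by rewrite ltr_wpDl.
  - by rewrite ltr_wpDl.
  - by rewrite (le_trans Qu)// lee_fin lerXn2r// ?nnegrE ?lerDl// addr_ge0.
  - by rewrite (le_trans Ls)// lee_fin lerXn2r// ?nnegrE ?lerDl// addr_ge0.
rewrite -(fineK gfin) lee_fin; apply: le_pow_eps => e e0.
have K0 : (0 < 78 * m + 2)%R by rewrite ltr_wpDl// mulr_ge0.
(* Both [u] and [s] are raised by this amount; the weights [1] and [78 * m + 1] add up to the
   divisor. *)
have e'0 : (0 < e / (78 * m + 2))%R by rewrite divr_gt0.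
rewrite (_ : u + (78 * m + 1) * s + e =
   (u + e / (78 * m + 2)) + (78 * m + 1) * (s + e / (78 * m + 2)))%R; last first.
  by field; rewrite gt_eqF.
rewrite -lee_fin fineK//; apply: gle.
- by rewrite ltr_wpDl.
- by rewrite ltr_wpDl.
- by rewrite (le_trans Qu)// lee_fin lerXn2r// ?nnegrE ?lerDl ?addr_ge0// ltW.
- by rewrite (le_trans Ls)// lee_fin lerXn2r// ?nnegrE ?lerDl ?addr_ge0// ltW.
Qed.

End MomentStep.

Section Forms.
Variables (R : realType) (I : eqType).
Implicit Types (x a : I -> R) (b : I -> I -> R) (s : seq I).

Definition linform a x s : R := \sum_(i <- s) a i * x i.

(** The off-diagonal part of a quadratic form, built one variable at a time: the new [x i]
    multiplies a linear form in the others, which is the shape [Q + c * L] of [moment_step]. *)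
Fixpoint chaos b x s : R :=
  if s is i :: s' then chaos b x s' + x i * linform (b i) x s' else 0.

(** The variance of [chaos] for independent centred variables of unit variance. *)
Fixpoint chaos_var b s : R :=
  if s is i :: s' then chaos_var b s' + \sum_(j <- s') b i j ^+ 2 else 0.

Lemma chaos_var_ge0 b s : 0 <= chaos_var b s.
Proof.
by elim: s => //= i s IH; rewrite addr_ge0// sumr_ge0// => j _; exact: sqr_ge0.
Qed.

Lemma quad_chaosE (M : I -> I -> R) x s :
  \sum_(i <- s) \sum_(j <- s) M i j * x i * x j =
  \sum_(i <- s) M i i * x i ^+ 2 + chaos (fun i j => M i j + M j i) x s.
Proof.
elim: s => [|i s IH]; first by rewrite !big_nil addr0.
rewrite /= !big_cons.
under [X in _ + X = _]eq_bigr do rewrite big_cons.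
rewrite big_split /= IH /linform.
rewrite [X in _ = _ + (_ + X)]mulr_sumr.
rewrite (_ : \sum_(j <- s) x i * ((M i j + M j i) * x j) =
  \sum_(j <- s) M i j * x i * x j + \sum_(j <- s) M j i * x j * x i).
  by ring.
by rewrite -big_split /=; apply: eq_bigr => j _; ring.
Qed.

Lemma chaos_var_le (M : I -> I -> R) s :
  chaos_var (fun i j => M i j + M j i) s <=
  2 * \sum_(i <- s) \sum_(j <- s) M i j ^+ 2.
Proof.
elim: s => [|i s IH]; first by rewrite big_nil mulr0.
rewrite /= !big_cons.
under [X in _ <= 2 * (_ + X)]eq_bigr do rewrite big_cons.
rewrite big_split /=.
have : \sum_(j <- s) (M i j + M j i) ^+ 2 <=
    2 * (\sum_(j <- s) M i j ^+ 2) + 2 * (\sum_(j <- s) M j i ^+ 2).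
  rewrite !mulr_sumr -big_split /=; apply: ler_sum => j _.
  by rewrite -subr_ge0 (_ : _ - _ = (M i j - M j i) ^+ 2) ?sqr_ge0//; ring.
have := sqr_ge0 (M i i).
by move: IH; lra.
Qed.

End Forms.

Section FormMoments.
Local Open Scope ereal_scope.
Context d (T : measurableType d) (R : realType) (P : probability T R).
Variables (I : finType) (X : I -> {RV P >-> R}).
Hypothesis indX : mutually_independent X.
Variables (phi : R -> R) (k : nat) (m : R).
Hypothesis mphi : measurable_fun setT phi.
Hypothesis hk : (k \in [:: 2; 3])%N.
Hypothesis phi_int : forall i, P.-integrable setT (fun w => (phi (X i w))%:E).
Hypothesis phi_mean : forall i, \int[P]_w (phi (X i w))%:E = 0.
Hypothesis phi_var : forall i, \int[P]_w (phi (X i w) ^+ 2)%:E <= m%:E.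
Hypothesis phi_mom : forall i, \int[P]_w (phi (X i w) ^+ (2 * k))%:E <= m%:E.

Let x w i := phi (X i w).
Let K : R := (78 * m + 1)%R.

Lemma measurable_phi (J : {set I}) i : i \in J ->
  measurable_fun [set: sigma_of X J] ((fun w => x w i) : sigma_of X J -> R).
Proof. by move=> iJ; apply: (measurableT_comp mphi); exact: measurable_coord. Qed.

Lemma measurable_linform (J : {set I}) a s : {subset s <= J} ->
  measurable_fun [set: sigma_of X J] ((fun w => linform a (x w) s) : sigma_of X J -> R).
Proof.
rewrite /linform; elim: s => [_|i s IH sJ].
  by under eq_fun do rewrite big_nil; exact: measurable_cst.
under eq_fun do rewrite big_cons; apply: measurable_funD.
  by apply: measurable_funM => //; apply: measurable_phi; rewrite sJ// mem_head.
by apply: IH => j js; rewrite sJ// in_cons js orbT.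
Qed.

Lemma measurable_chaos (J : {set I}) b s : {subset s <= J} ->
  measurable_fun [set: sigma_of X J] ((fun w => chaos b (x w) s) : sigma_of X J -> R).
Proof.
elim: s => [_|i s IH sJ] /=; first exact: measurable_cst.
have sJ' : {subset s <= J} by move=> j js; rewrite sJ// in_cons js orbT.
apply: measurable_funD; first exact: IH.
by apply: measurable_funM; [apply: measurable_phi; rewrite sJ// mem_head|exact: measurable_linform].
Qed.

Lemma phi_moment_ge0 (i : I) : (0 <= m)%R.
Proof.
rewrite -lee_fin (le_trans _ (phi_var i))// integral_ge0// => w _.
by rewrite lee_fin sqr_ge0.
Qed.

Lemma integral_pow0 : \int[P]_w ((0 : R) ^+ (2 * k))%:E <= 0.
Proof.
by rewrite integral0_eq// => w _; move: hk; rewrite !inE => /orP[] /eqP ->; rewrite expr0n.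
Qed.

(** Induction with [L] constant. The function [phi] will be a centred square, possibly truncated,
    for the diagonal of a quadratic form; for the off-diagonal part it is the identity. *)
Lemma linform_moment a s : uniq s ->
  \int[P]_w (linform a (x w) s ^+ (2 * k))%:E <=
  ((K * \sum_(i <- s) a i ^+ 2) ^+ k)%:E.
Proof.
elim: s => [_|i s IH /= /andP[iNs us]].
  rewrite /linform big_nil; under eq_integral do rewrite big_nil.
  by rewrite (le_trans integral_pow0)// lee_fin exprn_ge0// mulr0.
have K0 : (0 <= K)%R by rewrite addr_ge0// mulr_ge0// (phi_moment_ge0 i).
rewrite big_cons mulrDr addrC.
rewrite [leLHS](_ : _ = \int[P]_w
  ((linform a (x w) s + x w i * cst (a i) w) ^+ (2 * k))%:E); last first.
  by apply: eq_integral => w _; rewrite /linform big_cons addrC mulrC.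
apply: (@moment_step _ _ _ P _ X indX k [set i] [set j in s]
  (fun w => x w i) (fun w => linform a (x w) s) (cst (a i))).
- exact: hk.
- by move=> j; rewrite !inE => /eqP ->.
- by apply: measurable_phi; rewrite inE.
- by apply: measurable_linform => j; rewrite inE.
- exact: measurable_cst.
- exact: phi_int.
- exact: phi_mean.
- exact: phi_var.
- exact: phi_mom.
- by rewrite mulr_ge0// sumr_ge0// => j _; exact: sqr_ge0.
- exact: sqr_ge0.
- exact: IH.
- by under eq_integral do rewrite /=; rewrite integral_cst_prob lee_fin exprM.
Qed.

(** One factor [K] is paid for the new variable, the other for the linear form that it
    multiplies. *)
Lemma chaos_moment b s : uniq s ->
  \int[P]_w (chaos b (x w) s ^+ (2 * k))%:E <= ((K ^+ 2 * chaos_var b s) ^+ k)%:E.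
Proof.
elim: s => [_|i s IH /= /andP[iNs us]].
  by rewrite (le_trans integral_pow0)// lee_fin exprn_ge0// mulr0.
have K0 : (0 <= K)%R by rewrite addr_ge0// mulr_ge0// (phi_moment_ge0 i).
rewrite mulrDr (_ : (K ^+ 2 * \sum_(j <- s) _ = K * (K * \sum_(j <- s) b i j ^+ 2))%R); last first.
  by rewrite expr2 mulrA.
apply: (@moment_step _ _ _ P _ X indX k [set i] [set j in s]
  (fun w => x w i) (fun w => chaos b (x w) s) (fun w => linform (b i) (x w) s)).
- exact: hk.
- by move=> j; rewrite !inE => /eqP ->.
- by apply: measurable_phi; rewrite inE.
- by apply: measurable_chaos => j; rewrite inE.
- by apply: measurable_linform => j; rewrite inE.
- exact: phi_int.
- exact: phi_mean.
- exact: phi_var.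
- exact: phi_mom.
- by rewrite mulr_ge0 ?sqr_ge0// chaos_var_ge0.
- by rewrite mulr_ge0// sumr_ge0// => j _; exact: sqr_ge0.
- exact: IH.
- exact: linform_moment.
Qed.

End FormMoments.

Section Transfer.
Local Open Scope ereal_scope.
Context d (T : measurableType d) (R : realType) (P : probability T R).
Variables (law : probability R R) (Y : {RV P >-> R}).
Hypothesis lawY : forall B : set R, measurable B -> distribution P Y B = law B.

Lemma ge0_integral_law (f : R -> R) : measurable_fun setT f ->
  (forall x, (0 <= f x)%R) ->
  \int[P]_w (f (Y w))%:E = \int[law]_x (f x)%:E.
Proof.
move=> mf f0; transitivity (\int[distribution P Y]_x (f x)%:E).
  rewrite ge0_integral_distribution//; first exact/measurable_EFinP.
by apply: eq_measure_integral => A mA _; first [exact: lawY|exact/esym/lawY].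
Qed.

Lemma integrable_law (f : R -> R) : law.-integrable setT (EFin \o f) ->
  P.-integrable setT (fun w => (f (Y w))%:E).
Proof.
move=> /integrableP[/measurable_EFinP mf fi]; apply/integrableP; split.
  exact/measurable_EFinP/measurableT_comp.
by under eq_integral do rewrite /=; rewrite (ge0_integral_law (f := fun x => `|f x|%R))//; exact: measurableT_comp.
Qed.

Lemma integral_law (f : R -> R) : law.-integrable setT (EFin \o f) ->
  \int[P]_w (f (Y w))%:E = \int[law]_x (f x)%:E.
Proof.
move=> fi; have /integrableP[mf _] := fi.
transitivity (\int[distribution P Y]_x (f x)%:E).
  by rewrite integral_distribution//; exact: integrable_law fi.
by apply: eq_measure_integral => A mA _; first [exact: lawY|exact/esym/lawY].
Qed.

End Transfer.

(** * Moments of the common law *)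

Section LawMoments.
Local Open Scope ereal_scope.
Context (R : realType) (law : probability R R) (c : R).
Hypothesis hc : (0 < c)%R.
Hypothesis hmom : \int[law]_x ((`|x| `^ (8 + c))%:E) < +oo.

Lemma even_pow_ge0 (x : R) j : (0 <= x ^+ (2 * j))%R.
Proof. by rewrite exprM exprn_ge0// sqr_ge0. Qed.

(** Up to order 8 every even power is at most [1 + |x|^(8 + c)]. *)
Lemma law_even_moments : exists2 m : R, (0 <= m)%R &
  forall j, (j <= 4)%N -> \int[law]_x ((x ^+ (2 * j))%:E) <= m%:E.
Proof.
have mabs : measurable_fun setT (fun x : R => `|x| `^ (8 + c))%R.
  apply: (@measurableT_comp _ _ _ _ _ _ (fun y : R => y `^ (8 + c))%R) => //.
have mom0 : 0 <= \int[law]_x ((`|x| `^ (8 + c))%:E).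
  by apply: integral_ge0 => x _; rewrite lee_fin powR_ge0.
have fmom : \int[law]_x ((`|x| `^ (8 + c))%:E) \is a fin_num.
  by rewrite ge0_fin_numE.
exists (1 + fine (\int[law]_x ((`|x| `^ (8 + c))%:E)))%R.
  by rewrite addr_ge0// fine_ge0.
move=> j j4; rewrite EFinD fineK//.
rewrite -[X in X + _](integral_cst_prob law 1%R) -ge0_integralD//; try first [by move=> x _; rewrite lee_fin powR_ge0 | exact/measurable_EFinP].
apply: ge0_le_integral => //.
- by move=> x _; rewrite lee_fin even_pow_ge0.
- by apply/measurable_EFinP; exact: measurable_funX.
- by apply/measurable_EFinP; exact: measurable_funD.
- move=> x _; rewrite -EFinD lee_fin.
  have -> : (x ^+ (2 * j) = `|x| ^+ (2 * j))%R by rewrite !exprM -normrX ger0_norm// sqr_ge0.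
  have [x1|/ltW x1] := leP (`|x|)%R 1%R.
    by rewrite (le_trans (exprn_ile1 _ (normr_ge0 x) x1))// lerDl powR_ge0.
  rewrite (@le_trans _ _ (`|x| `^ (8 + c))%R)//; last by rewrite lerDr.
  rewrite -powR_mulrn//; apply: ler_powR => //.
  rewrite (@le_trans _ _ 8%:R)//; last by rewrite lerDl ltW.
  by rewrite ler_nat; move: j4; case: j => [|[|[|[|[|]]]]].
Qed.

Lemma law_integrable (f : R -> R) (A B : R) : measurable_fun setT f ->
  (forall x, `|f x| <= A + B * x ^+ 8)%R -> (0 <= A)%R -> (0 <= B)%R ->
  law.-integrable setT (EFin \o f).
Proof.
move=> mf fb A0 B0; have [m m0 H] := law_even_moments.
apply/integrableP; split; first exact/measurable_EFinP.
apply: (@le_lt_trans _ _ (A%:E + B%:E * \int[law]_x ((x ^+ (2 * 4))%:E))).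
  rewrite -[X in X + _](integral_cst_prob law) -ge0_integralZl//; try first [by apply/measurable_EFinP; exact: measurable_funX |
    by move=> x _; rewrite lee_fin even_pow_ge0 | by rewrite lee_fin].
  rewrite -ge0_integralD//; try first [by move=> x _; rewrite mule_ge0// lee_fin// even_pow_ge0 |
    by apply: measurable_funeM; apply/measurable_EFinP; exact: measurable_funX].
  apply: ge0_le_integral => //.
  - by apply/measurable_EFinP; exact: measurableT_comp.
  - apply: emeasurable_funD => //; apply: measurable_funeM.
    by apply/measurable_EFinP; exact: measurable_funX.
  - by move=> x _; rewrite -EFinM -EFinD /= lee_fin; exact: fb.
apply: (@le_lt_trans _ _ (A%:E + B%:E * m%:E)).
  by apply: leeD => //; apply: lee_wpmul2l; [rewrite lee_fin|exact: H].
by rewrite -EFinM -EFinD ltry.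
Qed.

Lemma law_integral_le (f : R -> R) (A B m : R) : measurable_fun setT f ->
  (forall x, 0 <= f x <= A + B * x ^+ 8)%R -> (0 <= A)%R -> (0 <= B)%R ->
  \int[law]_x ((x ^+ (2 * 4))%:E) <= m%:E ->
  \int[law]_x ((f x)%:E) <= (A + B * m)%:E.
Proof.
move=> mf fb A0 B0 Hm.
apply: (@le_trans _ _ (A%:E + B%:E * \int[law]_x ((x ^+ (2 * 4))%:E))); last first.
  by rewrite EFinD EFinM; apply: leeD => //; apply: lee_wpmul2l; rewrite ?lee_fin.
rewrite -[X in X + _](integral_cst_prob law) -ge0_integralZl//; try first [by apply/measurable_EFinP; exact: measurable_funX |
  by move=> x _; rewrite lee_fin even_pow_ge0 | by rewrite lee_fin].
rewrite -ge0_integralD//; try first [by move=> x _; rewrite mule_ge0// lee_fin// even_pow_ge0 |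
  by apply: measurable_funeM; apply/measurable_EFinP; exact: measurable_funX].
apply: ge0_le_integral => //.
- by move=> x _; rewrite lee_fin; case/andP: (fb x).
- exact/measurable_EFinP.
- apply: emeasurable_funD => //; apply: measurable_funeM.
  by apply/measurable_EFinP; exact: measurable_funX.
- by move=> x _; rewrite -EFinM -EFinD /= lee_fin; case/andP: (fb x).
Qed.

End LawMoments.

(** * Fourth moments and lower tails of quadratic forms *)

Section QuadraticForms.
Local Open Scope ereal_scope.
Context (R : realType) (law : probability R R) (c : R).
Hypothesis hc : (0 < c)%R.
Hypothesis hmom : \int[law]_x ((`|x| `^ (8 + c))%:E) < +oo.
Hypothesis hmean : \int[law]_x (x%:E) = 0.
Hypothesis hvar : \int[law]_x ((x ^+ 2)%:E) = 1.

Lemma pow4_sum (u v : R) : ((u + v) ^+ 4 <= 8 * u ^+ 4 + 8 * v ^+ 4)%R.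
Proof.
rewrite -subr_ge0 (_ : _ - _ = (u - v) ^+ 2 * (6 * (u + v) ^+ 2 + (u - v) ^+ 2))%R; last by ring.
by apply: mulr_ge0; [|apply: addr_ge0; [apply: mulr_ge0 => //|]]; exact: sqr_ge0.
Qed.

Lemma pow6_sum (u v : R) : ((u + v) ^+ 6 <= 32 * u ^+ 6 + 32 * v ^+ 6)%R.
Proof.
rewrite -subr_ge0 (_ : _ - _ = (u - v) ^+ 2 * (15 * (u + v) ^+ 4 +
  15 * (u + v) ^+ 2 * (u - v) ^+ 2 + (u - v) ^+ 4))%R; last by ring.
have e4 (z : R) : (0 <= z ^+ 4)%R by exact: (even_pow_ge0 z 2).
apply: mulr_ge0; first exact: sqr_ge0.
apply: addr_ge0 => //; apply: addr_ge0; first exact: mulr_ge0.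
by apply: mulr_ge0; [apply: mulr_ge0 => //|]; exact: sqr_ge0.
Qed.

Definition quadform (I : finType) (M : I -> I -> R) (x : I -> R) : R :=
  (\sum_i \sum_j M i j * x i * x j)%R.

Definition frob2 (I : finType) (M : I -> I -> R) : R := (\sum_i \sum_j M i j ^+ 2)%R.

Lemma diag_le_frob2 (I : finType) (M : I -> I -> R) :
  (\sum_i M i i ^+ 2 <= frob2 M)%R.
Proof.
apply: ler_sum => i _; rewrite (bigD1 i)//= lerDl sumr_ge0// => j _.
exact: sqr_ge0.
Qed.

Lemma frob2_ge0 (I : finType) (M : I -> I -> R) : (0 <= frob2 M)%R.
Proof. by apply: sumr_ge0 => i _; apply: sumr_ge0 => j _; exact: sqr_ge0. Qed.

Lemma normr_pow_le8 (x : R) j : (j <= 8)%N -> (`|x| ^+ j <= 1 + x ^+ 8)%R.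
Proof.
move=> j8; have x8 : (x ^+ 8 = `|x| ^+ 8)%R.
  by rewrite -normrX ger0_norm//; exact: (even_pow_ge0 x 4).
rewrite x8; have [x1|/ltW x1] := leP (`|x|)%R 1%R.
  by rewrite (le_trans (exprn_ile1 _ (normr_ge0 x) x1))// lerDl exprn_ge0.
by rewrite (@le_trans _ _ (`|x| ^+ 8)%R) ?lerDr// ler_weXn2l.
Qed.

Lemma law_integrable_id : law.-integrable setT (fun x => x%:E).
Proof.
apply: (law_integrable hc hmom (f := id) (A := 1) (B := 1)) => // x.
by rewrite mul1r; exact: (@normr_pow_le8 x 1).
Qed.

Lemma pow_le8 (x : R) j : (j <= 4)%N -> (0 <= x ^+ (2 * j) <= 1 + 1 * x ^+ 8)%R.
Proof.
move=> j4; rewrite even_pow_ge0 mul1r/= (le_trans (ler_norm _))// normrX.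
by apply: normr_pow_le8; move: j4; case: j => [|[|[|[|[|]]]]].
Qed.

(** The diagonal part is a linear form in [x_i^2 - 1], whose fourth moment is where the eighth
    moment of the law enters; the rest is a chaos. The constant precedes the space and the matrix,
    so it serves all problems of the sequence. *)
Lemma quadform_moment4 : exists2 C : R, (0 <= C)%R &
  forall d (T : measurableType d) (P : probability T R) (I : finType)
    (X : I -> {RV P >-> R}) (M : I -> I -> R), iid_with_law law X ->
  \int[P]_w ((quadform M (X^~ w) - \sum_i M i i) ^+ 4)%:E <= (C * frob2 M ^+ 2)%:E.
Proof.
have [m m0 hm] := law_even_moments hc hmom.
have hm8 := hm 4%N isT.
pose m1 := (1 + m)%R; pose m2 := (16 + 16 * m)%R.
have m10 : (0 <= m1)%R by rewrite addr_ge0.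
have m20 : (0 <= m2)%R by rewrite addr_ge0// mulr_ge0.
pose K1 := (78 * m1 + 1)%R; pose K2 := (78 * m2 + 1)%R.
have K10 : (0 <= K1)%R by rewrite addr_ge0// mulr_ge0.
have K20 : (0 <= K2)%R by rewrite addr_ge0// mulr_ge0.
exists (8 * K2 ^+ 2 + 8 * (2 * K1 ^+ 2) ^+ 2)%R.
  by apply: addr_ge0; apply: mulr_ge0 => //; exact: sqr_ge0.
move=> d T P I X M [indX lawX].
pose ph2 (x : R) := (x ^+ 2 - 1)%R.
have mph2 : measurable_fun setT ph2 by apply: measurable_funB => //; exact: measurable_funX.
have ph2b (x : R) : (`|ph2 x| <= 2 + 1 * x ^+ 8)%R.
  rewrite (le_trans (ler_normB _ _))// normr1 normrX mul1r addrC -addrA lerD2l.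
  exact: normr_pow_le8.
have ph2_2 (x : R) : (0 <= ph2 x ^+ 2 <= 16 + 16 * x ^+ 8)%R.
  rewrite sqr_ge0/= /ph2; have /andP[_] := @pow_le8 x 2%N isT; have := sqr_ge0 x.
  have := even_pow_ge0 x 4%N; rewrite /=; nra.
have ph2_4 (x : R) : (0 <= ph2 x ^+ (2 * 2) <= 16 + 16 * x ^+ 8)%R.
  rewrite even_pow_ge0/= /ph2; have := pow4_sum (x ^+ 2) (-1)%R.
  rewrite -exprM (_ : (-1) ^+ 4 = 1 :> R)%R; last by ring.
  have := even_pow_ge0 x 4%N; rewrite /=; lra.
have iph2 i : P.-integrable setT (fun w => (ph2 (X i w))%:E).
  by apply: (integrable_law (lawX i)); apply: (law_integrable hc hmom mph2 ph2b).
have iid i : P.-integrable setT (fun w => (X i w)%:E).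
  exact: (integrable_law (lawX i) law_integrable_id).
have eid i : \int[P]_w (X i w)%:E = 0.
  by rewrite (integral_law (lawX i) law_integrable_id).
have eph2 i : \int[P]_w (ph2 (X i w))%:E = 0.
  rewrite (integral_law (lawX i)); last exact: (law_integrable hc hmom mph2 ph2b).
  have i2 : law.-integrable setT (EFin \o (fun x => x ^+ 2)%R).
    apply: (law_integrable hc hmom (A := 1) (B := 1)) => //.
    by move=> x; rewrite normrX mul1r; exact: normr_pow_le8.
  have i1 : law.-integrable setT (EFin \o cst 1%R) by exact: finite_measure_integrable_cst.
  under eq_integral do rewrite /ph2 EFinB.
  by rewrite (integralB _ i2 i1)//= hvar integral_cst_prob subee.
have mid : measurable_fun [set: R] (id : R -> R) by exact: measurable_id.
have mom1 j i : (j <= 4)%N -> \int[P]_w (X i w ^+ (2 * j))%:E <= m1%:E.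
  move=> j4; rewrite (ge0_integral_law (lawX i) (f := fun x => x ^+ (2 * j))%R).
  - by rewrite (le_trans (hm j j4))// lee_fin lerDr.
  - exact: measurable_funX.
  - by move=> x; exact: even_pow_ge0.
have mom2 i : \int[P]_w (ph2 (X i w) ^+ 2)%:E <= m2%:E.
  rewrite (ge0_integral_law (lawX i) (f := fun x => ph2 x ^+ 2)%R).
  - by apply: law_integral_le => //; exact: measurable_funX.
  - exact: measurable_funX.
  - by move=> x; exact: sqr_ge0.
have mom4 i : \int[P]_w (ph2 (X i w) ^+ (2 * 2))%:E <= m2%:E.
  rewrite (ge0_integral_law (lawX i) (f := fun x => ph2 x ^+ (2 * 2))%R).
  - by apply: law_integral_le => //; exact: measurable_funX.
  - exact: measurable_funX.
  - by move=> x; exact: even_pow_ge0.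
pose s := index_enum I; have us : uniq s by exact: index_enum_uniq.
have h2 : (2 \in [:: 2; 3])%N by [].
have LM := linform_moment indX mph2 h2 iph2 eph2 mom2 mom4 (fun i => M i i) us.
have CM := chaos_moment indX mid h2 iid eid (fun i => mom1 1%N i isT) (fun i => mom1 2%N i isT)
  (fun i j => M i j + M j i)%R us.
rewrite -/K2 in LM; rewrite -/K1 in CM.
have mL := sub_measurable_fun (measurable_linform (J := [set: I]%SET) (X := X) mph2 (fun i => M i i) (s := s) (fun i _ => finset.in_setT i)).
have mC := sub_measurable_fun (measurable_chaos (J := [set: I]%SET) (X := X) mid (fun i j => M i j + M j i)%R (s := s) (fun i _ => finset.in_setT i)).
pose Lf w := (8 * linform (fun i => M i i) (fun i => ph2 (X i w)) s ^+ 4)%R.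
pose Cf w := (8 * chaos (fun i j => M i j + M j i)%R (fun i => X i w) s ^+ 4)%R.
have mLf : measurable_fun setT (EFin \o Lf).
  by apply/measurable_EFinP; apply: measurable_funM => //; exact: measurable_funX.
have mCf : measurable_fun setT (EFin \o Cf).
  by apply/measurable_EFinP; apply: measurable_funM => //; exact: measurable_funX.
have Lf0 w : (0 <= Lf w)%R by apply: mulr_ge0 => //; exact: (even_pow_ge0 _ 2).
have Cf0 w : (0 <= Cf w)%R by apply: mulr_ge0 => //; exact: (even_pow_ge0 _ 2).
have quadE w : (quadform M (X^~ w) - \sum_i M i i = 
  linform (fun i => M i i) (fun i => ph2 (X i w)) s + chaos (fun i j => M i j + M j i) (fun i => X i w) s)%R.
  rewrite /quadform quad_chaosE addrAC; congr (_ + _)%R.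
  by rewrite /linform -sumrB; apply: eq_bigr => i _; rewrite /ph2; ring.
apply: (@le_trans _ _ (\int[P]_w ((EFin \o Lf) w + (EFin \o Cf) w))).
  apply: ge0_le_integral => //.
  - by move=> w _; rewrite lee_fin; exact: (even_pow_ge0 _ 2).
  - apply/measurable_EFinP; apply: measurable_funX; under eq_fun do rewrite quadE.
    exact: measurable_funD.
  - exact: emeasurable_funD.
  - by move=> w _; rewrite quadE -EFinD lee_fin; exact: pow4_sum.
rewrite ge0_integralD//; try by move=> w _; rewrite lee_fin.
rewrite mulrDl EFinD; apply: leeD.
- rewrite /Lf; under eq_integral do rewrite /= EFinM.
  rewrite ge0_integralZl//; try first [by move=> w _; rewrite lee_fin; exact: (even_pow_ge0 _ 2) |
    by apply/measurable_EFinP; exact: measurable_funX].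
  rewrite -mulrA EFinM; apply: lee_wpmul2l; first by rewrite lee_fin.
  apply: le_trans LM _; rewrite lee_fin exprMn ler_wpM2l ?sqr_ge0//.
  apply: lerXn2r; rewrite ?nnegrE ?frob2_ge0//; last exact: diag_le_frob2.
  by apply: sumr_ge0 => i _; exact: sqr_ge0.
- rewrite /Cf; under eq_integral do rewrite /= EFinM.
  rewrite ge0_integralZl//; try first [by move=> w _; rewrite lee_fin; exact: (even_pow_ge0 _ 2) |
    by apply/measurable_EFinP; exact: measurable_funX].
  rewrite -mulrA EFinM; apply: lee_wpmul2l; first by rewrite lee_fin.
  apply: le_trans CM _; rewrite lee_fin -exprMn.
  apply: lerXn2r; rewrite ?nnegrE ?mulr_ge0 ?sqr_ge0 ?frob2_ge0 ?chaos_var_ge0//.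
  apply: (@le_trans _ _ (K1 ^+ 2 * (2 * frob2 M)))%R; last by rewrite mulrCA mulrA.
  by apply: ler_wpM2l; [exact: sqr_ge0|exact: chaos_var_le].
Qed.

(* Only the diagonal needs high moments in [quadform_moment4]; for a lower
   bound one may truncate the squares, so six moments give the rate |M|_F^6. *)
Lemma quadform_lower_tail : exists C mu : R, [/\ (0 <= C)%R, (0 < mu)%R &
  forall d (T : measurableType d) (P : probability T R) (I : finType)
    (X : I -> {RV P >-> R}) (M : I -> I -> R), iid_with_law law X ->
  (forall i, 0 <= M i i)%R ->
  P [set w | (quadform M (X^~ w) <= mu * \sum_i M i i)%R] *
    ((\sum_i M i i) ^+ 6)%:E <= (C * frob2 M ^+ 3)%:E].
Proof.
have [m m0 hm] := law_even_moments hc hmom.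
(* Truncating the square at [K] loses at most [E x^4 / K <= m / K <= 1/2] of the unit variance. *)
pose K := (2 * m + 1)%R; have K0 : (0 < K)%R by rewrite ltr_wpDl ?mulr_ge0.
pose tr (x : R) := Num.min (x ^+ 2)%R K.
have mtr : measurable_fun setT tr.
  by apply: measurable_minr => //; exact: measurable_funX.
have tr0 x : (0 <= tr x)%R by rewrite le_min sqr_ge0 ltW.
have trK x : (tr x <= K)%R by rewrite ge_min lexx orbT.
have trx x : (tr x <= x ^+ 2)%R by rewrite ge_min lexx.
have itr : law.-integrable setT (EFin \o tr).
  apply: (law_integrable hc hmom (A := K) (B := 0)) => // [x|]; last exact: ltW.
  by rewrite mul0r addr0 ger0_norm.
pose mu0 := fine (\int[law]_x (tr x)%:E).
have emu0 : \int[law]_x (tr x)%:E = mu0%:E.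
  by rewrite fineK//; exact: integrable_fin_num.
have mu0_ge : (2^-1 <= mu0)%R.
  have : \int[law]_x (x ^+ 2)%:E <= \int[law]_x ((tr x)%:E + (K^-1)%:E * (x ^+ (2 * 2))%:E).
    apply: ge0_le_integral => //.
    - by move=> x _; rewrite lee_fin sqr_ge0.
    - by apply/measurable_EFinP; exact: measurable_funX.
    - apply: emeasurable_funD; first exact/measurable_EFinP.
      by apply: measurable_funeM; apply/measurable_EFinP; exact: measurable_funX.
    - move=> x _; rewrite -EFinM -EFinD lee_fin /tr.
      have [xK|/ltW Kx] := leP (x ^+ 2)%R K.
        by rewrite lerDl mulr_ge0// ?even_pow_ge0// invr_ge0 ltW.
      rewrite (@le_trans _ _ (K^-1 * x ^+ (2 * 2))%R)//; last by rewrite lerDr ltW.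
      by rewrite ler_pdivlMl// exprM [leRHS]expr2 ler_wpM2r// sqr_ge0.
  rewrite hvar ge0_integralD//; try first [by move=> x _; rewrite ?mule_ge0// lee_fin ?even_pow_ge0// invr_ge0 ltW |
    exact/measurable_EFinP | by apply: measurable_funeM; apply/measurable_EFinP; exact: measurable_funX].
  rewrite ge0_integralZl//; try first [by move=> x _; rewrite lee_fin even_pow_ge0 | by rewrite lee_fin invr_ge0 ltW
    | by apply/measurable_EFinP; exact: measurable_funX].
  move=> /le_trans/(_ (leeD (lexx _) (lee_wpmul2l _ (hm 2%N isT)))).
  rewrite lee_fin invr_ge0 ltW// => /(_ isT); rewrite emu0 -EFinM -EFinD lee_fin.
  have : (K^-1 * m <= 2^-1)%R by rewrite ler_pdivrMl// /K; lra.
  by lra.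
have mu0_leK : (mu0 <= K)%R.
  rewrite -lee_fin -emu0 -(integral_cst_prob law K).
  apply: ge0_le_integral => //.
  - by move=> x _; rewrite lee_fin.
  - exact/measurable_EFinP.
  - by move=> x _; rewrite lee_fin.
pose ph (x : R) := (tr x - mu0)%R.
have mph : measurable_fun setT ph by apply: measurable_funB.
have phK x : (`|ph x| <= K)%R.
  by rewrite ler_norml /ph; apply/andP; split; have := tr0 x; have := trK x; lra.
have iph : law.-integrable setT (EFin \o ph).
  apply: (law_integrable hc hmom (A := K) (B := 0)) => // [x|]; last exact: ltW.
  by rewrite mul0r addr0.
pose m1 := m; pose m2 := (K ^+ 2 + K ^+ 6)%R.
have m20 : (0 <= m2)%R by rewrite addr_ge0// exprn_ge0// ltW.
pose K1 := (78 * m1 + 1)%R; pose K2 := (78 * m2 + 1)%R.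
have K10 : (0 <= K1)%R by rewrite addr_ge0// mulr_ge0.
have K20 : (0 <= K2)%R by rewrite addr_ge0// mulr_ge0.
have e3 (z : R) : (0 <= z -> 0 <= z ^+ 3)%R by move=> ?; exact: exprn_ge0.
have mu00 : (0 < mu0)%R by rewrite (lt_le_trans _ mu0_ge).
(* The threshold is half the truncated mean, so on the bad event the fluctuations exceed [mu0 / 2]
   times the trace. Markov's inequality for sixth powers gives the first factor, [pow6_sum] the
   factors 32. *)
exists ((mu0 / 2)^-1 ^+ 6 * (32 * K2 ^+ 3 + 32 * (2 * K1 ^+ 2) ^+ 3))%R, (mu0 / 2)%R; split.
- apply: mulr_ge0; first by rewrite exprn_ge0// invr_ge0 divr_ge0// ltW.
  by apply: addr_ge0; apply: mulr_ge0 => //; apply: e3 => //; rewrite mulr_ge0// sqr_ge0.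
- by rewrite divr_gt0.
move=> d T P I X M [indX lawX] M0.
have iphX i : P.-integrable setT (fun w => (ph (X i w))%:E).
  exact: (integrable_law (lawX i) iph).
have iidX i : P.-integrable setT (fun w => (X i w)%:E).
  exact: (integrable_law (lawX i) law_integrable_id).
have eid i : \int[P]_w (X i w)%:E = 0.
  by rewrite (integral_law (lawX i) law_integrable_id).
have eph i : \int[P]_w (ph (X i w))%:E = 0.
  rewrite (integral_law (lawX i) iph).
  have i1 : law.-integrable setT (EFin \o cst mu0) by exact: finite_measure_integrable_cst.
  under eq_integral do rewrite /ph EFinB.
  by rewrite (integralB _ itr i1)//= emu0 integral_cst_prob subee.
have mid : measurable_fun [set: R] (id : R -> R) by exact: measurable_id.
have mom1 j i : (j <= 4)%N -> \int[P]_w (X i w ^+ (2 * j))%:E <= m1%:E.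
  move=> j4; rewrite (ge0_integral_law (lawX i) (f := fun x => x ^+ (2 * j))%R).
  - exact: hm.
  - exact: measurable_funX.
  - by move=> x; exact: even_pow_ge0.
have momph j i : (j \in [:: 1; 3])%N -> \int[P]_w (ph (X i w) ^+ (2 * j))%:E <= m2%:E.
  move=> j13; rewrite -(integral_cst_prob P).
  apply: ge0_le_integral => //.
  - by move=> w _; rewrite lee_fin; exact: even_pow_ge0.
  - by apply/measurable_EFinP; apply: measurable_funX; exact: measurableT_comp.
  - move=> w _; rewrite lee_fin.
    rewrite (le_trans (ler_norm _))// normrX.
    apply: (@le_trans _ _ (K ^+ (2 * j))%R).
      by apply: lerXn2r; rewrite ?nnegrE// ltW.
    by move: j13; rewrite !inE => /orP[] /eqP -> /=; rewrite ?lerDl ?lerDr exprn_ge0// ltW.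
pose s := index_enum I; have us : uniq s by exact: index_enum_uniq.
have h3 : (3 \in [:: 2; 3])%N by [].
have LM := linform_moment indX mph h3 iphX eph (fun i => momph 1%N i isT) (fun i => momph 3%N i isT)
  (fun i => M i i) us.
have CM := chaos_moment indX mid h3 iidX eid (fun i => mom1 1%N i isT) (fun i => mom1 3%N i isT)
  (fun i j => M i j + M j i)%R us.
rewrite -/K2 in LM; rewrite -/K1 in CM.
have mL := sub_measurable_fun (measurable_linform (J := [set: I]%SET) (X := X) mph (fun i => M i i) (s := s) (fun i _ => finset.in_setT i)).
have mC := sub_measurable_fun (measurable_chaos (J := [set: I]%SET) (X := X) mid (fun i j => M i j + M j i)%R (s := s) (fun i _ => finset.in_setT i)).
pose L0 w := linform (fun i => M i i) (fun i => ph (X i w)) s.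
pose C0 w := chaos (fun i j => M i j + M j i)%R (fun i => X i w) s.
pose trM := (\sum_i M i i)%R.
have trM0 : (0 <= trM)%R by exact: sumr_ge0.
pose A := [set w | (quadform M (X^~ w) <= mu0 / 2 * trM)%R].
pose Lf w := ((mu0 / 2)^-1 ^+ 6 * 32 * L0 w ^+ 6)%R.
pose Cf w := ((mu0 / 2)^-1 ^+ 6 * 32 * C0 w ^+ 6)%R.
have mLf : measurable_fun setT (EFin \o Lf).
  by apply/measurable_EFinP; apply: measurable_funM => //; exact: measurable_funX.
have mCf : measurable_fun setT (EFin \o Cf).
  by apply/measurable_EFinP; apply: measurable_funM => //; exact: measurable_funX.
have k0 : (0 <= (mu0 / 2)^-1 ^+ 6 * 32)%R.
  by rewrite mulr_ge0// exprn_ge0// invr_ge0 divr_ge0// ltW.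
have Lf0 w : (0 <= Lf w)%R by apply: mulr_ge0 => //; exact: (even_pow_ge0 _ 3).
have Cf0 w : (0 <= Cf w)%R by apply: mulr_ge0 => //; exact: (even_pow_ge0 _ 3).
have mquad : measurable_fun setT (fun w => quadform M (X^~ w)).
  rewrite /quadform; apply: measurable_sum => i; apply: measurable_sum => j.
  by apply: measurable_funM => //; exact: measurable_funM.
(* The next inequality, [quad_ge], replaces squares by their truncations; only a lower bound is
   claimed, and the diagonal coefficients are nonnegative. *)
have mA : measurable A.
  by rewrite -[A]setTI; exact: measurable_fun_le.
have quad_ge w : (mu0 * trM + L0 w + C0 w <= quadform M (X^~ w))%R.
  rewrite /quadform quad_chaosE lerD2r /L0 /linform /trM mulr_sumr -big_split /=.
  apply: ler_sum => i _; rewrite /ph mulrBr mulrC addrC subrK.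
  by rewrite ler_wpM2l.
have key w : (\1_A w * trM ^+ 6 <= Lf w + Cf w)%R.
  rewrite indicE; have [wA|_] := boolP (w \in A); last by rewrite mul0r addr_ge0.
  move: wA; rewrite inE /A /= => wA; rewrite mul1r.
  rewrite /Lf /Cf -mulrDr -mulrA mulrDr exprVn ler_pdivlMl; last by rewrite exprn_gt0// divr_gt0.
  rewrite -exprMn (le_trans _ (pow6_sum _ _))//.
  have : (mu0 / 2 * trM <= `|L0 w + C0 w|)%R.
    rewrite -normrN (le_trans _ (ler_norm _))//; have := quad_ge w; lra.
  have -> : ((L0 w + C0 w) ^+ 6 = `|L0 w + C0 w| ^+ 6)%R.
    by rewrite -normrX ger0_norm//; exact: (even_pow_ge0 _ 3).
  by move=> ?; apply: lerXn2r; rewrite ?nnegrE// mulr_ge0// divr_ge0// ltW.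
apply: (@le_trans _ _ (\int[P]_w ((EFin \o Lf) w + (EFin \o Cf) w))).
  have -> : P A = \int[P]_w (\1_A w)%:E by rewrite integral_indic// setIT.
  rewrite muleC -ge0_integralZl//; try first [by move=> w _; rewrite lee_fin | by rewrite lee_fin exprn_ge0|
    by apply/measurable_EFinP].
  apply: ge0_le_integral => //.
  - by move=> w _; rewrite mule_ge0// lee_fin// exprn_ge0.
  - by apply: measurable_funeM; apply/measurable_EFinP.
  - exact: emeasurable_funD.
  - by move=> w _; rewrite -EFinM -EFinD lee_fin mulrC; exact: key.
rewrite ge0_integralD//; try by move=> w _; rewrite lee_fin.
rewrite [X in _ <= X%:E](_ : _ = (mu0 / 2)^-1 ^+ 6 * 32 * (K2 ^+ 3 * frob2 M ^+ 3) +
  (mu0 / 2)^-1 ^+ 6 * 32 * ((2 * K1 ^+ 2) ^+ 3 * frob2 M ^+ 3))%R; last by ring.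
rewrite EFinD; apply: leeD.
- rewrite /Lf; under eq_integral do rewrite /= EFinM.
  rewrite ge0_integralZl//; try first [by move=> w _; rewrite lee_fin; exact: (even_pow_ge0 _ 3) |
    by apply/measurable_EFinP; exact: measurable_funX].
  rewrite [X in _ <= X]EFinM; apply: lee_wpmul2l; first by rewrite lee_fin.
  apply: le_trans LM _; rewrite lee_fin exprMn ler_wpM2l ?e3//.
  apply: lerXn2r; rewrite ?nnegrE ?frob2_ge0//; last exact: diag_le_frob2.
  by apply: sumr_ge0 => i _; exact: sqr_ge0.
- rewrite /Cf; under eq_integral do rewrite /= EFinM.
  rewrite ge0_integralZl//; try first [by move=> w _; rewrite lee_fin; exact: (even_pow_ge0 _ 3) |
    by apply/measurable_EFinP; exact: measurable_funX].
  rewrite [X in _ <= X]EFinM; apply: lee_wpmul2l; first by rewrite lee_fin.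
  apply: le_trans CM _; rewrite lee_fin -exprMn.
  apply: lerXn2r; rewrite ?nnegrE ?mulr_ge0 ?sqr_ge0 ?frob2_ge0 ?chaos_var_ge0//.
  apply: (@le_trans _ _ (K1 ^+ 2 * (2 * frob2 M)))%R; last by rewrite mulrCA mulrA.
  by apply: ler_wpM2l; [exact: sqr_ge0|exact: chaos_var_le].
Qed.

End QuadraticForms.

(** * Resolvents and rank one updates *)

Section QuadraticMatrices.
Variable R : realType.

Definition qf n (A : 'M[R]_n) (v : 'rV[R]_n) : R := (v *m A *m v^T) 0 0.
Definition nsq n (v : 'rV[R]_n) : R := (v *m v^T) 0 0.

Lemma nsqE n (v : 'rV[R]_n) : nsq v = \sum_i v 0 i ^+ 2.
Proof. by rewrite /nsq mxE; apply: eq_bigr => i _; rewrite mxE expr2. Qed.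

Lemma nsq_ge0 n (v : 'rV[R]_n) : 0 <= nsq v.
Proof. by rewrite nsqE sumr_ge0// => i _; exact: sqr_ge0. Qed.

Lemma nsq_eq0 n (v : 'rV[R]_n) : nsq v = 0 -> v = 0.
Proof.
rewrite nsqE => /eqP; rewrite psumr_eq0; last by move=> i _; exact: sqr_ge0.
move=> /allP H; apply/rowP => i; rewrite mxE; apply/eqP.
by rewrite -sqrf_eq0; apply: H; rewrite mem_index_enum.
Qed.

Lemma qfE n (A : 'M[R]_n) (v : 'rV[R]_n) :
  qf A v = \sum_i \sum_j A i j * v 0 i * v 0 j.
Proof.
rewrite /qf mxE; under eq_bigr do rewrite !mxE mulr_suml.
rewrite exchange_big /=; apply: eq_bigr => i _; apply: eq_bigr => j _.
by rewrite mulrC (mulrC (v 0 i)) mulrC.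
Qed.

Lemma qfD n (A B : 'M[R]_n) v : qf (A + B) v = qf A v + qf B v.
Proof. by rewrite /qf mulmxDr mulmxDl mxE. Qed.

Lemma qfZ n a (A : 'M[R]_n) v : qf (a *: A) v = a * qf A v.
Proof. by rewrite /qf -scalemxAr -scalemxAl mxE. Qed.

Lemma qfN n (A : 'M[R]_n) v : qf (- A) v = - qf A v.
Proof. by rewrite /qf mulmxN mulNmx mxE. Qed.

Lemma qf_scalar n a (v : 'rV[R]_n) : qf a%:M v = a * nsq v.
Proof. by rewrite /qf mul_mx_scalar -scalemxAl mxE. Qed.

Lemma qf_conj m n (A : 'M[R]_n) (V : 'M[R]_(m, n)) v :
  qf (V *m A *m V^T) v = qf A (v *m V).
Proof. by rewrite /qf trmx_mul !mulmxA. Qed.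

Lemma qf_gram n p (W : 'M[R]_(n, p)) v : qf (W^T *m W) v = nsq (v *m W^T).
Proof. by rewrite /qf /nsq trmx_mul trmxK !mulmxA. Qed.

Lemma qf_sqr n (A : 'M[R]_n) v : A^T = A -> qf (A *m A) v = nsq (v *m A).
Proof. by move=> sA; rewrite /qf /nsq trmx_mul sA !mulmxA. Qed.

Lemma qf_delta n (A : 'M[R]_n) i : qf A (delta_mx 0 i) = A i i.
Proof. by rewrite /qf -rowE trmx_delta -colE !mxE. Qed.

Lemma nsq_delta n (i : 'I_n) : nsq (delta_mx 0 i : 'rV[R]_n) = 1.
Proof. by rewrite -[nsq _]mul1r -qf_scalar qf_delta mxE eqxx. Qed.

Definition coercive n (k : R) (A : 'M[R]_n) :=
  A^T = A /\ forall v, k * nsq v <= qf A v.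

Section Coercive.
Context n (k : R) (A : 'M[R]_n).
Hypotheses (k0 : 0 < k) (cA : coercive k A).

Lemma coercive_unit : A \in unitmx.
Proof.
rewrite -row_free_unit -kermx_eq0; apply/eqP/row_matrixP => i; rewrite row0.
apply: nsq_eq0; apply/eqP; rewrite eq_le nsq_ge0 andbT.
rewrite -(ler_pM2l k0) mulr0 (le_trans (cA.2 _))// /qf -row_mul mulmx_ker.
by rewrite row0 mul0mx mxE.
Qed.

Lemma coercive_inv_sym : (invmx A)^T = invmx A.
Proof. by rewrite trmx_inv cA.1. Qed.

Lemma qf_invmx v : qf (invmx A) v = qf A (v *m invmx A).
Proof.
rewrite /qf trmx_mul coercive_inv_sym !mulmxA.
by rewrite mulmxKV ?coercive_unit.
Qed.

Lemma qf_invmx_ge v : k * nsq (v *m invmx A) <= qf (invmx A) v.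
Proof. by rewrite qf_invmx; exact: cA.2. Qed.

Lemma qf_invmx_ge0 v : 0 <= qf (invmx A) v.
Proof. by apply: le_trans (qf_invmx_ge v); rewrite mulr_ge0 ?nsq_ge0 ?ltW. Qed.

Lemma invmx_diag_ge0 i : 0 <= invmx A i i.
Proof. by rewrite -qf_delta qf_invmx_ge0. Qed.

Lemma coercive_qf_ge0 v : 0 <= qf A v.
Proof. by apply: le_trans (cA.2 v); rewrite mulr_ge0 ?nsq_ge0 ?ltW. Qed.

Lemma coercive_CS (u w : 'rV[R]_n) :
  (u *m A *m w^T) 0 0 ^+ 2 <= qf A u * qf A w.
Proof.
have [->|w0] := eqVneq w 0.
  by rewrite trmx0 mulmx0 mxE expr0n/= mulr_ge0// coercive_qf_ge0.
have qw : 0 < qf A w.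
  apply: lt_le_trans (cA.2 w); rewrite mulr_gt0// lt_def nsq_ge0 andbT.
  by apply: contra w0 => /eqP /nsq_eq0 ->.
set a := (u *m A *m w^T) 0 0.
have wu : (w *m A *m u^T) 0 0 = a.
  rewrite /a -[in RHS](trmxK (u *m A *m w^T)) [in RHS]mxE.
  by rewrite !trmx_mul trmxK cA.1 mulmxA.
have := coercive_qf_ge0 (u - (a / qf A w) *: w).
rewrite /qf mulmxBl linearB /= linearZ /= !mulmxBr !mulmxBl.
rewrite -!scalemxAr -!scalemxAl -/(qf A u) -/(qf A w).
have E (M1 M2 M3 M4 : 'M[R]_1) (l : R) : (M1 - l *: M2 - (l *: M3 - l *: (l *: M4))) 0 0 =
    M1 0 0 - l * M2 0 0 - (l * M3 0 0 - l * (l * M4 0 0)).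
  by rewrite !mxE.
rewrite E wu -/a -/(qf A u) -/(qf A w).
move=> H; rewrite -subr_ge0.
have -> : qf A u * qf A w - a ^+ 2 = qf A w *
   (qf A u - a / qf A w * a - (a / qf A w * a - a / qf A w * (a / qf A w * qf A w))).
  by field; rewrite gt_eqF.
by rewrite mulr_ge0 // ltW.
Qed.

(** Cauchy-Schwarz for the form [A], applied to [e_i A^-1] and [v], gives
    [v_i^2 <= (A^-1)_ii * qf A v]; summation over [i] yields the trace. This converts a bound on the
    trace of the inverse into coercivity. *)
Lemma nsq_le_tr v : nsq v <= \tr (invmx A) * qf A v.
Proof.
rewrite nsqE /mxtrace mulr_suml; apply: ler_sum => i _.
have := coercive_CS (delta_mx 0 i *m invmx A) v.
rewrite -qf_invmx qf_delta -(mulmxA (delta_mx 0 i)) mulVmx ?coercive_unit//.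
by rewrite mulmx1 -rowE !mxE.
Qed.

End Coercive.

Section Resolvent.
Context n p (W : 'M[R]_(n, p)) (t : R).
Hypothesis t0 : 0 < t.

Definition gram n p (W : 'M[R]_(n, p)) : 'M[R]_p := W^T *m W.
Definition res n p (W : 'M[R]_(n, p)) (t : R) : 'M[R]_p := invmx (gram W + t%:M).

Lemma gram_coercive : coercive t (gram W + t%:M).
Proof.
split; first by rewrite linearD /= tr_scalar_mx /gram trmx_mul trmxK.
by move=> v; rewrite qfD qf_gram qf_scalar lerDr nsq_ge0.
Qed.

Lemma gram_unit : gram W + t%:M \in unitmx.
Proof. exact: coercive_unit gram_coercive. Qed.

Lemma res_sym : (res W t)^T = res W t.
Proof. exact: coercive_inv_sym gram_coercive. Qed.

Lemma mul_res_gram : res W t *m gram W = 1%:M - t *: res W t.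
Proof.
apply/eqP; rewrite eq_sym subr_eq; apply/eqP.
by rewrite -mul_mx_scalar -mulmxDr mulVmx// gram_unit.
Qed.

Lemma mul_gram_res : gram W *m res W t = 1%:M - t *: res W t.
Proof.
apply/eqP; rewrite eq_sym subr_eq; apply/eqP.
by rewrite -mul_scalar_mx -mulmxDl mulmxV// gram_unit.
Qed.

Lemma qf_res_ge v : t * nsq (v *m res W t) <= qf (res W t) v.
Proof. exact: (qf_invmx_ge t0 gram_coercive). Qed.

Lemma qf_res_ge0 v : 0 <= qf (res W t) v.
Proof. exact: (qf_invmx_ge0 t0 gram_coercive). Qed.

Lemma res_diag_ge0 i : 0 <= res W t i i.
Proof. exact: (invmx_diag_ge0 t0 gram_coercive). Qed.

Lemma res_tr_ge0 : 0 <= \tr (res W t).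
Proof. by apply: sumr_ge0 => i _; exact: res_diag_ge0. Qed.

Lemma res_unique (B : 'M[R]_p) : (gram W + t%:M) *m B = 1%:M -> res W t = B.
Proof. by move=> H; rewrite -[RHS](mulKmx gram_unit) H mulmx1. Qed.

End Resolvent.

Lemma res_diff n p (W : 'M[R]_(n, p)) s t : 0 < s -> 0 < t ->
  res W s - res W t = (t - s) *: (res W s *m res W t).
Proof.
move=> s0 t0; apply: (can_inj (mulKmx (gram_unit W s0))).
rewrite mulmxBr mulmxV ?gram_unit// -scalemxAr mulmxA mulmxV ?gram_unit// mul1mx.
rewrite mulmxDl mul_gram_res// mul_scalar_mx.
by apply/matrixP => i j; rewrite !mxE; ring.
Qed.

Lemma res_comm n p (W : 'M[R]_(n, p)) s t : 0 < s -> 0 < t ->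
  res W s *m res W t = res W t *m res W s.
Proof.
move=> s0 t0; have [->//|st] := eqVneq s t.
have ts : t - s != 0 by rewrite subr_eq0 eq_sym.
apply: (scalerI ts); rewrite -res_diff// -[in RHS]opprB scaleNr -res_diff//.
by rewrite opprB.
Qed.

(** The resolvent identity used twice: [R_s - R_t = (t - s) R_t^2 + (t - s)^2 R_t R_s R_t]. In this
    form monotonicity in the level is visible. *)
Lemma qf_res_diff n p (W : 'M[R]_(n, p)) s t v : 0 < s -> 0 < t ->
  qf (res W s - res W t) v =
  (t - s) * (nsq (v *m res W t) + (t - s) * qf (res W s) (v *m res W t)).
Proof.
move=> s0 t0; rewrite -qf_sqr ?res_sym// -{2}(res_sym W t) -{3}(res_sym W t).
rewrite -qf_conj -qfZ -qfD -qfZ res_sym//; congr qf.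
rewrite res_diff//; congr (_ *: _).
rewrite -[X in X *m _](subrK (res W t)) res_diff// mulmxDl addrC -scalemxAl.
by rewrite res_comm.
Qed.

Lemma qf_res_diff_ge0 n p (W : 'M[R]_(n, p)) s t v : 0 < s -> s <= t ->
  0 <= qf (res W s - res W t) v.
Proof.
move=> s0 st; have t0 := lt_le_trans s0 st; rewrite qf_res_diff//.
have ts : 0 <= t - s by rewrite subr_ge0.
by rewrite mulr_ge0// addr_ge0 ?nsq_ge0// mulr_ge0// qf_res_ge0.
Qed.

End QuadraticMatrices.

(** * Bordered inverses and Schur complements of columns *)

Section BorderedInverse.
Context (R : fieldType) (p : nat) (A B : 'M[R]_p) (e : 'rV[R]_p) (k : 'cV[R]_p) (t g : R).
Hypotheses (t0 : t != 0) (AB : A *m B = 1%:M) (sB : B^T = B).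
Hypotheses (Ae : A *m e^T = t *: e^T) (Be : B *m e^T = t^-1 *: e^T).
Hypotheses (ek : e *m k = 0) (ee : e *m e^T = 1%:M).

Let M := A + k *m e + e^T *m k^T + g *: (e^T *m e).
Let y := e^T - B *m k.
Let D := t + g - (k^T *m B *m k) 0 0.

Let ke : k^T *m e^T = 0. Proof. by rewrite -trmx_mul ek trmx0. Qed.
Let eB : e *m B = t^-1 *: e.
Proof. by apply: trmx_inj; rewrite trmx_mul sB Be linearZ. Qed.
Let ey : e *m y = 1%:M.
Proof. by rewrite /y mulmxBr ee mulmxA eB -scalemxAl ek scaler0 subr0. Qed.

Let My : M *m y = D *: e^T.
Proof.
have Ay : A *m y = t *: e^T - k by rewrite /y mulmxBr Ae mulmxA AB mul1mx.
have ky : k^T *m y = (- (k^T *m B *m k) 0 0)%:M.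
  by rewrite /y mulmxBr ke sub0r mulmxA [X in - X]mx11_scalar raddfN.
rewrite /M !mulmxDl -(mulmxA k) -(mulmxA e^T) -scalemxAl -(mulmxA e^T) ey ky Ay.
rewrite !mulmx1 mul_mx_scalar subrK /D !scalerDl scaleNr.
by rewrite addrAC.
Qed.

(** No block decomposition is used. [A] acts as [t] on the direction [e], and the border [k],
    orthogonal to [e], couples that direction to the rest. Since [M y = D e^T], the vector [y / D]
    is the new column of the inverse, and a rank one term replaces the old entry [t^-1]. *)
Lemma bordered_inverse : D != 0 ->
  M *m (B - t^-1 *: (e^T *m e) + D^-1 *: (y *m y^T)) = 1%:M.
Proof.
move=> D0.
have ty : y^T = e - k^T *m B by rewrite /y linearB /= trmxK trmx_mul sB.
have MB : M *m B = 1%:M + t^-1 *: (k *m e) + e^T *m (k^T *m B) + t^-1 *: (g *: (e^T *m e)).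
  rewrite /M !mulmxDl AB -(mulmxA k) eB -scalemxAr -(mulmxA e^T); congr (_ + _).
  by rewrite -scalemxAl -(mulmxA e^T) eB -scalemxAr !scalerA mulrC.
have Mee : M *m (e^T *m e) = t *: (e^T *m e) + k *m e + g *: (e^T *m e).
  rewrite mulmxA /M !mulmxDl Ae -(mulmxA k) ee mulmx1 -(mulmxA e^T k^T) ke mulmx0 mul0mx addr0.
  by rewrite -!scalemxAl -(mulmxA e^T e) ee mulmx1.
rewrite mulmxDr mulmxBr MB -!scalemxAr Mee [M *m (y *m _)]mulmxA My.
rewrite -scalemxAl [D^-1 *: _]scalerA mulVf// scale1r ty mulmxBr.
move: (e^T *m (k^T *m B)) (e^T *m e) (k *m e) => U V N.
by apply/matrixP => i j; rewrite !mxE; field.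
Qed.

End BorderedInverse.

Section ColumnUpdate.
Context (R : realType) (n p : nat) (W : 'M[R]_(n, p)) (l : 'I_p) (t : R).
Hypothesis t0 : 0 < t.

(** The column is emptied instead of deleted, so the size [p] is kept. The price is a spurious
    diagonal entry [t^-1] in the resolvent. *)
Definition zcol : 'M[R]_(n, p) := \matrix_(i, j) if j == l then 0 else W i j.

Local Notation V := zcol.
Local Notation R' := (res zcol t).
Local Notation e := (delta_mx 0 l : 'rV[R]_p).
Local Notation c := (col l W).
Local Notation k := (zcol^T *m col l W).

(** Equal to [t (V V^T + t)^-1] with [V = zcol]: for small [t] nearly the projection orthogonal to
    the other columns. It does not involve column [l], which enters [schur] only as the vector of
    the quadratic form. *)
Definition schur_mx : 'M[R]_n := 1%:M - zcol *m res zcol t *m zcol^T.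
Definition schur : R := t + qf schur_mx (col l W)^T.

Lemma zcol_delta : zcol *m e^T = 0.
Proof.
rewrite trmx_delta -colE; apply/colP => i; rewrite !mxE eqxx //.
Qed.

Lemma zcolD : W = zcol + c *m e.
Proof.
apply/matrixP => i j; rewrite !mxE big_ord1 !mxE eqxx /=.
by case: eqP => [->|]; rewrite ?mulr1 ?add0r// mulr0 addr0.
Qed.

Lemma res_zcol_delta : res zcol t *m e^T = t^-1 *: e^T.
Proof.
apply: (can_inj (mulKmx (gram_unit V t0))); rewrite mulmxA mulmxV ?gram_unit// mul1mx.
rewrite mulmxDl -scalemxAr -mulmxA zcol_delta mulmx0 scaler0 add0r.
by rewrite mul_scalar_mx scalerA divff ?scale1r// gt_eqF.
Qed.

Lemma delta_delta : e *m e^T = 1%:M.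
Proof. by apply/matrixP => i j; rewrite !ord1 -/(nsq e) nsq_delta mxE eqxx. Qed.

Lemma delta_k : e *m k = 0.
Proof. by rewrite mulmxA -[e *m _]trmxK trmx_mul trmxK zcol_delta trmx0 mul0mx. Qed.

Lemma gram_zcol : gram W = gram zcol + k *m e + e^T *m k^T + (nsq c^T) *: (e^T *m e).
Proof.
rewrite (_ : gram W = (V + c *m e)^T *m (V + c *m e)); last by rewrite -zcolD.
rewrite [(_ + _)^T]linearD /= mulmxDl !mulmxDr [(c *m e)^T]trmx_mul [(_ *m c)^T]trmx_mul trmxK !mulmxA addrA.
congr (_ + _).
rewrite -(mulmxA e^T) [c^T *m c]mx11_scalar /nsq trmxK.
by rewrite mul_mx_scalar -scalemxAl.
Qed.

Lemma schurE : schur = t + nsq c^T - (k^T *m res zcol t *m k) 0 0.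
Proof.
rewrite /schur /schur_mx qfD qfN qf_scalar mul1r addrA; congr (_ + _ - _).
by rewrite /qf trmx_mul !trmxK !mulmxA.
Qed.

(** Column [l] of the resolvent of [W], multiplied by [schur]. *)
Definition schur_vec : 'cV[R]_p := e^T - res zcol t *m k.

Lemma res_zcolE : schur != 0 -> res W t =
  res zcol t - t^-1 *: (e^T *m e) + schur^-1 *: (schur_vec *m schur_vec^T).
Proof.
move=> D0; apply: res_unique => //.
have -> : gram W + t%:M = (gram V + t%:M) + k *m e + e^T *m k^T + nsq c^T *: (e^T *m e).
  rewrite gram_zcol; move: (gram V) (k *m e) (e^T *m k^T) (_ *: _) => a0 a b d.
  by rewrite addrAC (addrAC _ b) (addrAC a0).
rewrite schurE; apply: bordered_inverse.
- by rewrite gt_eqF.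
- by rewrite mulmxV// gram_unit.
- exact: res_sym.
- by rewrite mulmxDl -mulmxA zcol_delta mulmx0 add0r mul_scalar_mx.
- exact: res_zcol_delta.
- exact: delta_k.
- exact: delta_delta.
- by rewrite -schurE.
Qed.

Lemma mul_res_zcol_gram : zcol *m res zcol t *m zcol^T *m (zcol *m res zcol t *m zcol^T) =
  zcol *m res zcol t *m zcol^T - t *: (zcol *m (res zcol t *m res zcol t) *m zcol^T).
Proof.
rewrite !mulmxA -(mulmxA _ V^T V) -/(gram V) -(mulmxA V (res V t)) mul_res_gram//.
by rewrite mulmxBr mulmx1 !mulmxBl -scalemxAr -!scalemxAl.
Qed.

Lemma schur_mx_sym : schur_mx^T = schur_mx.
Proof.
by rewrite /schur_mx linearB /= trmx1 !trmx_mul trmxK res_sym mulmxA.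
Qed.

(* B = B^2 + t V R'^2 V^T, hence 0 <= B <= 1 *)
Lemma schur_mx_sqr : schur_mx =
  schur_mx *m schur_mx + t *: (zcol *m (res zcol t *m res zcol t) *m zcol^T).
Proof.
rewrite {2 3}/schur_mx mulmxBl !mulmxBr !mul1mx mulmx1 mul_res_zcol_gram.
rewrite /schur_mx; move: (V *m res V t *m V^T) (t *: _) => A B.
by rewrite opprB (addrC A) addrK subrK.
Qed.

Lemma qf_schur_mx v : qf schur_mx v = nsq (v *m schur_mx) + t * nsq (v *m zcol *m res zcol t).
Proof.
rewrite {1}schur_mx_sqr qfD qfZ qf_sqr ?schur_mx_sym//; congr (_ + _ * _).
by rewrite qf_conj qf_sqr ?res_sym.
Qed.

Lemma qf_schur_mx_ge0 v : 0 <= qf schur_mx v.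
Proof. by rewrite qf_schur_mx addr_ge0 ?nsq_ge0// mulr_ge0 ?nsq_ge0// ltW. Qed.

Lemma schur_mx_diag_ge0 i : 0 <= schur_mx i i.
Proof. by rewrite -qf_delta qf_schur_mx_ge0. Qed.

Lemma schur_ge : t <= schur.
Proof. by rewrite /schur lerDl qf_schur_mx_ge0. Qed.

Lemma schur_gt0 : 0 < schur.
Proof. exact: lt_le_trans schur_ge. Qed.

Lemma tr_schur_mx : \tr schur_mx = n%:R - p%:R + t * \tr (res zcol t).
Proof.
rewrite /schur_mx linearB /= mxtrace1 -mulmxA mxtrace_mulC -mulmxA mul_res_gram//.
by rewrite linearB /= mxtrace1 linearZ /= opprB addrA addrAC.
Qed.

Lemma tr_schur_mx_ge : n%:R - p%:R <= \tr schur_mx.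
Proof. by rewrite tr_schur_mx lerDl mulr_ge0 ?res_tr_ge0// ltW. Qed.

(** Row [i] of this contraction has squared norm at most its diagonal entry, hence at most 1. The
    bound is uniform in [t], which is what allows the level [1/n]. *)
Lemma frob2_schur_mx : frob2 schur_mx <= n%:R.
Proof.
have -> : frob2 schur_mx = \sum_i nsq (delta_mx 0 i *m schur_mx).
  apply: eq_bigr => i _; rewrite -rowE nsqE.
  by apply: eq_bigr => j _; rewrite [in RHS]mxE.
rewrite -[X in _ <= X%:R](card_ord n) -sum1_card natr_sum.
apply: ler_sum => i _.
apply: (@le_trans _ _ (qf schur_mx (delta_mx 0 i))).
  by rewrite qf_schur_mx lerDl mulr_ge0 ?nsq_ge0// ltW.
rewrite /schur_mx qfD qfN qf_scalar nsq_delta mulr1 gerBl.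
by rewrite qf_conj qf_res_ge0.
Qed.

Lemma res_diag_schur : res W t l l = schur^-1.
Proof.
have D0 : schur != 0 by rewrite gt_eqF// schur_gt0.
have E : e *m res W t *m e^T = schur^-1 *: 1%:M.
  have ey : e *m schur_vec = 1%:M.
    rewrite /schur_vec mulmxBr delta_delta [e *m (_ *m _)]mulmxA.
    have -> : e *m res V t = t^-1 *: e.
      by apply: trmx_inj; rewrite trmx_mul res_sym res_zcol_delta linearZ.
    by rewrite -scalemxAl delta_k scaler0 subr0.
  have ye : schur_vec^T *m e^T = 1%:M by rewrite -trmx_mul ey trmx1.
  rewrite res_zcolE// mulmxDr mulmxBr mulmxDl mulmxBl.
  rewrite -(mulmxA e (res V t)) res_zcol_delta -!scalemxAr delta_delta.
  rewrite -!scalemxAl !mulmxA delta_delta mul1mx delta_delta subrr add0r.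
  by rewrite ey mul1mx ye.
by rewrite -qf_delta /qf E !mxE eqxx mulr1.
Qed.

(** Apart from the spurious [t^-1] of the emptied coordinate, restoring the column adds a positive
    rank one matrix. *)
Lemma tr_res_zcol : \tr (res zcol t) - t^-1 <= \tr (res W t).
Proof.
rewrite res_zcolE ?gt_eqF ?schur_gt0//.
have : 0 <= \tr (schur_vec *m schur_vec^T).
  by rewrite mxtrace_mulC trace_mx11; have := nsq_ge0 schur_vec^T; rewrite /nsq trmxK.
move: (schur_vec *m _) => A A0.
rewrite mxtraceD mxtraceZ -scaleNr (mxtraceD (res _ _)) mxtraceZ (mxtrace_mulC e^T).
rewrite delta_delta mxtrace1 mulr1n mulNr mulr1 lerDl.
by rewrite mulr_ge0 ?invr_ge0 ?(ltW schur_gt0).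
Qed.

End ColumnUpdate.

Lemma sherman_morrison (R : fieldType) p (A B : 'M[R]_p) (r : 'rV[R]_p) :
  A *m B = 1%:M -> 1 + (r *m B *m r^T) 0 0 != 0 ->
  (A + r^T *m r) *m (B - (1 + (r *m B *m r^T) 0 0)^-1 *: (B *m r^T *m (r *m B))) = 1%:M.
Proof.
move=> AB q1; rewrite mulmxBr !mulmxDl AB -!scalemxAr.
have -> : A *m (B *m r^T *m (r *m B)) = r^T *m r *m B.
  by rewrite !mulmxA AB mul1mx.
have -> : r^T *m r *m (B *m r^T *m (r *m B)) = (r *m B *m r^T) 0 0 *: (r^T *m r *m B).
  have E := mx11_scalar (r *m B *m r^T); move: (_ 0 0) E => q E.
  by rewrite -[r^T *m r *m _]mulmxA (mulmxA r) (mulmxA r B) E mul_scalar_mx -scalemxAr mulmxA.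
move: (r^T *m r *m B) ((r *m B *m r^T) 0 0) q1 => C q q1.
by apply/matrixP => i j; rewrite !mxE; field.
Qed.

(** * Rank one row updates *)

Section RowUpdate.
Context (R : realType) (n p : nat) (W : 'M[R]_(n, p)) (l : 'I_n) (t : R).
Hypothesis t0 : 0 < t.

Definition zrow : 'M[R]_(n, p) := \matrix_(i, j) if i == l then 0 else W i j.

Lemma gram_zrow : gram W = gram zrow + (row l W)^T *m row l W.
Proof.
apply/matrixP => i j; rewrite !mxE big_ord1 !mxE (bigD1 l)//= addrC.
rewrite [in RHS](bigD1 l)//= !mxE eqxx mul0r add0r; congr (_ + _).
by apply: eq_bigr => h hl; rewrite !mxE (negbTE hl).
Qed.

Let q := qf (res zrow t) (row l W).
Let q0 : 0 <= q. Proof. exact: qf_res_ge0. Qed.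

Lemma res_zrowE : res W t = res zrow t -
  (1 + q)^-1 *: (res zrow t *m (row l W)^T *m (row l W *m res zrow t)).
Proof.
apply: res_unique => //; rewrite gram_zrow addrAC; apply: sherman_morrison.
  by rewrite mulmxV// gram_unit.
by rewrite gt_eqF// ltr_wpDr.
Qed.

Lemma qf_res_zrow : qf (res W t) (row l W) = q / (1 + q).
Proof.
have q1 : 1 + q != 0 by rewrite gt_eqF// ltr_wpDr.
rewrite res_zrowE qfD qfN qfZ -/q.
have -> : qf (res zrow t *m (row l W)^T *m (row l W *m res zrow t)) (row l W) = q * q.
  have E : row l W *m res zrow t *m (row l W)^T = q%:M by rewrite [LHS]mx11_scalar.
  rewrite /qf (mulmxA (row l W)) (mulmxA (row l W)) E mul_scalar_mx -scalemxAl E.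
  by rewrite !mxE.
by field.
Qed.

(** The difference is [|r R'|^2 / (1 + q)] with [r] the row and [R'] the resolvent without it, and
    [t |r R'|^2 <= q]. *)
Lemma tr_res_zrow : 0 <= \tr (res zrow t) - \tr (res W t) <= t^-1.
Proof.
rewrite res_zrowE -scaleNr mxtraceD mxtraceZ mulNr opprD addrA subrr sub0r opprK.
have -> : \tr (res zrow t *m (row l W)^T *m (row l W *m res zrow t)) =
    nsq (row l W *m res zrow t).
  by rewrite mxtrace_mulC trace_mx11 /nsq trmx_mul res_sym.
rewrite mulr_ge0 ?nsq_ge0 ?invr_ge0 ?addr_ge0//=.
rewrite ler_pdivrMl ?ltr_wpDr// mulrDl mul1r.
have := qf_res_ge zrow t0 (row l W); rewrite -ler_pdivlMl// -/q => H.
by rewrite (le_trans H)// mulrC lerDr invr_ge0 ltW.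
Qed.

End RowUpdate.

(** * Removal of a small shift from an inverse *)

Section InverseShift.
Context (R : realType) (n : nat) (A : 'M[R]_n) (k t : R).
Hypotheses (k0 : 0 < k) (t0 : 0 < t) (cA : coercive k A).

Lemma coercive_shift : coercive (k + t) (A + t%:M).
Proof.
split; first by rewrite linearD /= tr_scalar_mx cA.1.
by move=> v; rewrite qfD qf_scalar mulrDl lerD2r cA.2.
Qed.

Let kt0 : 0 < k + t. Proof. exact: addr_gt0. Qed.

(** With [B = A + t] this is the expansion [A^-1 = B^-1 + t B^-2 + t^2 B^-1 A^-1 B^-1]. *)
Lemma qf_inv_shift v (u := v *m invmx (A + t%:M)) :
  qf (invmx A) v = qf (invmx (A + t%:M)) v + t * (nsq u + t * qf (invmx A) u).
Proof.
have U := coercive_unit kt0 coercive_shift.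
have UA := coercive_unit k0 cA.
have sI := coercive_inv_sym coercive_shift.
have vE : v = u *m (A + t%:M) by rewrite /u mulmxKV.
have -> : qf (invmx (A + t%:M)) v = qf A u + t * nsq u.
  by rewrite (qf_invmx kt0 coercive_shift) -/u qfD qf_scalar.
have -> : qf (invmx A) v = qf A u + t * nsq u + t * nsq u + t * (t * qf (invmx A) u).
  have sAt : (A + t%:M)^T = A + t%:M by case: coercive_shift.
  rewrite {1}vE -{1}sAt -qf_conj trmxK sAt.
  have -> : (A + t%:M) *m invmx A *m (A + t%:M) =
      A + t%:M + (t%:M + t *: (t *: invmx A)).
    rewrite mulmxDl mulmxV// mul_scalar_mx mulmxDl mul1mx; congr (_ + _).
    by rewrite mulmxDr -scalemxAl mulVmx// mul_mx_scalar scalemx1.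
  by rewrite !qfD !qf_scalar !qfZ addrA.
by ring.
Qed.

Lemma qf_inv_le v : qf (invmx A) v <= k^-1 * nsq v.
Proof.
have UA := coercive_unit k0 cA.
set q := qf (invmx A) v.
have q0 : 0 <= q by exact: (qf_invmx_ge0 k0 cA).
have : q ^+ 2 <= nsq v * nsq (v *m invmx A).
  have c1 : coercive (1 : R) (1%:M : 'M[R]_n).
    by split=> [|w]; rewrite ?trmx1// qf_scalar.
  have := coercive_CS ltr01 c1 v (v *m invmx A).
  by rewrite mulmx1 !qf_scalar !mul1r trmx_mul (coercive_inv_sym cA) mulmxA.
have := qf_invmx_ge k0 cA v; rewrite -/q => h1 h2.
have [->|qn] := eqVneq q 0; first by rewrite mulr_ge0 ?nsq_ge0// invr_ge0 ltW.
have qp : 0 < q by rewrite lt_def qn.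
rewrite -(ler_pM2l qp) -expr2 (le_trans h2)//.
rewrite (_ : q * (k^-1 * nsq v) = nsq v * (k^-1 * q)); last by ring.
by rewrite ler_wpM2l ?nsq_ge0// ler_pdivlMl.
Qed.

(** Since [t <= k], the second order term is at most the first order one, whence the factor 2;
    coercivity [c] of the shifted matrix bounds [nsq u] by the form itself. The error is relative,
    so it can be summed with arbitrary nonnegative weights. *)
Lemma qf_inv_shift_le c v : 0 < c -> coercive c (A + t%:M) -> t <= k ->
  qf (invmx (A + t%:M)) v <= qf (invmx A) v <=
  (1 + 2 * t / c) * qf (invmx (A + t%:M)) v.
Proof.
move=> c0 cc tk; rewrite qf_inv_shift; set u := v *m _.
have qu0 : 0 <= qf (invmx A) u by exact: (qf_invmx_ge0 k0 cA).
have qu := qf_inv_le u.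
have nu := qf_invmx_ge c0 cc v; rewrite -/u in nu.
have tqu : t * qf (invmx A) u <= nsq u.
  rewrite (le_trans (ler_wpM2l (ltW t0) qu))// mulrA ler_piMl ?nsq_ge0//.
  by rewrite ler_pdivrMr// mul1r.
apply/andP; split; first by rewrite lerDl !(mulr_ge0, addr_ge0) ?nsq_ge0// ltW.
rewrite mulrDl mul1r lerD2l.
have NQ : nsq u <= qf (invmx (A + t%:M)) v / c by rewrite ler_pdivlMr// mulrC.
rewrite (_ : 2 * t / c * _ = t * (2 * (qf (invmx (A + t%:M)) v / c))); last by ring.
by rewrite ler_wpM2l ?(ltW t0)//; lra.
Qed.

End InverseShift.

(** * Comparison of two levels through Schur complements *)

Section BlockDeterministic.
Context (R : realType) (n p : nat) (W : 'M[R]_(n, p)).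
Variables (t t' : R).
Hypotheses (t0 : 0 < t) (tt' : t <= t').
Let t'0 : 0 < t' := lt_le_trans t0 tt'.

Lemma tr_resE s : 0 < s -> \tr (res W s) = \sum_l (schur W l s)^-1.
Proof. by move=> s0; apply: eq_bigr => l _; rewrite res_diag_schur. Qed.

Lemma schur_mx_diff l :
  schur_mx W l t' - schur_mx W l t =
  zcol W l *m (res (zcol W l) t - res (zcol W l) t') *m (zcol W l)^T.
Proof.
by rewrite /schur_mx opprB addrC addrA subrK mulmxBr mulmxBl.
Qed.

Lemma qf_schur_mx_diff_ge0 l v : 0 <= qf (schur_mx W l t' - schur_mx W l t) v.
Proof. by rewrite schur_mx_diff qf_conj qf_res_diff_ge0. Qed.

Lemma schur_diff l : schur W l t' - schur W l t =
  t' - t + qf (schur_mx W l t' - schur_mx W l t) (col l W)^T.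
Proof. by rewrite /schur qfD qfN; ring. Qed.

Lemma le_schur l : schur W l t <= schur W l t'.
Proof. by rewrite -subr_ge0 schur_diff addr_ge0 ?subr_ge0 ?qf_schur_mx_diff_ge0. Qed.

(** The dimensions cancel between the levels, and the contribution of the lower level has the
    favourable sign. The summand 1 is [t' * t'^-1], from the emptied coordinate. *)
Lemma tr_schur_mx_diff l : \tr (schur_mx W l t' - schur_mx W l t) <= 1 + t' * \tr (res W t').
Proof.
have := tr_res_zcol W l t'0; have := res_tr_ge0 (zcol W l) t0.
rewrite mxtraceD raddfN /= !tr_schur_mx// => x0 x1.
have : t' * \tr (res (zcol W l) t') <= 1 + t' * \tr (res W t').
  have := ler_wpM2l (ltW t'0) x1; rewrite mulrBr divff ?gt_eqF//; lra.
have : 0 <= t * \tr (res (zcol W l) t) by rewrite mulr_ge0// ltW.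
lra.
Qed.

(* [1 / D - 1 / D' <= (D' - D) / k^2] *)
Lemma tr_res_diff k : 0 < k -> (forall l, k <= schur W l t) ->
  0 <= \tr (res W t) - \tr (res W t') <=
  k^-1 ^+ 2 * \sum_l (t' + qf (schur_mx W l t' - schur_mx W l t) (col l W)^T).
Proof.
move=> k0 Hk; rewrite !tr_resE// -sumrB mulr_sumr; apply/andP; split.
  apply: sumr_ge0 => l _; rewrite subr_ge0 lef_pV2 ?posrE ?schur_gt0//.
  exact: le_schur.
apply: ler_sum => l _.
have D0 := schur_gt0 W l t0; have D'0 := schur_gt0 W l t'0.
have -> : (schur W l t)^-1 - (schur W l t')^-1 =
    (schur W l t)^-1 * (schur W l t')^-1 * (schur W l t' - schur W l t).
  by field; rewrite !gt_eqF.
apply: ler_pM.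
- by rewrite mulr_ge0// invr_ge0 ltW.
- by rewrite subr_ge0 le_schur.
- have h1 : (schur W l t)^-1 <= k^-1 by rewrite lef_pV2.
  have h2 : (schur W l t')^-1 <= k^-1.
    by rewrite lef_pV2// (le_trans (Hk l))// le_schur.
  by rewrite expr2 ler_pM// invr_ge0 ltW.
- by rewrite schur_diff lerD2r gerBl ltW.
Qed.

End BlockDeterministic.

(** * Weighted rows and the empirical eta transform *)

Section WeightedRows.
Context (R : realType) (n p : nat) (g : 'rV[R]_n) (Z : 'M[R]_(n, p)).
Variables (a b : R).
Hypotheses (a0 : 0 < a) (gab : forall j, a <= g 0 j <= b).

Definition wmx : 'M[R]_(n, p) := diag_mx (map_mx Num.sqrt g) *m Z.

Definition eta_emp (x : R) : R := n%:R^-1 * \sum_j (1 + x * g 0 j)^-1.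

Let g0 j : 0 < g 0 j. Proof. by apply: lt_le_trans a0 _; case/andP: (gab j). Qed.

Lemma wmxE i j : wmx i j = Num.sqrt (g 0 i) * Z i j.
Proof. by rewrite /wmx mul_diag_mx !mxE. Qed.

Lemma row_wmx j : row j wmx = Num.sqrt (g 0 j) *: row j Z.
Proof.
by apply/rowP => l; transitivity (wmx j l); [rewrite !mxE|rewrite wmxE !mxE].
Qed.

Lemma qf_scale m (A : 'M[R]_m) c v : qf A (c *: v) = c ^+ 2 * qf A v.
Proof. by rewrite /qf linearZ /= -scalemxAr -!scalemxAl !mxE mulrA expr2. Qed.

Lemma qf_row_wmx (A : 'M[R]_p) j : qf A (row j wmx) = g 0 j * qf A (row j Z).
Proof. by rewrite row_wmx qf_scale sqr_sqrtr// ltW. Qed.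

Lemma qf_col_wmx (A : 'M[R]_n) l : qf A (col l wmx)^T =
  quadform (fun i j => Num.sqrt (g 0 i) * A i j * Num.sqrt (g 0 j)) (fun i => Z i l).
Proof.
have E i : (col l wmx)^T 0 i = Num.sqrt (g 0 i) * Z i l.
  by transitivity (wmx i l); [rewrite !mxE|exact: wmxE].
rewrite qfE; apply: eq_bigr => i _; apply: eq_bigr => j _.
by rewrite !E; ring.
Qed.

Lemma sum_qf_row m (A : 'M[R]_p) (V : 'M[R]_(m, p)) :
  \sum_j qf A (row j V) = \tr (gram V *m A).
Proof.
rewrite /gram -mulmxA mxtrace_mulC; apply: eq_bigr => j _.
by rewrite /qf -row_mul tr_row !mxE; apply: eq_bigr => l _; rewrite !mxE.
Qed.

Lemma inv1D_lip (x y : R) j : 0 <= x -> 0 <= y ->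
  `|(1 + x * g 0 j)^-1 - (1 + y * g 0 j)^-1| <= b * `|x - y|.
Proof.
move=> x0 y0; have /andP[_ gb] := gab j.
have X : 1 <= 1 + x * g 0 j by rewrite lerDl mulr_ge0// ltW.
have Y : 1 <= 1 + y * g 0 j by rewrite lerDl mulr_ge0// ltW.
have X0 := lt_le_trans ltr01 X; have Y0 := lt_le_trans ltr01 Y.
have -> : (1 + x * g 0 j)^-1 - (1 + y * g 0 j)^-1 =
  (1 + x * g 0 j)^-1 * (1 + y * g 0 j)^-1 * (g 0 j * (y - x)).
  by field; rewrite !gt_eqF.
set u := _^-1 * _^-1.
have u0 : 0 <= u by rewrite mulr_ge0// invr_ge0 ltW.
have u1 : u <= 1 by rewrite mulr_ile1 ?invr_ge0 ?(ltW X0) ?(ltW Y0)// invf_le1.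
rewrite normrM (ger0_norm u0) normrM (gtr0_norm (g0 j)) distrC.
rewrite (le_trans (ler_piMl _ u1))//; first by rewrite mulr_ge0// ltW.
by rewrite ler_wpM2r.
Qed.

Lemma eta_emp_lip (x y : R) : (0 < n)%N -> 0 <= x -> 0 <= y ->
  `|eta_emp x - eta_emp y| <= b * `|x - y|.
Proof.
move=> n0 x0 y0; rewrite /eta_emp -mulrBr -sumrB normrM ger0_norm ?invr_ge0//.
rewrite ler_pdivrMl ?ltr0n// (le_trans (ler_norm_sum _ _ _))//.
apply: (@le_trans _ _ (\sum_(j < n) b * `|x - y|)).
  by apply: ler_sum => j _; exact: inv1D_lip.
by rewrite sumr_const card_ord mulr_natl.
Qed.

(** Summing [q / (1 + q)] over the rows gives [tr (S R) = p - t tr R], with [S] the Gram matrix of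
    [wmx] and [R] its resolvent. So the average of [(1 + z_j g_j)^-1], with [z_j] the form at row
    [j], is exactly [1 - p/n + (t/n) tr R]. The error comes from replacing [z_j] by the trace
    without row [j] and then by the full trace, each at Lipschitz cost [b]. *)
Lemma eta_emp_res t : 0 < t -> (0 < n)%N ->
  `|eta_emp (\tr (res wmx t)) - (1 - p%:R / n%:R + t / n%:R * \tr (res wmx t))| <=
  b * (n%:R^-1 * \sum_j `|qf (res (zrow wmx j) t) (row j Z) - \tr (res (zrow wmx j) t)| + t^-1).
Proof.
move=> t0 n0; set x := \tr _.
have x0 : 0 <= x by exact: res_tr_ge0.
pose z j := qf (res (zrow wmx j) t) (row j Z).
have z0 j : 0 <= z j by exact: qf_res_ge0.
have nn0 : n%:R != 0 :> R by rewrite pnatr_eq0 -lt0n.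
have E : \sum_j (1 + z j * g 0 j)^-1 = n%:R - p%:R + t * x.
  have := sum_qf_row (res wmx t) wmx; rewrite mul_gram_res// mxtraceD raddfN /= mxtraceZ mxtrace1.
  have -> : \sum_j qf (res wmx t) (row j wmx) = n%:R - \sum_j (1 + z j * g 0 j)^-1.
    rewrite -[X in X%:R - _](card_ord n) -sum1_card natr_sum -sumrB.
    apply: eq_bigr => j _; rewrite qf_res_zrow// qf_row_wmx -/(z j).
    have : 1 + z j * g 0 j != 0 by rewrite gt_eqF// ltr_wpDr// mulr_ge0// ltW.
    by rewrite (mulrC (g 0 j)) => h; field.
  rewrite -/x => H; lra.
have -> : 1 - p%:R / n%:R + t / n%:R * x = n%:R^-1 * \sum_j (1 + z j * g 0 j)^-1.
  by rewrite E; field.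
rewrite /eta_emp -mulrBr -sumrB normrM ger0_norm ?invr_ge0//.
rewrite ler_pdivrMl ?ltr0n// (le_trans (ler_norm_sum _ _ _))//.
have b0 : 0 <= b by case: (n) n0 g gab => // m _ g' /(_ ord0) /andP[/(le_trans (ltW a0))] /le_trans H /H.
apply: (@le_trans _ _ (\sum_j b * (`|z j - \tr (res (zrow wmx j) t)| + t^-1))).
  apply: ler_sum => j _; rewrite (le_trans (inv1D_lip _ _ _))// ler_wpM2l// distrC.
  have /andP[d0 d1] := tr_res_zrow wmx j t0.
  by rewrite (le_trans (ler_distD (\tr (res (zrow wmx j) t)) _ _))// lerD2l ger0_norm.
rewrite -mulr_sumr mulrCA ler_wpM2l// big_split /= mulrDr mulVKf// lerD2l.
by rewrite sumr_const card_ord mulr_natl.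
Qed.

End WeightedRows.

(** * Deterministic conclusion for one block *)

Section BlockConclusion.
Context (R : realType) (n p : nat) (g : 'rV[R]_n) (Z : 'M[R]_(n, p)).
Variables (a b dl tau : R).
Hypotheses (a0 : 0 < a) (gab : forall j, a <= g 0 j <= b).
Hypotheses (n0 : (0 < n)%N) (pn : (p <= n)%N) (dl0 : 0 < dl) (tau0 : 0 < tau) (tau1 : tau <= 1).

Local Notation W := (wmx g Z).
Local Notation t := (n%:R^-1 : R).
Local Notation t' := (tau * n%:R : R).

Hypothesis n_dl : 2 / dl <= n%:R.
Hypothesis n_tau : t <= tau ^+ 2.

(** The deviation of a column form from its conditional mean, taken for the increment between the
    levels: [tr_res_diff] compares the two Schur complements directly. *)
Definition coldev l : R :=
  qf (schur_mx W l t' - schur_mx W l t) (col l W)^T -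
  \sum_i g 0 i * (schur_mx W l t' - schur_mx W l t) i i.

Definition rowdev j : R :=
  qf (res (zrow W j) t') (row j Z) - \tr (res (zrow W j) t').

Hypothesis H1 : forall l, dl * n%:R <= schur W l t.
Hypothesis H2 : \sum_l `|coldev l| <= n%:R * (tau * n%:R).
Hypothesis H3 : \sum_j `|rowdev j| <= n%:R * tau.

Let nR0 : 0 < n%:R :> R. Proof. by rewrite ltr0n. Qed.
Let nR1 : 1 <= n%:R :> R. Proof. by rewrite ler1n. Qed.
Let t0 : 0 < t. Proof. by rewrite invr_gt0. Qed.
Let t'0 : 0 < t'. Proof. by rewrite mulr_gt0. Qed.
Let g0 j : 0 < g 0 j. Proof. by apply: lt_le_trans a0 _; case/andP: (gab j). Qed.
Let b0 : 0 <= b.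
Proof. by have /andP[/(le_trans (ltW a0))] := gab (Ordinal n0) => /le_trans H /H. Qed.
Let pnR : p%:R <= n%:R :> R. Proof. by rewrite ler_nat. Qed.

Let tt' : t <= t'.
Proof.
by rewrite (le_trans n_tau)// expr2 ler_wpM2l ?(ltW tau0)// (le_trans tau1).
Qed.

Let t_small : t <= dl / 2.
Proof. by rewrite -[leRHS]invrK lef_pV2 ?posrE ?invr_gt0 ?divr_gt0// invf_div. Qed.

Let x1 := \tr (res W t).
Let x' := \tr (res W t').

Let x1_ge0 : 0 <= x1. Proof. exact: res_tr_ge0. Qed.
Let x'_ge0 : 0 <= x'. Proof. exact: res_tr_ge0. Qed.

Lemma tr_res_le : \tr (res W t) <= dl^-1.
Proof.
rewrite tr_resE//; apply: (@le_trans _ _ (\sum_(l < p) (dl * n%:R)^-1)).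
  by apply: ler_sum => l _; rewrite lef_pV2 ?posrE ?schur_gt0// mulr_gt0.
rewrite sumr_const card_ord -[_ *+ p]mulr_natl.
have -> : p%:R * (dl * n%:R)^-1 = dl^-1 * (p%:R / n%:R) by field; rewrite !gt_eqF.
by apply: ler_piMr; rewrite ?invr_ge0 ?(ltW dl0)// ler_pdivrMr// mul1r.
Qed.

(** Here the smallest eigenvalue is controlled, through [nsq_le_tr] and the bounded trace.
    Subtracting [t <= dl / 2] afterwards leaves the unshifted Gram matrix coercive. *)
Lemma shift_coercive : coercive dl (gram W + t%:M).
Proof.
split; first by case: (gram_coercive W t).
move=> v; have := nsq_le_tr t0 (gram_coercive W t) v; rewrite -/(res W t) => H.
have q0 := coercive_qf_ge0 t0 (gram_coercive W t) v.
by rewrite mulrC -ler_pdivlMr// mulrC (le_trans H)// ler_wpM2r// tr_res_le.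
Qed.

Lemma block_coercive : coercive (dl / 2) (gram W).
Proof.
split; first by rewrite /gram trmx_mul trmxK.
move=> v; have := shift_coercive.2 v; rewrite qfD qf_scalar.
have := ler_wpM2r (nsq_ge0 v) t_small; lra.
Qed.

Let dl20 : 0 < dl / 2. Proof. by rewrite divr_gt0. Qed.

Lemma block_unit : gram W \in unitmx.
Proof. exact: coercive_unit dl20 block_coercive. Qed.

Lemma block_qf v : qf (res W t) v <= qf (invmx (gram W)) v <= (1 + 2 * t / dl) * qf (res W t) v.
Proof. exact: (qf_inv_shift_le dl20 t0 block_coercive v dl0 shift_coercive t_small). Qed.

Let x := \tr (invmx (gram W)).

Lemma block_tr : \tr (res W t) <= x <= (1 + 2 * t / dl) * \tr (res W t).
Proof.
rewrite /x /mxtrace mulr_sumr; apply/andP; split; apply: ler_sum => l _;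
  by have /andP[] := block_qf (delta_mx 0 l); rewrite !qf_delta.
Qed.

Lemma block_tr_bound : 0 <= x <= 2 / dl.
Proof.
have /andP[h1 h2] := block_tr; apply/andP; split; first exact: le_trans h1.
rewrite (le_trans h2)//; apply: ler_pM => //; last exact: tr_res_le.
  by rewrite addr_ge0// divr_ge0 ?(ltW dl0)// mulr_ge0// ltW.
have : 2 * t / dl <= 1; last by lra.
by rewrite ler_pdivrMr// mul1r mulrC -ler_pdivlMr.
Qed.

Let x_x1 : `|x - x1| <= 2 / dl ^+ 2 * tau.
Proof.
have /andP[h1 h2] := block_tr; rewrite ger0_norm ?subr_ge0//.
rewrite lerBlDl (le_trans h2)// mulrDl mul1r lerD2l.
have t_tau : t <= tau by rewrite (le_trans n_tau)// expr2 ler_piMl// ltW.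
have -> : 2 * t / dl * \tr (res W t) = (2 / dl * \tr (res W t)) * t by ring.
have -> : 2 / dl ^+ 2 * tau = (2 / dl * dl^-1) * tau by field; rewrite gt_eqF.
apply: ler_pM => //; first by rewrite mulr_ge0// divr_ge0// ltW.
by rewrite ler_wpM2l ?tr_res_le// divr_ge0// ltW.
Qed.

Let x1_x' : `|x1 - x'| <= dl^-1 ^+ 2 * (2 + b + b / dl) * tau.
Proof.
have dn0 : 0 < dl * n%:R by rewrite mulr_gt0.
have /andP[h1 h2] := tr_res_diff t0 tt' dn0 H1.
rewrite ger0_norm// (le_trans h2)//.
have -> : (dl * n%:R)^-1 ^+ 2 = dl^-1 ^+ 2 * (n%:R ^+ 2)^-1 by field; rewrite !gt_eqF.
rewrite -[leLHS]mulrA -[leRHS]mulrA; apply: ler_wpM2l; first by rewrite exprn_ge0// invr_ge0 ltW.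
rewrite ler_pdivrMl ?exprn_gt0//.
have x'dl : x' <= dl^-1.
  by rewrite (le_trans _ tr_res_le)// -subr_ge0.
(* The deterministic part of one column: [t'], plus a conditional mean with weights at most [b] and
   trace at most [1 + t' / dl]. *)
pose m := tau * n%:R + (b * (1 + t' / dl)).
apply: (@le_trans _ _ (\sum_(l < p) m + \sum_l `|coldev l|)).
  rewrite -big_split /=; apply: ler_sum => l _; rewrite /m -[leRHS]addrA lerD2l.
  rewrite -lerBlDr.
  pose M := schur_mx W l t' - schur_mx W l t.
  have M0 i : 0 <= M i i by rewrite -qf_delta; exact: qf_schur_mx_diff_ge0.
  have : \sum_i g 0 i * M i i <= b * (1 + t' / dl).
    apply: (@le_trans _ _ (b * \tr M)).
      rewrite /mxtrace mulr_sumr; apply: ler_sum => i _; rewrite ler_wpM2r//.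
      by case/andP: (gab i).
    rewrite ler_wpM2l// (le_trans (tr_schur_mx_diff W t0 tt' l))// lerD2l.
    by rewrite ler_wpM2l// ltW.
  have := ler_norm (coldev l); rewrite /coldev -/M; lra.
rewrite sumr_const card_ord -[_ *+ p]mulr_natl.
have m0 : 0 <= m.
  by rewrite addr_ge0 ?(ltW t'0)// mulr_ge0// addr_ge0// divr_ge0 ?(ltW t'0) ?(ltW dl0).
apply: (@le_trans _ _ (n%:R * m + n%:R * (tau * n%:R))).
  by apply: lerD; [exact: ler_wpM2r|exact: H2].
rewrite -mulrDr expr2 -[leRHS]mulrA ler_wpM2l ?(ltW nR0)// /m.
(* The summand [b] of [m] carries no factor [tau]; the assumption [1/n <= tau^2] supplies it. *)
have b_tau : b <= n%:R * (b * tau).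
  rewrite mulrCA ler_peMr// -ler_pdivrMl// mulr1 (le_trans n_tau)//.
  by rewrite expr2 ler_piMl// ltW.
have -> : n%:R * ((2 + b + b / dl) * tau) =
    2 * (tau * n%:R) + n%:R * (b * tau) + b * (t' / dl) by ring.
by move: b_tau; lra.
Qed.

(** The first term is the Lipschitz cost of moving from the true inverse to the level [tau * n]. The
    term [2 * b] covers row deviations and row removal, and [dl^-1] bounds the remainder
    [(t' / n) tr R]. *)
Lemma block_eta :
  `|eta_emp g x - (1 - p%:R / n%:R)| <=
  (b * (2 / dl ^+ 2 + dl^-1 ^+ 2 * (2 + b + b / dl)) + 2 * b + dl^-1) * tau.
Proof.
have /andP[xx0 _] := block_tr_bound.
have xx' : `|x - x'| <= (2 / dl ^+ 2 + dl^-1 ^+ 2 * (2 + b + b / dl)) * tau.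
  by rewrite (le_trans (ler_distD x1 _ _))// mulrDl lerD.
have h1 := eta_emp_lip a0 gab n0 xx0 x'_ge0.
have h2 := eta_emp_res Z a0 gab t'0 n0.
rewrite -/x' in h2.
have -> : eta_emp g x - (1 - p%:R / n%:R) = (eta_emp g x - eta_emp g x') +
   (eta_emp g x' - (1 - p%:R / n%:R + t' / n%:R * x')) + t' / n%:R * x' by ring.
rewrite (le_trans (ler_normD _ _))// (@mulrDl _ _ dl^-1); apply: lerD; last first.
  rewrite ger0_norm; last by rewrite mulr_ge0// divr_ge0 ?(ltW t'0) ?(ltW nR0).
  rewrite mulfK ?gt_eqF// mulrC ler_wpM2r ?(ltW tau0)//.
  rewrite (le_trans _ tr_res_le)// -subr_ge0.
  have dn0 : 0 < dl * n%:R by rewrite mulr_gt0.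
  by have /andP[] := tr_res_diff t0 tt' dn0 H1.
rewrite (le_trans (ler_normD _ _))// mulrDl; apply: lerD.
  by rewrite (le_trans h1)// -mulrA ler_wpM2l.
rewrite (le_trans h2)// (mulrC 2) -mulrA ler_wpM2l//.
have : t'^-1 <= tau.
  rewrite invfM mulrC ler_pdivrMr// -expr2; exact: n_tau.
have : n%:R^-1 * \sum_j `|rowdev j| <= tau by rewrite ler_pdivrMl.
rewrite /rowdev; lra.
Qed.

End BlockConclusion.

(** * Exceptional events *)

Section MatrixMeasurability.
Context d (T : measurableType d) (R : realType).

Definition mmx m n (F : T -> 'M[R]_(m, n)) :=
  forall i j, measurable_fun setT (fun w => F w i j).

Lemma measurable_invr (f : T -> R) : measurable_fun setT f ->
  measurable_fun setT (fun w => (f w)^-1).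
Proof.
(* The square gives [powR] a nonnegative base, and the factor [f w] makes both sides vanish where
   [f] does. *)
move=> mf; have -> : (fun w => (f w)^-1) = (fun w => f w * (f w ^+ 2) `^ (-1)).
  apply/funext => w; rewrite powR_inv1 ?sqr_ge0//.
  have [->|f0] := eqVneq (f w) 0; first by rewrite invr0 mul0r.
  by field.
apply: measurable_funM => //.
apply: (measurableT_comp (measurable_powR (-1))); exact: measurable_funX.
Qed.

Lemma mmx_cst m n (A : 'M[R]_(m, n)) : mmx (fun=> A).
Proof. by move=> i j; exact: measurable_cst. Qed.

Lemma mmx_add m n (F G : T -> 'M[R]_(m, n)) : mmx F -> mmx G -> mmx (fun w => F w + G w).
Proof. by move=> mF mG i j; under eq_fun do rewrite mxE; exact: measurable_funD. Qed.

Lemma mmx_opp m n (F : T -> 'M[R]_(m, n)) : mmx F -> mmx (fun w => - F w).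
Proof.
by move=> mF i j; under eq_fun do rewrite mxE; exact: (measurableT_comp (@oppr_measurable R setT)).
Qed.

Lemma mmx_sub m n (F G : T -> 'M[R]_(m, n)) : mmx F -> mmx G -> mmx (fun w => F w - G w).
Proof. by move=> mF mG; apply: mmx_add => //; exact: mmx_opp. Qed.

Lemma mmx_tr m n (F : T -> 'M[R]_(m, n)) : mmx F -> mmx (fun w => (F w)^T).
Proof. by move=> mF i j; under eq_fun do rewrite mxE; exact: mF. Qed.

Lemma mmx_mul m n q (F : T -> 'M[R]_(m, n)) (G : T -> 'M[R]_(n, q)) :
  mmx F -> mmx G -> mmx (fun w => F w *m G w).
Proof.
move=> mF mG i j; under eq_fun do rewrite mxE; apply: measurable_sum => l.
exact: measurable_funM.
Qed.

Lemma mmx_trace n (F : T -> 'M[R]_n) : mmx F -> measurable_fun setT (fun w => \tr (F w)).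
Proof. by move=> mF; rewrite /mxtrace; apply: measurable_sum => i; exact: mF. Qed.

Lemma mmx_det n (F : T -> 'M[R]_n) : mmx F -> measurable_fun setT (fun w => \det (F w)).
Proof.
move=> mF; rewrite /determinant; apply: measurable_sum => s.
by apply: measurable_funM => //; apply: measurable_prod => i _; exact: mF.
Qed.

Lemma mmx_inv n (F : T -> 'M[R]_n) : mmx F -> (forall w, F w \in unitmx) ->
  mmx (fun w => invmx (F w)).
Proof.
move=> mF UF i j; under eq_fun => w do rewrite /invmx UF !mxE /cofactor.
apply: measurable_funM; first exact/measurable_invr/mmx_det.
apply: measurable_funM => //; apply: mmx_det => i' j'.
by under eq_fun do rewrite !mxE; exact: mF.
Qed.

Lemma mmx_gram n p (F : T -> 'M[R]_(n, p)) : mmx F -> mmx (fun w => gram (F w)).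
Proof. by move=> mF; apply: mmx_mul => //; exact: mmx_tr. Qed.

Lemma mmx_res n p (F : T -> 'M[R]_(n, p)) t : 0 < t -> mmx F -> mmx (fun w => res (F w) t).
Proof.
move=> t0 mF; apply: mmx_inv => [|w]; last exact: gram_unit.
by apply: mmx_add; [exact: mmx_gram|exact: mmx_cst].
Qed.

Lemma mmx_schur_mx n p (F : T -> 'M[R]_(n, p)) l t : 0 < t ->
  mmx (fun w => zcol (F w) l) -> mmx (fun w => schur_mx (F w) l t).
Proof.
move=> t0 mF; apply: mmx_sub; first exact: mmx_cst.
by apply: mmx_mul; [apply: mmx_mul => //; exact: mmx_res|exact: mmx_tr].
Qed.

Lemma measurable_quadform (K : finType) (M : T -> K -> K -> R) (x : T -> K -> R) :
  (forall i j, measurable_fun setT (fun w => M w i j)) ->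
  (forall i, measurable_fun setT (fun w => x w i)) ->
  measurable_fun setT (fun w => quadform (M w) (x w)).
Proof.
move=> mM mx; rewrite /quadform; apply: measurable_sum => i; apply: measurable_sum => j.
by apply: measurable_funM => //; exact: measurable_funM.
Qed.

Lemma measurable_leS (f g : T -> R) : measurable_fun setT f -> measurable_fun setT g ->
  measurable [set w | f w <= g w].
Proof. by move=> mf mg; rewrite -[X in measurable X]setTI; exact: measurable_fun_le. Qed.

End MatrixMeasurability.

(** * Quadratic forms with an independent random matrix *)

Section DecoupledForms.
Local Open Scope ereal_scope.
Context (R : realType) (law : probability R R).
Context d (T : measurableType d) (P : probability T R).
Variables (I K : finType) (X : I -> {RV P >-> R}) (f : K -> I).
Hypothesis iidX : iid_with_law law X.
Hypothesis injf : injective f.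

Lemma iid_with_law_comp : iid_with_law law (X \o f).
Proof.
case: iidX => indX lawX; split; last by move=> i B mB; exact: lawX.
move=> J B mB.
(* Indices outside the image of [f] receive the full line, hence no constraint. *)
pose B' i := if [pick k | f k == i] is Some k then B k else setT.
have B'f k : B' (f k) = B k.
  by rewrite /B'; case: pickP => [k' /eqP/injf ->//|/(_ k)]; rewrite eqxx.
have mB' i : measurable (B' i) by rewrite /B'; case: pickP.
have -> : \bigcap_(k in [set` J]) ((X \o f) k @^-1` B k) =
    \bigcap_(i in [set` (f @: J)%SET]) (X i @^-1` B' i).
  apply/seteqP; split => w /= H.
    by move=> _ /imsetP[k kJ ->] /=; rewrite B'f; exact: H.
  by move=> k kJ; have := H (f k) (imset_f _ kJ); rewrite /= B'f.
rewrite indX// big_imset /=; last by move=> ? ? _ _; exact: injf.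
by apply: eq_bigr => k _; rewrite B'f.
Qed.

Variables (J1 J2 : {set I}) (M : T -> K -> K -> R).
Hypothesis J12 : {in J1, forall i, i \notin J2}.
Hypothesis fJ1 : forall k, f k \in J1.
Hypothesis mM : forall i j, measurable_fun [set: sigma_of X J2] ((fun w => M w i j) : sigma_of X J2 -> R).

Let Q (z : T * T) : R := quadform (M z.2) (fun k => X (f k) z.1).

Let mQ : measurable_fun [set: sigma_of X J1 * sigma_of X J2] Q.
Proof.
apply: (@measurable_quadform _ (sigma_of X J1 * sigma_of X J2)%type).
  move=> i j; exact: (measurableT_comp (mM i j)).
move=> i; have mc : measurable_fun [set: sigma_of X J1] (X (f i) : sigma_of X J1 -> R).
  exact: measurable_coord.
exact: (measurableT_comp mc).
Qed.

Let mtr : measurable_fun [set: sigma_of X J1 * sigma_of X J2] (fun z => \sum_k M z.2 k k)%R.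
Proof. by apply: measurable_sum => k; exact: (measurableT_comp (mM k k)). Qed.

(** The matrix is frozen and the deterministic bound integrated over it. The event [A] belongs to
    the sigma-algebra of the matrix, so it may be frozen too; this admits a Frobenius bound valid
    only on [A]. *)
Lemma decoupled_moment4 (C F : R) (A : set T) : (0 <= C)%R -> (0 <= F)%R ->
  (forall M' : K -> K -> R,
    \int[P]_w ((quadform M' ((X \o f)^~ w) - \sum_k M' k k) ^+ 4)%:E <= (C * frob2 M' ^+ 2)%:E) ->
  measurable (A : set (sigma_of X J2)) -> (forall w, A w -> (frob2 (M w) <= F)%R) ->
  \int[P]_w (\1_A w * (quadform (M w) (fun k => X (f k) w) - \sum_k M w k k) ^+ 4)%:E <= (C * F ^+ 2)%:E.
Proof.
move=> C0 F0 HC mA HF; have [indX _] := iidX.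
pose h (z : T * T) : \bar R := (\1_A z.2 * (Q z - \sum_k M z.2 k k) ^+ 4)%:E.
have h0 z : 0 <= h z.
  by rewrite lee_fin mulr_ge0// (even_pow_ge0 _ 2).
rewrite [leLHS](_ : _ = \int[P]_w \int[P]_u h (u, w)); last first.
  apply: (decoupling_family (h := h) indX J12) => //.
  apply/measurable_EFinP; apply: measurable_funM.
    have m1 : measurable_fun [set: sigma_of X J2] (\1_A : sigma_of X J2 -> R).
      exact: measurable_indic.
    exact: (measurableT_comp m1).
  by apply: measurable_funX; exact: measurable_funB.
rewrite -(integral_cst_prob P).
have mA' : measurable A by exact: (g_sigma_algebra_sub (@cyl_measurable _ _ _ _ _ X J2)).
have mMT i j : measurable_fun setT (fun w => M w i j) by exact: sub_measurable_fun (mM i j).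
have mh : measurable_fun [set: T * T] h.
  apply/measurable_EFinP; apply: measurable_funM.
    exact: (measurableT_comp (measurable_indic mA')).
  apply: measurable_funX; apply: measurable_funB.
    apply: measurable_quadform => [i j|i]; first exact: (measurableT_comp (mMT i j)).
    exact: measurableT_comp.
  by apply: measurable_sum => k; exact: (measurableT_comp (mMT k k)).
apply: ge0_le_integral => //.
- by move=> w _; exact: integral_ge0.
- exact: measurable_fun_fubini_tonelli_G.
- move=> w _; rewrite /h /=; have [wA|wA] := boolP (w \in A); last first.
    rewrite integral0_eq ?lee_fin ?mulr_ge0 ?exprn_ge0// => u _.
    by rewrite indicE (negbTE wA) mul0r.
  rewrite indicE wA; under eq_integral do rewrite mul1r.
  apply: le_trans (HC (M w)) _; rewrite lee_fin ler_wpM2l//.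
  by apply: lerXn2r; rewrite ?nnegrE ?frob2_ge0//; apply: HF; rewrite -inE.
Qed.

Lemma decoupled_lower (C mu F s : R) : (0 <= C)%R -> (0 < s)%R ->
  (forall M' : K -> K -> R, (forall k, 0 <= M' k k)%R ->
    P [set w | (quadform M' ((X \o f)^~ w) <= mu * \sum_k M' k k)%R] *
    ((\sum_k M' k k) ^+ 6)%:E <= (C * frob2 M' ^+ 3)%:E) ->
  (forall w k, 0 <= M w k k)%R -> (forall w, frob2 (M w) <= F)%R ->
  (forall w, s <= \sum_k M w k k)%R ->
  P [set w | (quadform (M w) (fun k => X (f k) w) <= mu * \sum_k M w k k)%R] <=
  (C * F ^+ 3 / s ^+ 6)%:E.
Proof.
move=> C0 s0 HC M0 HF Hs; have [indX _] := iidX.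
pose E : set (T * T) := [set z | (Q z <= mu * \sum_k M z.2 k k)%R].
have mMT i j : measurable_fun setT (fun w => M w i j) by exact: sub_measurable_fun (mM i j).
have mQT : measurable_fun [set: T * T] Q.
  apply: measurable_quadform => [i j|i]; first exact: (measurableT_comp (mMT i j)).
  exact: measurableT_comp.
have mtT : measurable_fun [set: T * T] (fun z => \sum_k M z.2 k k)%R.
  by apply: measurable_sum => k; exact: (measurableT_comp (mMT k k)).
have mE : measurable E.
  by apply: measurable_leS => //; exact: measurable_funM.
have mE' : measurable (E : set (sigma_of X J1 * sigma_of X J2)).
  by apply: measurable_leS => //; exact: measurable_funM.
pose h (z : T * T) : \bar R := (\1_E z)%:E.
have h0 z : 0 <= h z by rewrite lee_fin.
have mdiag : measurable_fun [set: T] (fun w : T => (w, w)) by exact: measurable_fun_pair.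
rewrite [leLHS](_ : _ = \int[P]_w h (w, w)); last first.
  rewrite /h integral_indic//=; first by rewrite setIT.
  by rewrite -[X in measurable X]setTI; exact: mdiag.
rewrite (decoupling_family (h := h) indX J12) => //; last first.
  by apply/measurable_EFinP; exact: measurable_indic.
rewrite -(integral_cst_prob P).
have mh : measurable_fun [set: T * T] h.
  by apply/measurable_EFinP; exact: measurable_indic.
apply: ge0_le_integral => //.
- by move=> w _; exact: integral_ge0.
- exact: measurable_fun_fubini_tonelli_G.
- move=> w _.
  have s6 : (0 < (\sum_k M w k k) ^+ 6)%R by rewrite exprn_gt0// (lt_le_trans s0).
  have mEw : measurable [set u | E (u, w)].
    have := measurable_ysection w mE; congr (measurable _).
    by apply/seteqP; split => u; rewrite ysectionE.
  have -> : \int[P]_u h (u, w) = P [set u | E (u, w)].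
    by rewrite /h integral_indic//= ?setIT//.
  have := HC (M w) (M0 w); rewrite -lee_pdivlMr// => /le_trans; apply.
  rewrite -EFinM lee_fin; apply: ler_pM.
  + by rewrite mulr_ge0// exprn_ge0// frob2_ge0.
  + by rewrite invr_ge0 ltW.
  + by rewrite ler_wpM2l//; apply: lerXn2r; rewrite ?nnegrE ?frob2_ge0// (le_trans (frob2_ge0 (M w))).
  + by rewrite lef_pV2 ?posrE// ?exprn_gt0//; apply: lerXn2r; rewrite ?nnegrE// ltW// (lt_le_trans s0).
Qed.

End DecoupledForms.

(** * Markov bounds for averages of deviations *)

Section Markov.
Local Open Scope ereal_scope.
Context d (T : measurableType d) (R : realType) (P : probability T R).

Lemma sum_sqr_le (q : nat) (x : 'I_q -> R) :
  ((\sum_l x l) ^+ 2 <= q%:R * \sum_l x l ^+ 2)%R.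
Proof.
rewrite expr2 big_distrlr /=.
apply: (@le_trans _ _ (\sum_i \sum_j (x i ^+ 2 + x j ^+ 2) / 2))%R.
  apply: ler_sum => i _; apply: ler_sum => j _; have := sqr_ge0 (x i - x j)%R; nra.
have Sx : (\sum_i \sum_(j < q) x i ^+ 2 = q%:R * \sum_i x i ^+ 2)%R.
  rewrite mulr_sumr; apply: eq_bigr => i _.
  by rewrite sumr_const card_ord mulr_natl.
have -> : (\sum_i \sum_j (x i ^+ 2 + x j ^+ 2) / 2 =
    \sum_(i < q) \sum_(j < q) x i ^+ 2 / 2 + \sum_(i < q) \sum_(j < q) x j ^+ 2 / 2)%R.
  rewrite -big_split /=; apply: eq_bigr => i _; rewrite -big_split /=.
  by apply: eq_bigr => j _; rewrite mulrDl.
rewrite [X in (_ + X <= _)%R]exchange_big /=.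
have -> : (\sum_(i < q) \sum_(j < q) x i ^+ 2 / 2 = q%:R * (\sum_i x i ^+ 2) / 2)%R.
  by rewrite -Sx mulr_suml; apply: eq_bigr => i _; rewrite mulr_suml.
by rewrite -splitr.
Qed.

Lemma sum_pow4_le (q : nat) (x : 'I_q -> R) :
  ((\sum_l x l) ^+ 4 <= q%:R ^+ 3 * \sum_l x l ^+ 4)%R.
Proof.
have h1 := sum_sqr_le x; have h2 := sum_sqr_le (fun l => x l ^+ 2)%R.
have -> : ((\sum_l x l) ^+ 4 = ((\sum_l x l) ^+ 2) ^+ 2)%R by rewrite -exprM.
apply: (@le_trans _ _ ((q%:R * \sum_l x l ^+ 2) ^+ 2))%R.
  by apply: lerXn2r; rewrite ?nnegrE ?sqr_ge0// mulr_ge0// sumr_ge0// => l _; exact: sqr_ge0.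
have -> : (\sum_l x l ^+ 4 = \sum_l (x l ^+ 2) ^+ 2)%R.
  by apply: eq_bigr => l _; rewrite -exprM.
move: h2; move: (\sum_l (x l ^+ 2) ^+ 2)%R (\sum_l x l ^+ 2)%R => A B h2.
rewrite (_ : q%:R ^+ 3 * A = q%:R ^+ 2 * (q%:R * A))%R; last by ring.
by rewrite exprMn ler_wpM2l ?sqr_ge0.
Qed.

(** By the power mean inequality an average has a fourth moment no larger than a common bound on
    those of its terms. No independence between the terms and no union bound is involved. *)
Lemma avg_markov4 (q : nat) (D : 'I_q -> T -> R) (F s : R) :
  (forall l, measurable_fun setT (D l)) -> (0 < s)%R -> (0 <= F)%R ->
  (forall l, \int[P]_w (D l w ^+ 4)%:E <= F%:E) ->
  measurable [set w | (q%:R * s < \sum_l `|D l w|)%R] /\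
  P [set w | (q%:R * s < \sum_l `|D l w|)%R] <= (F / s ^+ 4)%:E.
Proof.
move=> mD s0 F0 HF; set E := [set w | _].
have mS : measurable_fun setT (fun w => \sum_l `|D l w|)%R.
  by apply: measurable_sum => l; exact: measurableT_comp.
have mE : measurable E.
  rewrite (_ : E = ~` [set w | (\sum_l `|D l w| <= q%:R * s)%R]).
    by apply: measurableC; exact: measurable_leS.
  by apply/seteqP; split => w; rewrite /E /= ltNge => /negP.
split=> //.
(* An empty sum cannot exceed 0; otherwise one may divide by [q]. *)
have [q0|q0] := posnP q.
  have -> : E = set0.
    apply/seteqP; split=> w //; rewrite /E /=; move: D {mS mE E mD HF}; rewrite q0 => D.
    by rewrite big_ord0 mul0r ltxx.
  by rewrite measure0 lee_fin divr_ge0// (even_pow_ge0 _ 2).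
have q0' : (0 < q%:R :> R)%R by rewrite ltr0n.
have s40 : (0 < s ^+ 4)%R by rewrite exprn_gt0.
have mD4 l : measurable_fun setT (fun w => (D l w ^+ 4)%:E).
  by apply/measurable_EFinP; exact: measurable_funX.
have D40 l w : 0 <= (D l w ^+ 4)%:E by rewrite lee_fin (even_pow_ge0 _ 2).
have key w : (q%:R * s ^+ 4 * \1_E w <= \sum_l D l w ^+ 4)%R.
  rewrite indicE; have [|_] := boolP (w \in E); last first.
    by rewrite mulr0 sumr_ge0// => l _; exact: (even_pow_ge0 _ 2).
  rewrite inE mulr1 /E /= => /ltW wE.
  rewrite -(ler_pM2l (exprn_gt0 3 q0')).
  have -> : (q%:R ^+ 3 * (q%:R * s ^+ 4) = (q%:R * s) ^+ 4)%R by ring.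
  apply: (@le_trans _ _ ((\sum_l `|D l w|) ^+ 4)%R).
    by apply: lerXn2r; rewrite ?nnegrE ?mulr_ge0 ?sumr_ge0// ltW.
  rewrite (le_trans (sum_pow4_le _))//.
  apply: ler_wpM2l; first by rewrite exprn_ge0// ltW.
  apply: ler_sum => l _.
  by rewrite -normrX ger0_norm// (even_pow_ge0 _ 2).
rewrite EFinM -[_ * _]muleC lee_pdivlMl//.
rewrite -(@lee_pmul2l _ q%:R%:E)// ?lte_fin//.
apply: (@le_trans _ _ (\int[P]_w ((q%:R * s ^+ 4 * \1_E w)%:E))).
  under eq_integral do rewrite EFinM.
  have k0 : (0 <= q%:R * s ^+ 4)%R by rewrite mulr_ge0// ltW.
  rewrite ge0_integralZl//; try first [by apply/measurable_EFinP; exact: measurable_indic |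
    by move=> w _; rewrite lee_fin | by rewrite lee_fin].
  by rewrite integral_indic// setIT EFinM muleA.
apply: (@le_trans _ _ (\int[P]_w (\sum_l (D l w ^+ 4)%:E))).
  apply: ge0_le_integral => //.
  - by move=> w _; rewrite lee_fin !mulr_ge0// ltW.
  - by apply/measurable_EFinP; apply: measurable_funM => //; exact: measurable_indic.
  - by apply: emeasurable_sum.
  - by move=> w _; rewrite sumEFin lee_fin; exact: key.
rewrite ge0_integral_sum//.
apply: (@le_trans _ _ (\sum_(l < q) F%:E)); first by apply: lee_sum => l _.
by rewrite sumEFin lee_fin sumr_const card_ord mulr_natl.
Qed.

End Markov.

Section FrobeniusBounds.
Variable R : realType.

Lemma frob2E n (A : 'M[R]_n) : frob2 A = \sum_i nsq (row i A).
Proof.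
by apply: eq_bigr => i _; rewrite nsqE; apply: eq_bigr => j _; rewrite mxE.
Qed.

Lemma frob2_sub n (A B : 'M[R]_n) : frob2 (B - A) <= 2 * frob2 A + 2 * frob2 B.
Proof.
rewrite /frob2 !mulr_sumr -big_split /=; apply: ler_sum => i _.
rewrite !mulr_sumr -big_split /=; apply: ler_sum => j _.
rewrite !mxE; have := sqr_ge0 (A i j + B i j); nra.
Qed.

Lemma frob2_weighted n (g : 'rV[R]_n) b (A : 'M[R]_n) : (forall j, 0 <= g 0 j <= b) ->
  frob2 (fun i j => Num.sqrt (g 0 i) * A i j * Num.sqrt (g 0 j)) <= b ^+ 2 * frob2 A.
Proof.
move=> gb; rewrite /frob2 mulr_sumr; apply: ler_sum => i _.
rewrite mulr_sumr; apply: ler_sum => j _.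
have /andP[gi0 gib] := gb i; have /andP[gj0 gjb] := gb j.
rewrite !exprMn !sqr_sqrtr// mulrAC ler_wpM2r ?sqr_ge0//.
by rewrite expr2 ler_pM.
Qed.

Lemma tr_weighted n (g : 'rV[R]_n) (A : 'M[R]_n) : (forall j, 0 <= g 0 j) ->
  \sum_i (Num.sqrt (g 0 i) * A i i * Num.sqrt (g 0 i)) = \sum_i g 0 i * A i i.
Proof.
by move=> g0; apply: eq_bigr => i _; rewrite mulrAC -expr2 sqr_sqrtr.
Qed.

(** Row [i] has squared norm at most [R_ii / t]; as that norm is at least [R_ii^2], also
    [R_ii <= 1/t]. Useful at the high level, where [t] is of order [n]. *)
Lemma frob2_res_le n p (W : 'M[R]_(n, p)) t : 0 < t ->
  frob2 (res W t) <= p%:R / t ^+ 2.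
Proof.
move=> t0; rewrite frob2E.
have Rii i : res W t i i <= t^-1.
  have := qf_res_ge W t0 (delta_mx 0 i); rewrite qf_delta -rowE => h.
  have h2 : res W t i i ^+ 2 <= nsq (row i (res W t)).
    by rewrite nsqE (bigD1 i)//= mxE lerDl sumr_ge0// => j _; exact: sqr_ge0.
  have r0 := res_diag_ge0 W t0 i.
  have [->|rn] := eqVneq (res W t i i) 0; first by rewrite invr_ge0 ltW.
  have rp : 0 < res W t i i by rewrite lt_def rn.
  rewrite -(ler_pM2l t0) divff ?gt_eqF// -(ler_pM2r rp) mul1r.
  by rewrite -mulrA -expr2 (le_trans _ h)// ler_wpM2l// ltW.
apply: (@le_trans _ _ (\sum_(i < p) (t ^+ 2)^-1)).
  apply: ler_sum => i _; have := qf_res_ge W t0 (delta_mx 0 i).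
  rewrite qf_delta -rowE -ler_pdivlMl// => /le_trans; apply.
  by rewrite expr2 invfM ler_wpM2l// invr_ge0 ltW.
by rewrite sumr_const card_ord mulr_natl.
Qed.

(** From [R_ij^2 <= R_ii * R_jj]. This serves the level [1/n], where the trace stays bounded on good
    events while [p / t^2] explodes. *)
Lemma frob2_res_tr n p (W : 'M[R]_(n, p)) t : 0 < t ->
  frob2 (res W t) <= \tr (res W t) ^+ 2.
Proof.
move=> t0; rewrite /frob2 /mxtrace expr2 big_distrlr /=.
apply: ler_sum => i _; apply: ler_sum => j _.
have cA := gram_coercive W t.
have := coercive_CS t0 cA (delta_mx 0 i *m res W t) (delta_mx 0 j *m res W t).
rewrite -!(qf_invmx t0 cA) -/(res W t) !qf_delta.
rewrite -(mulmxA (delta_mx 0 i)) mulVmx ?gram_unit// mulmx1.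
by rewrite trmx_mul res_sym mulmxA -rowE trmx_delta -colE !mxE.
Qed.

End FrobeniusBounds.

Lemma measure_bigsetU_le d (T : measurableType d) (R : realType) (P : probability T R)
    (J : Type) (s : seq J) (A : J -> set T) : (forall j, measurable (A j)) ->
  (P (\big[setU/set0]_(j <- s) A j) <= \sum_(j <- s) P (A j))%E.
Proof.
move=> mA; elim: s => [|j s IH]; first by rewrite !big_nil measure0.
rewrite !big_cons (le_trans (measureU2 _ _ _))//.
  by apply: bigsetU_measurable => i _; exact: mA.
exact: leeD.
Qed.

(** * Exceptional events of one block *)

Section BlockEvents.
Local Open Scope ereal_scope.
Context (R : realType) (law : probability R R) (C4 C6 mu : R).
Hypotheses (C40 : (0 <= C4)%R) (C60 : (0 <= C6)%R) (mu0 : (0 < mu)%R).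
Hypothesis H4 : forall d (T : measurableType d) (P : probability T R) (I : finType)
    (X : I -> {RV P >-> R}) (M : I -> I -> R), iid_with_law law X ->
  \int[P]_w ((quadform M (X^~ w) - \sum_i M i i) ^+ 4)%:E <= (C4 * frob2 M ^+ 2)%:E.
Hypothesis H6 : forall d (T : measurableType d) (P : probability T R) (I : finType)
    (X : I -> {RV P >-> R}) (M : I -> I -> R), iid_with_law law X ->
  (forall i, 0 <= M i i)%R ->
  P [set w | (quadform M (X^~ w) <= mu * \sum_i M i i)%R] *
    ((\sum_i M i i) ^+ 6)%:E <= (C6 * frob2 M ^+ 3)%:E.

Context d (T : measurableType d) (P : probability T R) (I : finType) (X : I -> {RV P >-> R}).
Hypothesis iidX : iid_with_law law X.
Context (n p : nat) (idx : 'I_n -> 'I_p -> I) (g : 'rV[R]_n) (a b th tau : R).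
Hypothesis idx_inj : forall i l i' l', idx i l = idx i' l' -> i = i' /\ l = l'.
Hypotheses (a0 : (0 < a)%R) (gab : forall j, (a <= g 0 j <= b)%R).
Hypotheses (n0 : (0 < n)%N) (th0 : (0 < th)%R) (pn : (th * n%:R <= n%:R - p%:R)%R).
Hypotheses (tau0 : (0 < tau)%R).

Definition Zm w : 'M[R]_(n, p) := \matrix_(i, l) X (idx i l) w.

Local Notation W w := (wmx g (Zm w)).
Local Notation t := (n%:R^-1 : R)%R.
Local Notation t' := (tau * n%:R : R)%R.

Let nR0 : (0 < n%:R :> R)%R. Proof. by rewrite ltr0n. Qed.
Let t0 : (0 < t)%R. Proof. by rewrite invr_gt0. Qed.
Let t'0 : (0 < t')%R. Proof. by rewrite mulr_gt0. Qed.
Let g0 j : (0 <= g 0 j)%R. Proof. by rewrite (le_trans (ltW a0))//; case/andP: (gab j). Qed.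
Let g0b j : (0 <= g 0 j <= b)%R. Proof. by rewrite g0; case/andP: (gab j). Qed.
Let b0 : (0 <= b)%R.
Proof. by have /andP[/le_trans H /H] := g0b (Ordinal n0). Qed.

Definition colset l : {set I} := [set idx i l | i : 'I_n]%SET.
Definition rowset j : {set I} := [set idx j l | l : 'I_p]%SET.

Let mX (J : {set I}) i : i \in J ->
  measurable_fun [set: sigma_of X J] (X i : sigma_of X J -> R).
Proof. exact: measurable_coord. Qed.

Lemma measurable_wmx_entry (J : {set I}) i l : idx i l \in J ->
  measurable_fun [set: sigma_of X J] ((fun w => W w i l) : sigma_of X J -> R).
Proof.
move=> iJ; under eq_fun do rewrite wmxE mxE.
by apply: measurable_funM => //; exact: mX.
Qed.

Lemma mmx_zcol_wmx l : @mmx _ (sigma_of X (~: colset l)) _ _ _ (fun w => zcol (W w) l).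
Proof.
move=> i j; under eq_fun do rewrite mxE.
have [_|jl] := eqVneq j l; first exact: measurable_cst.
apply: measurable_wmx_entry; rewrite inE; apply/imsetP => -[i' _ /idx_inj[_ jl']].
by rewrite jl' eqxx in jl.
Qed.

Lemma mmx_zrow_wmx j : @mmx _ (sigma_of X (~: rowset j)) _ _ _ (fun w => zrow (W w) j).
Proof.
move=> i l; under eq_fun do rewrite mxE.
have [_|ij] := eqVneq i j; first exact: measurable_cst.
apply: measurable_wmx_entry; rewrite inE; apply/imsetP => -[l' _ /idx_inj[ij' _]].
by rewrite ij' eqxx in ij.
Qed.

Let notinC (J : {set I}) : {in J, forall i, i \notin ~: J}.
Proof. by move=> i iJ; rewrite inE negbK. Qed.

Definition colweight (B : 'M[R]_n) i j : R :=
  (Num.sqrt (g 0 i) * B i j * Num.sqrt (g 0 j))%R.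

Definition lower_bad l := [set w |
  (quadform (colweight (schur_mx (W w) l t)) (fun i => X (idx i l) w) <=
   mu * \sum_i colweight (schur_mx (W w) l t) i i)%R].

Let mschur l s i j : (0 < s)%R -> measurable_fun [set: sigma_of X (~: colset l)]
  ((fun w => schur_mx (W w) l s i j) : sigma_of X (~: colset l) -> R).
Proof. by move=> s0; apply: mmx_schur_mx => //; exact: mmx_zcol_wmx. Qed.

Let idx_col l : injective (idx^~ l).
Proof. by move=> i i' /idx_inj[]. Qed.

Let idx_row j : injective (idx j).
Proof. by move=> i i' /idx_inj[]. Qed.

Lemma lower_bad_measurable l : measurable (lower_bad l).
Proof.
have mcw i j : measurable_fun setT (fun w => colweight (schur_mx (W w) l t) i j).
  apply: measurable_funM => //; apply: measurable_funM => //.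
  exact: sub_measurable_fun (@mschur l _ i j t0).
apply: measurable_leS; first exact: measurable_quadform.
by apply: measurable_funM => //; exact: measurable_sum.
Qed.

(** The trace of the weighted matrix is at least of order [n] and its squared Frobenius norm at most
    of order [n], so the ratio is [n^3 / n^6]. *)
Lemma lower_bad_le l : P (lower_bad l) <=
  (C6 * (b ^+ 2 * n%:R) ^+ 3 / (a * (th * n%:R)) ^+ 6)%:E.
Proof.
apply: (@decoupled_lower R law _ T P I 'I_n X (idx^~ l) iidX
  (colset l) (~: colset l) (fun w => colweight (schur_mx (W w) l t))).
- exact: notinC.
- by move=> k; exact: imset_f.
- move=> i j; apply: measurable_funM => //; apply: measurable_funM => //.
  exact: mschur.
- exact: C60.
- by rewrite !mulr_gt0.
- move=> M' M'0; apply: H6 => //.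
  exact: (iid_with_law_comp iidX (@idx_col l)).
- by move=> w k; rewrite !mulr_ge0 ?sqrtr_ge0// schur_mx_diag_ge0.
- move=> w; rewrite (le_trans (frob2_weighted _ g0b))//.
  by rewrite ler_wpM2l ?sqr_ge0// frob2_schur_mx.
- move=> w; rewrite tr_weighted//.
  apply: (@le_trans _ _ (a * \tr (schur_mx (W w) l t))%R).
    by rewrite ler_wpM2l ?(ltW a0)// (le_trans pn)// tr_schur_mx_ge.
  rewrite /mxtrace mulr_sumr; apply: ler_sum => i _.
  by rewrite ler_wpM2r ?schur_mx_diag_ge0//; case/andP: (gab i).
Qed.

Lemma lower_good l w : ~ lower_bad l w -> (mu * a * th * n%:R <= schur (W w) l t)%R.
Proof.
rewrite /lower_bad /= => /negP; rewrite -ltNge => H.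
rewrite /schur (qf_col_wmx) (le_trans _ (ler_wpDl (ltW t0) (lexx _)))//.
have -> : quadform (fun i j => Num.sqrt (g 0 i) * schur_mx (W w) l t i j * Num.sqrt (g 0 j))%R
    (fun i => Zm w i l) = quadform (colweight (schur_mx (W w) l t)) (fun i => X (idx i l) w).
  by congr quadform; apply/funext => i; rewrite mxE.
apply: le_trans (ltW H); rewrite -!mulrA ler_wpM2l ?(ltW mu0)//.
rewrite tr_weighted//.
apply: (@le_trans _ _ (a * \tr (schur_mx (W w) l t))%R).
  by rewrite ler_wpM2l ?(ltW a0)// (le_trans pn)// tr_schur_mx_ge.
rewrite /mxtrace mulr_sumr; apply: ler_sum => i _.
by rewrite ler_wpM2r ?schur_mx_diag_ge0//; case/andP: (gab i).
Qed.

Let cdev l w := coldev g (Zm w) tau l.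

Lemma coldevE l w : cdev l w =
  (quadform (colweight (schur_mx (W w) l t' - schur_mx (W w) l t)) (fun i => X (idx i l) w) -
  \sum_k colweight (schur_mx (W w) l t' - schur_mx (W w) l t) k k)%R.
Proof.
rewrite /cdev /coldev qf_col_wmx tr_weighted//; congr (_ - _)%R.
by congr quadform; apply/funext => i; rewrite mxE.
Qed.

Lemma mcdev l : measurable_fun setT (cdev l).
Proof.
have mcw i j : measurable_fun setT
    (fun w => colweight (schur_mx (W w) l t' - schur_mx (W w) l t) i j).
  apply: measurable_funM => //; apply: measurable_funM => //.
  under eq_fun do rewrite mxE [X in (_ + X)%R]mxE; apply: measurable_funB.
    exact: sub_measurable_fun (@mschur l _ i j t'0).
  exact: sub_measurable_fun (@mschur l _ i j t0).
rewrite (funext (coldevE l)).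
by apply: measurable_funB; [exact: measurable_quadform|exact: measurable_sum].
Qed.

Lemma cdev_moment l : \int[P]_w (cdev l w ^+ 4)%:E <= (C4 * (b ^+ 2 * (4 * n%:R)) ^+ 2)%:E.
Proof.
rewrite [leLHS](_ : _ = \int[P]_w (\1_(@setT T) w *
  (quadform (colweight (schur_mx (W w) l t' - schur_mx (W w) l t)) (fun k => X (idx k l) w) -
   \sum_k colweight (schur_mx (W w) l t' - schur_mx (W w) l t) k k) ^+ 4)%:E); last first.
  by apply: eq_integral => w _; rewrite indicT mul1r -coldevE.
apply: (@decoupled_moment4 R law _ T P I 'I_n X (idx^~ l) iidX (colset l) (~: colset l)
  (fun w => colweight (schur_mx (W w) l t' - schur_mx (W w) l t))).
- exact: notinC.
- by move=> k; exact: imset_f.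
- move=> i j; apply: measurable_funM => //; apply: measurable_funM => //.
  under eq_fun do rewrite mxE [X in (_ + X)%R]mxE; apply: measurable_funB.
    exact: (@mschur l _ i j t'0).
  exact: (@mschur l _ i j t0).
- exact: C40.
- by rewrite mulr_ge0 ?sqr_ge0// mulr_ge0.
- by move=> M'; apply: H4; exact: (iid_with_law_comp iidX (@idx_col l)).
- exact: measurableT.
- move=> w _; rewrite (le_trans (frob2_weighted _ g0b))// ler_wpM2l ?sqr_ge0//.
  rewrite (le_trans (frob2_sub _ _))//.
  have := frob2_schur_mx (W w) l t0; have := frob2_schur_mx (W w) l t'0; lra.
Qed.

Let rdev j w := rowdev g (Zm w) tau j.

Let mres j k l : measurable_fun [set: sigma_of X (~: rowset j)]
  ((fun w => res (zrow (W w) j) t' k l) : sigma_of X (~: rowset j) -> R).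
Proof. by apply: mmx_res => //; exact: mmx_zrow_wmx. Qed.

Lemma rowdevE j w : rdev j w =
  (quadform (res (zrow (W w) j) t') (fun l => X (idx j l) w) -
  \sum_k res (zrow (W w) j) t' k k)%R.
Proof.
rewrite /rdev /rowdev qfE; congr (_ - _)%R.
by congr quadform; apply/funext => k; rewrite !mxE.
Qed.

Lemma mrdev j : measurable_fun setT (rdev j).
Proof.
have mT k l : measurable_fun setT (fun w => res (zrow (W w) j) t' k l).
  exact: sub_measurable_fun (@mres j k l).
rewrite (funext (rowdevE j)).
by apply: measurable_funB; [exact: measurable_quadform|exact: measurable_sum].
Qed.

Lemma rdev_moment j : \int[P]_w (rdev j w ^+ 4)%:E <= (C4 * (p%:R / t' ^+ 2) ^+ 2)%:E.
Proof.
rewrite [leLHS](_ : _ = \int[P]_w (\1_(@setT T) w *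
  (quadform (res (zrow (W w) j) t') (fun l => X (idx j l) w) -
  \sum_k res (zrow (W w) j) t' k k) ^+ 4)%:E); last first.
  by apply: eq_integral => w _; rewrite indicT mul1r -rowdevE.
apply: (@decoupled_moment4 R law _ T P I 'I_p X (idx j) iidX (rowset j) (~: rowset j)
  (fun w => fun_of_matrix (res (zrow (W w) j) t'))).
- exact: notinC.
- by move=> k; exact: imset_f.
- move=> k l; exact: mres.
- exact: C40.
- by rewrite divr_ge0// exprn_ge0// ltW.
- by move=> M'; apply: H4; exact: (iid_with_law_comp iidX (@idx_row j)).
- exact: measurableT.
- by move=> w _; exact: frob2_res_le.
Qed.

(** One summand per exceptional event: a small Schur complement, the column deviations, the row
    deviations. Each event costs its summand times [n^-2]. *)
Definition block_const : R :=
  (C6 * (b ^+ 2) ^+ 3 / (a * th) ^+ 6 + C4 * (b ^+ 2 * 4) ^+ 2 / tau ^+ 4 + C4 / tau ^+ 8)%R.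

(* The union over columns costs a factor p <= n, paid by the rate n^-3 of [lower_bad_le]. *)
Lemma block_bad : exists2 E : set T, measurable E /\ P E <= (block_const / n%:R ^+ 2)%:E &
  forall w, ~ E w ->
  [/\ forall l, (mu * a * th * n%:R <= schur (W w) l t)%R,
     (\sum_l `|coldev g (Zm w) tau l| <= n%:R * t')%R &
     (\sum_j `|rowdev g (Zm w) tau j| <= n%:R * tau)%R].
Proof.
have pnR : (p%:R <= n%:R :> R)%R.
  by rewrite -subr_ge0 (le_trans _ pn)// mulr_ge0// ltW.
have [mE2 PE2] := @avg_markov4 _ T R P p cdev (C4 * (b ^+ 2 * (4 * n%:R)) ^+ 2)%R t'
   mcdev t'0 (mulr_ge0 C40 (sqr_ge0 _)) cdev_moment.
have [mE3 PE3] := @avg_markov4 _ T R P n rdev (C4 * (p%:R / t' ^+ 2) ^+ 2)%R tau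
   mrdev tau0 (mulr_ge0 C40 (sqr_ge0 _)) rdev_moment.
set E2 := [set w | _] in mE2 PE2; set E3 := [set w | _] in mE3 PE3.
pose E1 := \big[setU/set0]_(l < p) lower_bad l.
have mE1 : measurable E1.
  by apply: bigsetU_measurable => l _; exact: lower_bad_measurable.
have PE1 : P E1 <= (C6 * (b ^+ 2) ^+ 3 / (a * th) ^+ 6 / n%:R ^+ 2)%:E.
  apply: (@le_trans _ _ (\sum_(l < p) P (lower_bad l))).
    exact: (measure_bigsetU_le P (index_enum _) lower_bad_measurable).
  apply: (@le_trans _ _ (\sum_(l < p) (C6 * (b ^+ 2 * n%:R) ^+ 3 / (a * (th * n%:R)) ^+ 6)%:E)).
    by apply: lee_sum => l _; exact: lower_bad_le.
  rewrite sumEFin lee_fin sumr_const card_ord -[(_ *+ p)%R]mulr_natl.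
  have -> : (C6 * (b ^+ 2) ^+ 3 / (a * th) ^+ 6 / n%:R ^+ 2 =
    n%:R * (C6 * (b ^+ 2 * n%:R) ^+ 3 / (a * (th * n%:R)) ^+ 6))%R.
    by field; rewrite !gt_eqF.
  rewrite ler_wpM2r// divr_ge0 ?mulr_ge0 ?exprn_ge0 ?mulr_ge0 ?sqr_ge0 ?(ltW a0) ?(ltW th0) ?(ltW nR0)//.
exists (E1 `|` (E2 `|` E3)).
  split; first by do 2 apply: measurableU => //.
  rewrite (le_trans (measureU2 _ mE1 (measurableU _ _ mE2 mE3)))//.
  rewrite /block_const !mulrDl -addrA EFinD; apply: leeD; first exact: PE1.
  rewrite (le_trans (measureU2 _ mE2 mE3))// EFinD; apply: leeD.
    apply: le_trans PE2 _; rewrite lee_fin le_eqVlt; apply/orP; left; apply/eqP.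
    by field; rewrite !gt_eqF.
  apply: le_trans PE3 _; rewrite lee_fin.
  have -> : (C4 * (p%:R / t' ^+ 2) ^+ 2 / tau ^+ 4 = C4 / tau ^+ 8 / n%:R ^+ 2 * (p%:R / n%:R) ^+ 2)%R.
    by field; rewrite !gt_eqF.
  rewrite ler_piMr//.
    by rewrite !divr_ge0 ?exprn_ge0// ltW.
  by rewrite exprn_ile1 ?divr_ge0 ?(ltW nR0)// ler_pdivrMr// mul1r.
move=> w /not_orP[nE1 /not_orP[nE2 nE3]]; split.
- move=> l; apply: lower_good => bad; apply: nE1.
  by rewrite /E1 (bigD1 l)//=; left.
- move: nE2 => /negP; rewrite -leNgt => /le_trans; apply.
  by rewrite ler_wpM2r// ltW.
- by move: nE3 => /negP; rewrite -leNgt.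
Qed.

End BlockEvents.

(** * Concentration across two blocks *)

Section CrossBlock.
Local Open Scope ereal_scope.
Context (R : realType) (law : probability R R) (C4 : R).
Hypotheses (C40 : (0 <= C4)%R).
Hypothesis H4 : forall d (T : measurableType d) (P : probability T R) (I : finType)
    (X : I -> {RV P >-> R}) (M : I -> I -> R), iid_with_law law X ->
  \int[P]_w ((quadform M (X^~ w) - \sum_i M i i) ^+ 4)%:E <= (C4 * frob2 M ^+ 2)%:E.
Context d (T : measurableType d) (P : probability T R) (I : finType) (X : I -> {RV P >-> R}).
Hypothesis iidX : iid_with_law law X.
Context (n n' p : nat) (idx : 'I_n -> 'I_p -> I) (idx' : 'I_n' -> 'I_p -> I).
Context (g : 'rV[R]_n) (g' : 'rV[R]_n') (b c t eps : R).
Hypothesis idx'_inj : forall i l i' l', idx' i l = idx' i' l' -> i = i' /\ l = l'.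
Hypothesis idx_neq : forall i l i' l', idx i l <> idx' i' l'.
Hypothesis g'b : forall j, (0 <= g' 0 j <= b)%R.
Hypotheses (t0 : (0 < t)%R) (c0 : (0 <= c)%R) (eps0 : (0 < eps)%R) (n'0 : (0 < n')%N).

Local Notation W w := (wmx g (Zm X idx w)).
Local Notation Z' w := (Zm X idx' w).
Local Notation K := ('I_n' * 'I_p)%type.

Let f (k : K) : I := idx' k.1 k.2.
Let J1 : {set I} := [set f k | k : K]%SET.
(** The Kronecker product of the weights with [A]. All rows of the second block enter one quadratic
    form, so their independence is exploited: the squared Frobenius norm is only of order [n']. *)
Let Mx (A : 'M[R]_p) (k k' : K) : R := (if k.1 == k'.1 then g' 0 k.1 * A k.2 k'.2 else 0)%R.

Definition crossdev w : R :=
  (\sum_l g' 0 l * (qf (res (W w) t) (row l (Z' w)) - \tr (res (W w) t)))%R.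

Let sum_pair (F : K -> R) : (\sum_k F k = \sum_l \sum_i F (l, i))%R.
Proof. by rewrite pair_bigA /=; apply: eq_bigr => -[]. Qed.

Let quadformE (A : 'M[R]_p) (x : K -> R) :
  quadform (Mx A) x = (\sum_l g' 0 l * \sum_i \sum_j A i j * x (l, i) * x (l, j))%R.
Proof.
rewrite /quadform sum_pair.
apply: eq_bigr => l _; rewrite mulr_sumr; apply: eq_bigr => i _.
rewrite sum_pair.
rewrite (bigD1 l)//= [X in (_ + X)%R]big1 ?addr0; last first.
  move=> l' l'l; rewrite big1// => j _.
  by rewrite /Mx /= eq_sym (negbTE l'l) !mul0r.
rewrite mulr_sumr; apply: eq_bigr => j _.
by rewrite /Mx /= eqxx !mulrA.
Qed.

Let trE (A : 'M[R]_p) : (\sum_k Mx A k k = \sum_l g' 0 l * \tr A)%R.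
Proof.
rewrite sum_pair.
apply: eq_bigr => l _; rewrite /mxtrace mulr_sumr.
by apply: eq_bigr => i _; rewrite /Mx eqxx.
Qed.

Let frobE (A : 'M[R]_p) : (frob2 (Mx A) = \sum_l g' 0 l ^+ 2 * frob2 A)%R.
Proof.
rewrite /frob2 sum_pair.
apply: eq_bigr => l _; rewrite mulr_sumr; apply: eq_bigr => i _.
rewrite sum_pair.
rewrite (bigD1 l)//= [X in (_ + X)%R]big1 ?addr0; last first.
  move=> l' l'l; rewrite big1// => j _.
  by rewrite /Mx /= eq_sym (negbTE l'l) expr0n.
by rewrite mulr_sumr; apply: eq_bigr => j _; rewrite /Mx /= eqxx exprMn.
Qed.

Let injf : injective f.
Proof. by move=> [l i] [l' i'] /idx'_inj[/= -> ->]. Qed.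

Lemma crossdevE w : crossdev w =
  (quadform (Mx (res (W w) t)) (fun k => X (f k) w) - \sum_k Mx (res (W w) t) k k)%R.
Proof.
rewrite /crossdev quadformE trE -sumrB; apply: eq_bigr => l _.
rewrite mulrBr; congr (_ * _ - _)%R; rewrite qfE.
by apply: eq_bigr => i _; apply: eq_bigr => j _; rewrite !mxE.
Qed.

Let mW : @mmx _ (sigma_of X (~: J1)) _ _ _ (fun w => W w).
Proof.
move=> i l; apply: measurable_wmx_entry; rewrite inE; apply/imsetP => -[k _].
exact: idx_neq.
Qed.

Let mR : @mmx _ (sigma_of X (~: J1)) _ _ _ (fun w => res (W w) t).
Proof. exact: mmx_res. Qed.

(** The trace is bounded only with high probability. This event depends on the first block alone, so
    it can be frozen with the matrix. *)
Let A : set T := [set w | (\tr (res (W w) t) <= c)%R].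

Let mA : measurable (A : set (sigma_of X (~: J1))).
Proof. by apply: measurable_leS; [exact: mmx_trace|exact: measurable_cst]. Qed.

Let mMx k k' : measurable_fun [set: sigma_of X (~: J1)]
  ((fun w => Mx (res (W w) t) k k') : sigma_of X (~: J1) -> R).
Proof.
rewrite /Mx; case: eqP => _; last exact: measurable_cst.
by apply: measurable_funM => //; exact: mR.
Qed.

Lemma measurable_crossdev : measurable_fun setT crossdev.
Proof.
have mT k k' : measurable_fun setT (fun w => Mx (res (W w) t) k k').
  exact: sub_measurable_fun (@mMx k k').
rewrite (funext crossdevE).
by apply: measurable_funB; [exact: measurable_quadform|exact: measurable_sum].
Qed.

Lemma crossdev_moment : \int[P]_w (\1_A w * crossdev w ^+ 4)%:E <=
  (C4 * (n'%:R * (b ^+ 2 * c ^+ 2)) ^+ 2)%:E.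
Proof.
under eq_integral do rewrite crossdevE.
apply: (@decoupled_moment4 R law _ T P I K X f iidX J1 (~: J1)
  (fun w => Mx (res (W w) t))).
- by move=> i iJ; rewrite inE negbK.
- by move=> k; exact: imset_f.
- exact: mMx.
- exact: C40.
- by rewrite mulr_ge0// mulr_ge0 ?sqr_ge0.
- by move=> M'; apply: H4; exact: (iid_with_law_comp iidX injf).
- exact: mA.
- move=> w; rewrite /A /= => trc; rewrite frobE.
  have tr0 := res_tr_ge0 (W w) t0.
  apply: (@le_trans _ _ (\sum_(l < n') b ^+ 2 * c ^+ 2)%R).
    apply: ler_sum => l _; have /andP[gl0 glb] := g'b l.
    apply: ler_pM; rewrite ?sqr_ge0 ?frob2_ge0//.
      by apply: lerXn2r; rewrite ?nnegrE// (le_trans gl0).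
    by rewrite (le_trans (frob2_res_tr _ t0))//; apply: lerXn2r; rewrite ?nnegrE.
  by rewrite sumr_const card_ord mulr_natl.
Qed.

Lemma cross_bad : exists2 E : set T,
  measurable E /\ P E <= (C4 * (b * c) ^+ 4 / eps ^+ 4 / n'%:R ^+ 2)%:E &
  forall w, ~ E w -> (\tr (res (W w) t) <= c)%R -> (`|crossdev w| <= n'%:R * eps)%R.
Proof.
have n'R : (0 < n'%:R :> R)%R by rewrite ltr0n.
have s0 : (0 < n'%:R * eps)%R by rewrite mulr_gt0.
have mAT : measurable A by exact: (g_sigma_algebra_sub (@cyl_measurable _ _ _ _ _ X (~: J1))).
(* A single deviation, as an average of length one. *)
pose D (_ : 'I_1) w := (\1_A w * crossdev w)%R.
have mD l : measurable_fun setT (D l).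
  by apply: measurable_funM; [exact: measurable_indic|exact: measurable_crossdev].
have HD l : \int[P]_w (D l w ^+ 4)%:E <= (C4 * (n'%:R * (b ^+ 2 * c ^+ 2)) ^+ 2)%:E.
  apply: le_trans crossdev_moment; rewrite le_eqVlt; apply/orP; left; apply/eqP.
  apply: eq_integral => w _; rewrite /D exprMn; congr ((_ * _)%:E)%R.
  by rewrite indicE; case: (w \in A); rewrite ?expr1n ?expr0n.
have [mE PE] := avg_markov4 mD s0 (mulr_ge0 C40 (sqr_ge0 _)) HD.
eexists; first (split; [exact: mE|]).
  apply: le_trans PE _; rewrite lee_fin le_eqVlt; apply/orP; left; apply/eqP.
  by field; rewrite !gt_eqF.
move=> w /= /negP; rewrite -leNgt mul1r big_ord1 /D => H trc.
by move: H; rewrite indicE mem_set// mul1r.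
Qed.

End CrossBlock.

(** * Limiting spectral distributions and the eta transform *)

Section DiagonalSpectrum.
Variable R : realType.

(** In both lists a value occurs as often as its multiplicity in the characteristic polynomial; for
    [spectrum] this relies on [rootsR] being free of duplicates. *)
Lemma perm_spectrum_diag n (g : 'rV[R]_n) :
  perm_eq (spectrum (diag_mx g)) [seq g 0 j | j : 'I_n].
Proof.
have cp : char_poly (diag_mx g) = \prod_(y <- [seq g 0 j | j : 'I_n]) ('X - y%:P).
  rewrite char_poly_trig ?diag_mx_is_trig// big_map big_enum /=.
  by apply: eq_bigr => i _; rewrite mxE eqxx.
have cp0 : char_poly (diag_mx g) != 0 by rewrite monic_neq0// char_poly_monic.
have mupE y : mup y (char_poly (diag_mx g)) = count_mem y [seq g 0 j | j : 'I_n].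
  by rewrite cp mu_prod_XsubC.
have us : uniq (rootsR (char_poly (diag_mx g))) by exact: uniq_roots.
have rP y : (y \in rootsR (char_poly (diag_mx g))) = root (char_poly (diag_mx g)) y.
  have := roots_on_rootsR cp0 y; rewrite in_itv /= => <-.
  by [].
apply/allP => y _ /=; apply/eqP; rewrite -mupE /spectrum.
move: (rootsR _) us (rP y) => s us ry.
have -> : count_mem y (flatten [seq nseq (mup x (char_poly (diag_mx g))) x | x <- s]) =
   if y \in s then mup y (char_poly (diag_mx g)) else 0%N.
  elim: s us {ry} => [//|x s IH] /= /andP[xs us].
  rewrite count_cat IH// count_nseq /= in_cons (eq_sym y).
  have [<-|xy] := eqVneq x y; first by rewrite (negbTE xs) mul1n addn0.
  by rewrite mul0n.
rewrite ry; case: ifPn => // nr.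
by rewrite mupNroot.
Qed.

Lemma sum_spectrum_diag n (g : 'rV[R]_n) (h : R -> R) :
  \sum_(x <- spectrum (diag_mx g)) h x = \sum_j h (g 0 j).
Proof.
rewrite (perm_big _ (perm_spectrum_diag g)) /= big_map big_enum //.
Qed.

Lemma Rintegral_esd_diag n (g : 'rV[R]_n) (h : R -> R) :
  measurable_fun setT h -> (forall x, 0 <= h x) ->
  Rintegral (esd (diag_mx g)) setT h = n%:R^-1 * \sum_j h (g 0 j).
Proof.
move=> mh h0; rewrite -sum_spectrum_diag /Rintegral /esd.
have mhE : measurable_fun setT (EFin \o h) by exact/measurable_EFinP.
have hE0 : forall x, setT x -> (0 <= (h x)%:E)%E by move=> x _; rewrite lee_fin.
rewrite ge0_integral_mscale// ge0_integral_measure_sum//.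
have -> : (\sum_(n0 < size (spectrum (diag_mx g)))
    \int[\d_((spectrum (diag_mx g))`_n0)]_x (h x)%:E)%E =
  (\sum_(x <- spectrum (diag_mx g)) h x)%:E.
  rewrite (big_nth 0) big_mkord -sumEFin; apply: eq_bigr => i _.
  by rewrite integral_dirac// diracT mul1e.
by [].
Qed.

End DiagonalSpectrum.

(** * Weak limits of weights confined to an interval *)

Section WeakLimit.
Context (R : realType) (a b : R) (m : nat -> nat) (g : forall N, 'rV[R]_(m N)).
Context (G : probability R R).
Hypotheses (a0 : 0 < a) (ab : a <= b) (gab : forall N j, a <= g N 0 j <= b).
Hypothesis hG : weakly_cvg (fun N => esd (diag_mx (g N))) G.

(** The retraction onto [[a, b]]. Composed with it, the unbounded integrand of the mean and the
    singular one of the eta transform become bounded continuous test functions. *)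
Definition clip (x : R) : R := Num.max a (Num.min b x).

Lemma clip_itv x : a <= clip x <= b.
Proof. by rewrite /clip le_max lexx/= ge_max ab ge_min lexx. Qed.

Lemma clip_id x : a <= x <= b -> clip x = x.
Proof. by move=> /andP[ax xb]; rewrite /clip min_r// max_r. Qed.

Lemma continuous_clip : continuous clip.
Proof.
move=> x; apply: (@continuous_max _ _ (cst a) (fun y => Num.min b y)); first exact: cst_continuous.
by apply: (@continuous_min _ _ (cst b) id); [exact: cst_continuous|].
Qed.

Lemma weak_limit_emp (h : R -> R) : continuous h -> (forall x, 0 <= h x) ->
  (exists M, forall x, h x <= M) ->
  (m N)%:R^-1 * \sum_j h (g N 0 j) @[N --> \oo] --> Rintegral G setT h.
Proof.
move=> ch h0 [M hM].
have mh : measurable_fun setT h by exact: continuous_measurable_fun.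
have E : (fun N => Rintegral (esd (diag_mx (g N))) setT h) =
    (fun N => (m N)%:R^-1 * \sum_j h (g N 0 j)).
  by apply/funext => N; exact: Rintegral_esd_diag.
by rewrite -E; apply: hG => //; exists M => x; rewrite ger0_norm.
Qed.

Let mclip : measurable_fun setT clip.
Proof. exact: continuous_measurable_fun continuous_clip. Qed.

(** The test function [min(1, |x - clip x|)] vanishes on every weight, so its integral under the
    limit is zero. *)
Lemma weak_limit_support : {ae G, forall x, clip x = x}.
Proof.
pose h x := Num.min 1 `|x - clip x|.
have ch : continuous h.
  move=> x; apply: (@continuous_min _ _ (cst 1) (fun y => `|y - clip y|)).
    exact: cst_continuous.
  apply: (@continuous_comp _ _ _ (fun y => y - clip y) Num.norm); last exact: norm_continuous.
  by apply: continuousB => //; exact: continuous_clip.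
have h0 x : 0 <= h x by rewrite le_min normr_ge0 ler01.
have h1 x : h x <= 1 by rewrite ge_min lexx.
have := weak_limit_emp ch h0 (ex_intro _ 1 h1).
have -> : (fun N => (m N)%:R^-1 * \sum_j h (g N 0 j)) = cst 0.
  apply/funext => N; rewrite big1 ?mulr0// => j _.
  by rewrite /h clip_id// subrr normr0 min_r.
move=> /(cvg_unique _ (@cvg_cst _ _ _ _ _))/esym H.
have mh : measurable_fun setT h by exact: continuous_measurable_fun.
have ih : G.-integrable setT (EFin \o h).
  have i1 : G.-integrable setT (EFin \o cst (1 : R)) by exact: finite_measure_integrable_cst.
  apply: (le_integrable measurableT _ _ i1); first exact/measurable_EFinP.
  by move=> x _ /=; rewrite lee_fin ger0_norm// normr1.
have : (\int[G]_x `|(h x)%:E| = 0)%E.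
  under eq_integral do rewrite gee0_abs ?lee_fin//.
  have fi := integrable_fin_num measurableT ih.
  by rewrite -(fineK fi) -[fine _]/(Rintegral G setT h) H.
move=> /ae_eq_integral_abs-/(_ measurableT) [].
  exact/measurable_EFinP.
move=> N [mN N0 sub]; exists N; split=> // x /= nx; apply: sub => /= Hx.
have [] := Hx Logic.I; rewrite /h => /eqP; rewrite eq_le.
case: (leP 1 `|x - clip x|) => [_|_]; first by rewrite ler10.
by rewrite -eq_le normr_eq0 subr_eq0 => /eqP/esym.
Qed.

Lemma Rintegral_clip (h : R -> R) : measurable_fun setT h -> measurable_fun setT (h \o clip) ->
  Rintegral G setT h = Rintegral G setT (h \o clip).
Proof.
move=> mh mhc; congr fine; apply: ae_eq_integral => //.
- exact/measurable_EFinP.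
- exact/measurable_EFinP.
apply: filterS weak_limit_support => x cx _.
by rewrite /= cx.
Qed.

Lemma mean_limit : (m N)%:R^-1 * \sum_j g N 0 j @[N --> \oo] --> mean G.
Proof.
rewrite /mean Rintegral_clip//.
have c0 x : 0 <= clip x by rewrite (le_trans (ltW a0))//; case/andP: (clip_itv x).
have := weak_limit_emp continuous_clip c0 (ex_intro _ b (fun x => proj2 (andP (clip_itv x)))).
have -> : (fun N => (m N)%:R^-1 * \sum_j clip (g N 0 j)) =
    (fun N => (m N)%:R^-1 * \sum_j g N 0 j).
  by apply/funext => N; congr (_ * _); apply: eq_bigr => j _; rewrite clip_id.
by [].
Qed.

Lemma eta_limit x : 0 <= x -> eta_emp (g N) x @[N --> \oo] --> Defs.eta G x.
Proof.
move=> x0; rewrite /Defs.eta.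
have d0 y : 0 < 1 + x * clip y.
  rewrite ltr_pwDl// mulr_ge0// (le_trans (ltW a0))//.
  by case/andP: (clip_itv y).
have ch : continuous (fun y => (1 + x * clip y)^-1).
  move=> y; apply: cvgV; first by rewrite gt_eqF.
  by apply: cvgD; [exact: cvg_cst|apply: cvgM; [exact: cvg_cst|exact: continuous_clip]].
rewrite Rintegral_clip//; last 2 first.
- apply: measurable_invr; apply: measurable_funD => //; exact: measurable_funM.
- exact: (continuous_measurable_fun ch).
have e0 y : 0 <= (1 + x * clip y)^-1 by rewrite invr_ge0 ltW.
have e1 y : (1 + x * clip y)^-1 <= 1.
  rewrite invf_le1// lerDl mulr_ge0// (le_trans (ltW a0))//.
  by case/andP: (clip_itv y).
have := weak_limit_emp ch e0 (ex_intro _ 1 e1).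
have -> : (fun N => (m N)%:R^-1 * \sum_j (1 + x * clip (g N 0 j))^-1) =
    (fun N => eta_emp (g N) x).
  by apply/funext => N; congr (_ * _); apply: eq_bigr => j _; rewrite clip_id.
by [].
Qed.

End WeakLimit.

(** * Monotonicity, decay and Jensen bound for the eta transform *)

Section EtaEmp.
Context (R : realType) (n : nat) (g : 'rV[R]_n) (a b : R).
Hypotheses (a0 : 0 < a) (gab : forall j, a <= g 0 j <= b) (n0 : (0 < n)%N).

Let g0 j : 0 < g 0 j. Proof. by apply: lt_le_trans a0 _; case/andP: (gab j). Qed.
Let nR0 : 0 < n%:R :> R. Proof. by rewrite ltr0n. Qed.
Let d0 x j : 0 <= x -> 0 < 1 + x * g 0 j.
Proof. by move=> x0; rewrite ltr_wpDr// mulr_ge0// ltW. Qed.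

(** An explicit slope is given because strict inequalities do not survive a limit, whereas a uniform
    slope does. It yields injectivity of the limit and stability of its inverse. *)
Lemma eta_emp_decr c x y : 0 <= x -> x <= y -> y <= c ->
  a / (1 + b * c) ^+ 2 * (y - x) <= eta_emp g x - eta_emp g y.
Proof.
move=> x0 xy yc; rewrite /eta_emp -mulrBr -sumrB ler_pdivlMl//.
have y0 := le_trans x0 xy; have c0 := le_trans y0 yc.
have -> : n%:R * (a / (1 + b * c) ^+ 2 * (y - x)) =
    \sum_(j < n) a / (1 + b * c) ^+ 2 * (y - x).
  by rewrite sumr_const card_ord mulr_natl.
apply: ler_sum => j _.
have dx := d0 j x0; have dy := d0 j y0.
have -> : (1 + x * g 0 j)^-1 - (1 + y * g 0 j)^-1 =
    g 0 j / ((1 + x * g 0 j) * (1 + y * g 0 j)) * (y - x).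
  by field; rewrite !gt_eqF.
have /andP[ga gb] := gab j.
have bc z : 0 <= z -> z <= c -> 1 + z * g 0 j <= 1 + b * c.
  by move=> z0 zc; rewrite lerD2l mulrC ler_pM// ltW.
apply: ler_wpM2r; first by rewrite subr_ge0.
apply: ler_pM => //; first exact: ltW.
  by rewrite invr_ge0 exprn_ge0// (le_trans (ltW dx))// bc// (le_trans xy).
have p1 : 0 < (1 + b * c) ^+ 2 by rewrite exprn_gt0// (lt_le_trans dx)// bc// (le_trans xy).
have p2 := mulr_gt0 dx dy; rewrite lef_pV2 ?posrE//.
by rewrite expr2; apply: ler_pM; rewrite ?(ltW dx) ?(ltW dy)// bc// (le_trans xy).
Qed.

Lemma eta_emp_le x : 0 <= x -> eta_emp g x <= (1 + x * a)^-1.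
Proof.
move=> x0; rewrite /eta_emp ler_pdivrMl//.
have -> : n%:R * (1 + x * a)^-1 = \sum_(j < n) (1 + x * a)^-1.
  by rewrite sumr_const card_ord mulr_natl.
apply: ler_sum => j _; rewrite lef_pV2 ?posrE ?d0//.
  by rewrite lerD2l ler_wpM2l//; case/andP: (gab j).
by rewrite ltr_wpDr// mulr_ge0// ltW.
Qed.

Lemma eta_emp_jensen x : 0 <= x ->
  1 <= eta_emp g x * (1 + x * (n%:R^-1 * \sum_j g 0 j)).
Proof.
move=> x0; set v := 1 + _.
have m0 : 0 <= n%:R^-1 * \sum_j g 0 j.
  by rewrite mulr_ge0 ?invr_ge0// sumr_ge0// => j _; exact: ltW.
have v0 : 0 < v by rewrite ltr_wpDr// mulr_ge0.
rewrite -ler_pdivrMr// mul1r /eta_emp ler_pdivlMl//.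
(* Jensen by the tangent to [1/d] at the mean value [v]: the gap is [d^-1 (d / v - 1)^2]. *)
apply: (@le_trans _ _ (\sum_j (2 / v - (1 + x * g 0 j) / v ^+ 2))).
  rewrite sumrB sumr_const card_ord -mulr_suml big_split /= sumr_const card_ord -mulr_sumr.
  rewrite -[(2 / v) *+ n]mulr_natl.
  have -> : x * \sum_j g 0 j = n%:R * (v - 1).
    rewrite /v; field; by rewrite gt_eqF.
  rewrite le_eqVlt; apply/orP; left; apply/eqP; field; by rewrite gt_eqF.
apply: ler_sum => j _; have dx := d0 j x0; rewrite -subr_ge0.
have -> : (1 + x * g 0 j)^-1 - (2 / v - (1 + x * g 0 j) / v ^+ 2) =
  (1 + x * g 0 j)^-1 * ((1 + x * g 0 j) / v - 1) ^+ 2.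
  by field; rewrite !gt_eqF.
by rewrite mulr_ge0 ?sqr_ge0// invr_ge0 ltW.
Qed.

End EtaEmp.

(** * Inversion of the limiting eta transform *)

Section EtaInverse.
Context (R : realType) (a b : R) (m : nat -> nat) (g : forall N, 'rV[R]_(m N)).
Context (G : probability R R) (gam : R).
Hypotheses (a0 : 0 < a) (ab : a <= b) (gab : forall N j, a <= g N 0 j <= b).
Hypothesis hG : weakly_cvg (fun N => esd (diag_mx (g N))) G.
Hypothesis m0 : \forall N \near \oo, (0 < m N)%N.
Hypothesis hgam : 0 < gam < 1.

Let b0 : 0 <= b := le_trans (ltW a0) ab.
Let etac x : 0 <= x -> eta_emp (g N) x @[N --> \oo] --> Defs.eta G x.
Proof. exact: (eta_limit a0 ab gab hG). Qed.

Lemma eta_decr c x y : 0 <= x -> x <= y -> y <= c ->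
  a / (1 + b * c) ^+ 2 * (y - x) <= Defs.eta G x - Defs.eta G y.
Proof.
move=> x0 xy yc; have y0 := le_trans x0 xy.
apply: (ler_cvg_to (cvg_cst _) (cvgB (etac x0) (etac y0))).
by near=> N; apply: eta_emp_decr => //; near: N.
Unshelve. all: by end_near. Qed.

Lemma eta_lip x y : 0 <= x -> 0 <= y -> `|Defs.eta G x - Defs.eta G y| <= b * `|x - y|.
Proof.
move=> x0 y0.
have h : `|eta_emp (g N) x - eta_emp (g N) y| @[N --> \oo] -->
    `|Defs.eta G x - Defs.eta G y|.
  by apply: cvg_norm; exact: cvgB (etac x0) (etac y0).
have hc : (cst (b * `|x - y|) : nat -> R) N @[N --> \oo] --> b * `|x - y| by exact: cvg_cst.
apply: (ler_cvg_to h hc).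
by near=> N; apply: (eta_emp_lip a0) => //; near: N.
Unshelve. all: by end_near. Qed.

Lemma eta_le x : 0 <= x -> Defs.eta G x <= (1 + x * a)^-1.
Proof.
move=> x0; apply: (ler_cvg_to (etac x0) (cvg_cst _)).
by near=> N; apply: eta_emp_le => //; near: N.
Unshelve. all: by end_near. Qed.

Lemma eta_jensen x : 0 <= x -> 1 <= Defs.eta G x * (1 + x * mean G).
Proof.
move=> x0.
have h : eta_emp (g N) x * (1 + x * ((m N)%:R^-1 * \sum_j g N 0 j)) @[N --> \oo] -->
    Defs.eta G x * (1 + x * mean G).
  apply: cvgM; first exact: etac.
  apply: cvgD; first exact: cvg_cst.
  by apply: cvgM; [exact: cvg_cst|exact: (mean_limit a0 ab gab hG)].
have hc : (cst 1 : nat -> R) N @[N --> \oo] --> (1 : R) by exact: cvg_cst.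
apply: (ler_cvg_to hc h).
by near=> N; apply: (eta_emp_jensen a0) => //; near: N.
Unshelve. all: by end_near. Qed.

Let eta0 : Defs.eta G 0 = 1.
Proof.
rewrite /Defs.eta; under eq_Rintegral do rewrite mul0r addr0 invr1.
by rewrite /Rintegral integral_cst_prob.
Qed.

Let eta_strict x y : 0 <= x -> x < y -> Defs.eta G y < Defs.eta G x.
Proof.
move=> x0 xy; rewrite -subr_gt0.
have y0 := le_trans x0 (ltW xy).
apply: lt_le_trans (eta_decr x0 (ltW xy) (lexx y)).
by rewrite mulr_gt0 ?subr_gt0// divr_gt0// exprn_gt0// ltr_wpDr// mulr_ge0.
Qed.

Lemma f_etaE : exists2 f, 0 <= f /\ Defs.eta G f = 1 - gam & f_eta gam G = f.
Proof.
have /andP[gam0 gam1] := hgam.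
(* Chosen so that the upper bound [(1 + c * a)^-1] equals [1 - gam]; the preimage then lies in
   [[0, c]]. *)
pose c := (gam / (1 - gam)) / a.
have g10 : 0 < 1 - gam by rewrite subr_gt0.
have c0 : 0 <= c by rewrite !divr_ge0// ltW.
have etac_le : Defs.eta G c <= 1 - gam.
  rewrite (le_trans (eta_le c0))// /c divfK ?gt_eqF//.
  have -> : 1 + gam / (1 - gam) = (1 - gam)^-1 by field; rewrite gt_eqF.
  by rewrite invrK.
(* Continuity of the transform is established on the half line only; this extension is continuous
   everywhere, as the intermediate value theorem is applied to it. *)
pose h x := Defs.eta G (Num.max 0 x).
have ch : continuous h.
  move=> x; apply/cvgrPdist_le => e e0.
  have b1 : 0 < b + 1 by rewrite ltr_wpDl.
  have eb : 0 < e / (b + 1) by rewrite divr_gt0.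
  have xx : y @[y --> x] --> (x : R) by exact: cvg_id.
  move/cvgrPdist_le : xx => /(_ _ eb); apply: filterS => y xy; rewrite /h (le_trans (eta_lip _ _))//.
  - by rewrite le_max lexx.
  - by rewrite le_max lexx.
  have : `|Num.max 0 x - Num.max 0 y| <= `|x - y|.
    have [hx|hx] := leP 0 x; have [hy|hy] := leP 0 y.
    - by [].
    - rewrite subr0 (ger0_norm hx) ger0_norm; lra.
    - rewrite sub0r normrN (ger0_norm hy) distrC ger0_norm; lra.
    - by rewrite subrr normr0.
  move=> hxy; rewrite (le_trans (ler_wpM2l b0 (le_trans hxy xy)))//.
  by rewrite mulrA ler_pdivrMr// mulrC; apply: ler_wpM2l; [exact: ltW|rewrite lerDl].
have := @IVT R h 0 c (1 - gam) c0 (continuous_subspaceT ch).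
have -> : h 0 = 1 by rewrite /h max_l.
have -> : h c = Defs.eta G c by rewrite /h max_r.
case.
  rewrite ge_min le_max etac_le orbT/=; apply/orP; left; lra.
move=> f /[!in_itv]/= /andP[f0 fc] hf.
have ef : Defs.eta G f = 1 - gam by rewrite -hf /h max_r.
exists f => //; rewrite /f_eta /eta_inv -ef.
apply: pinvKV; last by rewrite inE /= in_itv /= f0.
move=> x y; rewrite !inE /= !in_itv /= !andbT => x0 y0 exy.
have [xy|yx|//] := ltgtP x y.
  by have := eta_strict x0 xy; rewrite exy ltxx.
by have := eta_strict y0 yx; rewrite exy ltxx.
Qed.

Lemma f_eta_gt : gam / (1 - gam) <= f_eta gam G * mean G.
Proof.
have /andP[gam0 gam1] := hgam.
have [f [f0 ef] ->] := f_etaE.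
have := eta_jensen f0; rewrite ef ler_pdivrMr ?subr_gt0//; lra.
Qed.

(** The transforms need to converge only at the single point [f]. The slope bound of [eta_emp],
    uniform in [N] on an interval containing [f] and all [x N], turns closeness of values into
    closeness of arguments. *)
Lemma f_eta_cvg (p : nat -> nat) (x : nat -> R) (c : R) :
  (p N)%:R / (m N)%:R @[N --> \oo] --> gam ->
  (\forall N \near \oo, 0 <= x N <= c) ->
  eta_emp (g N) (x N) - (1 - (p N)%:R / (m N)%:R) @[N --> \oo] --> 0 ->
  x N @[N --> \oo] --> f_eta gam G.
Proof.
move=> hp hx hd.
have [f [f0 ef] ->] := f_etaE.
pose C := Num.max c f.
have C0 : 0 <= C by rewrite le_max f0 orbT.
pose k := a / (1 + b * C) ^+ 2.
have k0 : 0 < k by rewrite divr_gt0// exprn_gt0// ltr_wpDr// mulr_ge0.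
have he : eta_emp (g N) (x N) - eta_emp (g N) f @[N --> \oo] --> 0.
  have -> : (fun N => eta_emp (g N) (x N) - eta_emp (g N) f) =
     (fun N => (eta_emp (g N) (x N) - (1 - (p N)%:R / (m N)%:R)) +
               ((1 - (p N)%:R / (m N)%:R) - eta_emp (g N) f)).
    by apply/funext => N; ring.
  rewrite (_ : nbhs 0 = nbhs ((0 : R) + ((1 - gam) - Defs.eta G f))); last first.
    by rewrite ef subrr addr0.
  apply: cvgD => //; apply: cvgB; last exact: etac.
  by apply: cvgB => //; exact: cvg_cst.
apply/cvgrPdist_le => e e0.
have ke : 0 < k * e by rewrite mulr_gt0.
move/cvgrPdist_le : he => /(_ _ ke) he.
near=> N.
have /andP[x0 xc] : 0 <= x N <= c by near: N.
have mN : (0 < m N)%N by near: N.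
have : `|0 - (eta_emp (g N) (x N) - eta_emp (g N) f)| <= k * e by near: N.
rewrite sub0r normrN => H.
rewrite -(ler_pM2l k0) (le_trans _ H)//.
have xC : x N <= C by rewrite le_max xc.
have fC : f <= C by rewrite le_max lexx orbT.
have [xf|/ltW fx] := leP (x N) f.
  rewrite ger0_norm ?subr_ge0// (le_trans _ (ler_norm _))//.
  exact: (eta_emp_decr a0 (@gab N) mN x0 xf fC).
rewrite distrC ger0_norm ?subr_ge0// distrC (le_trans _ (ler_norm _))//.
exact: (eta_emp_decr a0 (@gab N) mN f0 fx xC).
Unshelve. all: by end_near. Qed.

End EtaInverse.

(** * Traces of the elliptical model *)

Section PosdefSqrt.
Context (R : realType).

Lemma poly_interpolation (s : seq R) (f : R -> R) :
  exists q : {poly R}, forall x, x \in s -> q.[x] = f x.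
Proof.
elim: s => [|x s [q hq]]; first by exists 0.
have [xs|xs] := boolP (x \in s).
  by exists q => y; rewrite in_cons => /orP[/eqP->|]; exact: hq.
pose r : {poly R} := \prod_(y <- s) ('X - y%:P).
have rx : r.[x] != 0 by rewrite -/(root r x) root_prod_XsubC.
exists (q + (f x - q.[x]) / r.[x] *: r) => y.
rewrite in_cons hornerD hornerZ => /orP[/eqP->|ys].
  by rewrite divfK// addrC subrK.
have /rootP -> : root r y by rewrite root_prod_XsubC.
by rewrite mulr0 addr0 hq.
Qed.

(** The spectral theorem is applied to the complexification. Only the eigenvalues are brought back
    to the reals; [V] may stay complex, since the square root will be a real polynomial in [A]. *)
Lemma posdef_diagonalizable n (A : 'M[R]_n) : posdef A ->
  exists V : 'M[R[i]]_n, exists2 e : 'rV[R]_n, V \in unitmx /\ (forall j, 0 < e 0 j) &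
    map_mx (real_complex R) A = invmx V *m diag_mx (map_mx (real_complex R) e) *m V.
Proof.
move=> [As Apos]; set rc := real_complex R; set A' := map_mx rc A.
have hA : A' \is hermsymmx.
  apply: realsym_hermsym.
    apply/is_hermitianmxP; rewrite expr0 scale1r map_mx_id// /A' map_trmx As.
    by [].
  by apply/mxOverP => i j; rewrite mxE complex_real.
have /orthomx_spectralP := hermitian_normalmx hA.
have := hermitian_spectral_diag_real hA.
have := spectral_unit A'.
move: (spectralmx A') (spectral_diag A') => V D Vu Dr AE.
pose e : 'rV[R]_n := map_mx (@complex.Re R) D.
have De : D = map_mx rc e.
  apply/rowP => j; rewrite !mxE.
  by have /mxOverP/(_ 0 j)/complex_realP[x ->] := Dr.
exists V; exists e; last by rewrite -De.
split=> // j.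
have : eigenvalue A' (rc (e 0 j)).
  apply/eigenvalueP; exists (row j V).
    rewrite -row_mul AE -mulmxA mulKVmx// De row_mul row_diag_mx.
    by rewrite -scalemxAl -rowE mxE.
  apply/eqP => V0.
  have : row j (V *m invmx V) = 0 by rewrite row_mul V0 mul0mx.
  rewrite mulmxV// => /rowP/(_ j); rewrite !mxE eqxx => /eqP.
  by rewrite oner_eq0.
(* The characteristic polynomial has real coefficients, so a real eigenvalue also has a real
   eigenvector, to which positive definiteness applies. *)
rewrite eigenvalue_root_char -map_char_poly fmorph_root -eigenvalue_root_char.
move=> /eigenvalueP[v vA v0].
have := Apos v v0; rewrite vA -scalemxAl mxE.
rewrite pmulr_lgt0// lt_neqAle; apply/andP; split; last first.
  by rewrite mxE sumr_ge0// => l _; rewrite mxE -expr2 sqr_ge0.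
apply: contraNneq v0 => /esym; rewrite mxE => v0.
apply/eqP/rowP => l; rewrite mxE.
have /eqP := v0; rewrite psumr_eq0; last by move=> i _; rewrite mxE -expr2 sqr_ge0.
by move=> /allP/(_ l); rewrite mem_index_enum mxE -expr2 sqrf_eq0 => /(_ isT)/eqP.
Qed.

Lemma posdef_has_sqrt n (A : 'M[R]_n) : posdef A ->
  exists S : 'M[R]_n, possemidef S /\ S *m S = A.
Proof.
(* Evaluating polynomials at a matrix requires a nonempty matrix ring. *)
case: n A => [|n] A hA.
  exists A; split; last by rewrite [LHS]flatmx0 [RHS]flatmx0.
  by case: hA => As _; split=> // v; rewrite mxE big_ord0.
have [V [e [Vu e0] AE]] := posdef_diagonalizable hA.
have As : A^T = A by case: hA.
(* [q] takes fourth roots of the eigenvalues: the square root [q(A)^2] is then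
   positive semidefinite because [q(A)] is symmetric. *)
have [q hq] := poly_interpolation [seq e 0 j | j <- enum 'I_n.+1] (fun x => Num.sqrt (Num.sqrt x)).
pose B := horner_mx A q.
have Bs : B^T = B.
  rewrite /B; elim/poly_ind: q {hq B} => [|q x IH]; first by rewrite rmorph0 trmx0.
  rewrite rmorphD rmorphM /= horner_mx_X horner_mx_C linearD /= tr_scalar_mx.
  congr (_ + _); rewrite -[_ * _]/(_ *m _) trmx_mul As IH.
  by apply: comm_mx_horner.
exists (B *m B); split; first split.
- by rewrite trmx_mul Bs.
- move=> v; have -> : v *m (B *m B) *m v^T = (v *m B) *m (v *m B)^T.
    by rewrite trmx_mul Bs !mulmxA.
  by rewrite mxE sumr_ge0// => l _; rewrite [X in _ * X]mxE -expr2 sqr_ge0.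
suff : horner_mx A (q ^+ 4) = A.
  by move=> E; rewrite -[RHS]E rmorphXn /= -/B -!mulmxA !exprS expr0 mulr1.
apply: (@map_mx_inj _ _ (real_complex R)); rewrite map_horner_mx AE.
have Vi : invmx V \is a GRing.unit by rewrite unitmx_inv.
rewrite -{2}[V]invmxK horner_mx_uconj// invmxK horner_mx_diag.
congr (_ *m diag_mx _ *m _); apply/rowP => j; rewrite !mxE.
rewrite horner_map; congr (real_complex R _).
rewrite horner_exp hq; last by apply: map_f; rewrite mem_enum.
by rewrite (exprM _ 2 2) !sqr_sqrtr ?sqrtr_ge0 ?ltW.
Qed.

End PosdefSqrt.

(** * Cancellation of the population covariance *)

Section TraceAlgebra.
Context (R : realType).

Lemma sqrtmx_posdef n (A : 'M[R]_n) : posdef A ->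
  [/\ (sqrtmx A)^T = sqrtmx A, sqrtmx A \in unitmx & sqrtmx A *m sqrtmx A = A].
Proof.
move=> hA; have [S [hS SS]] := posdef_has_sqrt hA.
have [[sT _] ss] : [set S : 'M[R]_n | possemidef S /\ S *m S = A] (sqrtmx A).
  by rewrite /sqrtmx; apply: (@xgetI _ _ _ S).
split=> //; have [_ Apos] := hA.
have : A \in unitmx.
  rewrite -row_free_unit -kermx_eq0; apply/eqP/row_matrixP => i; rewrite row0.
  apply/eqP; apply: contraT => /Apos.
  by rewrite -row_mul mulmx_ker row0 mul0mx mxE ltxx.
by rewrite -{1}ss unitmx_mul => /andP[].
Qed.

(** Applied with [A] the square root of [Sigma]: the congruence becomes a similarity, which the
    trace ignores. *)
Lemma mxtrace_congr_inv n (A S S' : 'M[R]_n) : A \in unitmx -> S \in unitmx ->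
  \tr (invmx (A *m S *m A) *m (A *m S' *m A)) = \tr (invmx S *m S').
Proof.
move=> uA uS.
have -> : invmx (A *m S *m A) = invmx A *m (invmx S *m invmx A).
  have u : A *m S *m A \in unitmx by rewrite !unitmx_mul uA uS.
  rewrite -[RHS](mulmxK u).
  have -> : invmx A *m (invmx S *m invmx A) *m (A *m S *m A) = 1%:M.
    rewrite -!mulmxA mulKmx// (mulmxA (invmx S)) mulVmx// mul1mx.
    by rewrite mulVmx.
  by rewrite mul1mx.
rewrite -!mulmxA mxtrace_mulC -!mulmxA mulmxV// mulmx1.
by rewrite mulKmx.
Qed.

Context (k : nat) (nn : 'I_k -> nat) (p : nat).

Definition blockmx (g : 'rV[R]_(\sum_(i < k) nn i)) (Z : 'M[R]_(\sum_(i < k) nn i, p)) i :=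
  wmx (submxrow g i) (submxcol Z i).

Lemma submxcol_elliptical g Z (Sigma : 'M[R]_p) i :
  submxcol (elliptical_data g Z Sigma) i = blockmx g Z i *m sqrtmx Sigma.
Proof.
rewrite /elliptical_data -submxcol_mul; congr (_ *m _).
by apply/matrixP => j l; rewrite /blockmx wmxE [LHS]mxE mul_diag_mx !mxE.
Qed.

Lemma tr_elliptical g Z (Sigma : 'M[R]_p) i : posdef Sigma ->
    gram (blockmx g Z i) \in unitmx ->
  let X := elliptical_data g Z Sigma in
  \tr (invmx ((submxcol X i)^T *m submxcol X i) *m
       ((\mxcol_(j < k) submxcol X j)^T *m \mxcol_(j < k) submxcol X j)) =
  \sum_(j < k) \tr (invmx (gram (blockmx g Z i)) *m gram (blockmx g Z j)).
Proof.
move=> hS ui X; have [As Au _] := sqrtmx_posdef hS.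
have E j : (submxcol X j)^T *m submxcol X j =
    sqrtmx Sigma *m gram (blockmx g Z j) *m sqrtmx Sigma.
  by rewrite submxcol_elliptical trmx_mul As /gram !mulmxA.
rewrite tr_mxcol mul_mxrow_mxcol mulmx_sumr raddf_sum /=; apply: eq_bigr => j _.
by rewrite !E mxtrace_congr_inv.
Qed.

Lemma tr_gram_other (g : 'rV[R]_(\sum_(i < k) nn i)) Z (a : R) i j : 0 < a -> (forall l, a <= g 0 l) ->
  \tr (invmx (gram (blockmx g Z i)) *m gram (blockmx g Z j)) =
  \sum_l submxrow g j 0 l *
    qf (invmx (gram (blockmx g Z i))) (row l (submxcol Z j)).
Proof.
move=> a0 ag; rewrite mxtrace_mulC -sum_qf_row; apply: eq_bigr => l _.
rewrite /blockmx row_wmx qf_scale sqr_sqrtr// mxE ltW//.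
exact: lt_le_trans (ag _).
Qed.

End TraceAlgebra.

(** * Almost sure limits *)

Section BorelCantelli.
Context d (T : measurableType d) (R : realType) (P : probability T R).

Lemma sum_inv_sqr_le (n : nat) : \sum_(0 <= i < n) (i.+1%:R ^+ 2)^-1 <= (2 : R).
Proof.
(* The sharper bound makes the induction close. *)
suff : \sum_(0 <= i < n.+1) (i.+1%:R ^+ 2)^-1 <= 2 - n.+1%:R^-1 :> R.
  rewrite big_nat_recr//= => H; apply: le_trans (le_trans _ H) _.
    by rewrite lerDl invr_ge0 exprn_ge0.
  by rewrite lerBlDr lerDl invr_ge0.
elim: n => [|n IH]; first by rewrite big_nat1 expr1n invr1; lra.
rewrite big_nat_recr//= (le_trans (lerD IH (lexx _)))//.
have h : 0 < n.+1%:R :> R by [].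
rewrite -subr_ge0 -(natr1 n.+1); move: (n.+1%:R : R) h => x x0.
have -> : 2 - (x + 1)^-1 - (2 - x^-1 + ((x + 1) ^+ 2)^-1) = (x * (x + 1) ^+ 2)^-1.
  by field; rewrite !gt_eqF// ltr_wpDr.
by rewrite invr_ge0 mulr_ge0 ?exprn_ge0// ?addr_ge0// ltW.
Qed.

(** The comparison [N <= C * n N] makes a rate [n^-2] summable in the index. Sample points where [Q]
    fails infinitely often lie in the limsup of the covering events, so no measurability of [Q] is
    asked. *)
Lemma ae_eventually (Q : nat -> T -> Prop) (n : nat -> nat) (K : R) (C : nat) :
  (\forall N \near \oo, (N <= C * n N)%N) -> 0 <= K ->
  (\forall N \near \oo, exists2 E : set T,
     measurable E /\ (P E <= (K / (n N)%:R ^+ 2)%:E)%E & forall w, ~ E w -> Q N w) ->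
  {ae P, forall w, \forall N \near \oo, Q N w}.
Proof.
move=> hn K0 hE.
pose good N E := [/\ measurable E, (P E <= (K / (n N)%:R ^+ 2)%:E)%E & forall w, ~ E w -> Q N w].
pose F N := if pselect (exists E, good N E) is left h then projT1 (cid h) else set0.
have FP N : measurable (F N) /\ ((exists E, good N E) -> good N (F N)).
  rewrite /F; case: pselect => [h|//]; case: cid => E /= HE.
  by split=> //; case: HE.
have hgood : \forall N \near \oo, good N (F N).
  near=> N; apply: (FP N).2.
  have [E [mE PE] HE] : exists2 E : set T,
     measurable E /\ (P E <= (K / (n N)%:R ^+ 2)%:E)%E & forall w, ~ E w -> Q N w by near: N.
  by exists E.
have [N0 _ HN0] : \forall N \near \oo, good N (F N) /\ (N <= C * n N)%N.
  by near=> N; split; near: N.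
(* Up to [N0] the trivial bound 1 is used; beyond, [N + 1 <= 2 * C * n N]. *)
pose D := Num.max (N0.+1%:R ^+ 2) (K * (2 * C%:R) ^+ 2) : R.
have D0 : 0 <= D by rewrite le_max exprn_ge0.
have PF N : (P (F N) <= (D * (N.+1%:R ^+ 2)^-1)%:E)%E.
  have N1 : 0 < N.+1%:R ^+ 2 :> R by rewrite exprn_gt0.
  have [NN|NN] := leqP N N0.
    apply: (le_trans (probability_le1 P (FP N).1)).
    rewrite lee_fin ler_pdivlMr// mul1r le_max lerXn2r ?nnegrE// ler_nat//.
  have [[_ H _] HC] := HN0 N (ltnW NN).
  rewrite (le_trans H)// lee_fin.
  have nN : (0 < n N)%N.
    by rewrite lt0n; apply: contraTneq HC => ->; rewrite muln0 -ltnNge (leq_ltn_trans _ NN).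
  have nN' : 0 < (n N)%:R :> R by rewrite ltr0n.
  rewrite ler_pdivlMr// mulrAC ler_pdivrMr ?exprn_gt0//.
  apply: (@le_trans _ _ (K * (2 * C%:R) ^+ 2 * (n N)%:R ^+ 2)).
    rewrite -mulrA -exprMn ler_wpM2l// lerXn2r ?nnegrE ?mulr_ge0//.
    rewrite -!natrM ler_nat -mulnA mul2n -addnn -addn1 leq_add//.
    by rewrite (leq_trans _ HC)// (leq_ltn_trans _ NN).
  by rewrite ler_wpM2r ?exprn_ge0// le_max lexx orbT.
have mF N : measurable (F N) by exact: (FP N).1.
have sF : (\sum_(0 <= N <oo) P (F N) < +oo)%E.
  apply: (@le_lt_trans _ _ (D * 2)%:E); last exact: ltry.
  apply: lime_le; first by apply: is_cvg_nneseries => *; exact: measure_ge0.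
  apply: nearW => m; rewrite (le_trans (lee_sum _ (fun i _ => PF i)))// sumEFin lee_fin.
  by rewrite -mulr_sumr ler_wpM2l// sum_inv_sqr_le.
have L0 := lim_sup_set_cvg0 mF sF.
exists (lim_sup_set F); split => //.
  by apply: bigcapT_measurable => m; apply: bigcup_measurable.
move=> w /= nQ m _; apply: contrapT => nF; apply: nQ.
near=> N.
have [_ _ H] : good N (F N) by near: N.
apply: H => FN; apply: nF; exists N => //=.
by near: N; exact: nbhs_infty_ge.
Unshelve. all: by end_near. Qed.

End BorelCantelli.

(** * Convergence at a fixed sample point *)

Section BlockLimits.
Context (R : realType).

(** The level [tau] will run through [1 / (m + 1)], so that countably many almost sure statements
    suffice. *)
Definition good_block n p (g : 'rV[R]_n) (Z : 'M[R]_(n, p)) (dl tau : R) : Prop :=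
  [/\ forall l, dl * n%:R <= schur (wmx g Z) l (n%:R^-1 : R),
      \sum_l `|coldev g Z tau l| <= n%:R * (tau * n%:R) &
      \sum_j `|rowdev g Z tau j| <= n%:R * tau].

(** The trace bound is a premise because concentration is known only where it holds; [tr_res_le]
    supplies it on good blocks. *)
Definition good_cross n n' p (W : 'M[R]_(n, p)) (g' : 'rV[R]_n') (Z' : 'M[R]_(n', p))
    (c e : R) : Prop :=
  let A := res W (n%:R^-1 : R) in
  \tr A <= c -> `|\sum_l g' 0 l * (qf A (row l Z') - \tr A)| <= n'%:R * e.

(** Here [A] and [x] come from the true inverse, [q] and [r] from the resolvent at level [1/n], and
    [s] is the relative cost of the shift between them. *)
Lemma sandwich_dist (A q r x m e s b c : R) : 0 <= r <= c -> 0 <= m <= b -> 0 <= s <= 1 ->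
  0 <= e -> `|q - r * m| <= e -> q <= A <= (1 + s) * q -> r <= x <= (1 + s) * r ->
  `|A - x * m| <= 2 * e + s * (c * b).
Proof.
move=> /andP[r0 rc] /andP[m0 mb] /andP[s0 s1] e0 /ler_normlP[q1 q2] /andP[A1 A2] /andP[x1 x2].
have h1 : s * (r * m) <= s * (c * b) by rewrite ler_wpM2l// ler_pM.
have h2 : s * (q - r * m) <= e by rewrite (le_trans (ler_wpM2l s0 q2))// ler_piMl.
have h3 : r * m <= x * m by rewrite ler_wpM2r.
have h4 : x * m <= r * m + s * (r * m).
  have -> : r * m + s * (r * m) = (1 + s) * r * m by ring.
  by rewrite ler_wpM2r.
rewrite mulrBr in h2; rewrite mulrDl mul1r in A2.
by rewrite ler_norml; apply/andP; split; lra.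
Qed.

Lemma near_inv_le (u : nat -> nat) (e : R) : u N @[N --> \oo] --> \oo -> 0 < e ->
  \forall N \near \oo, (0 < u N)%N /\ (u N)%:R^-1 <= e.
Proof.
move=> hu e0.
have h0 : \forall N \near \oo, e^-1 <= (u N)%:R by exact: (hu _ (nbhs_infty_ger e^-1)).
have h1 : \forall N \near \oo, (0 < u N)%N by exact: (hu _ (nbhs_infty_gt 0%N)).
near=> N; have un : (0 < u N)%N by near: N.
split => //; rewrite -[e]invrK lef_pV2 ?posrE ?invr_gt0 ?ltr0n//.
by near: N.
Unshelve. all: by end_near. Qed.

Lemma cvg_sub0_add (u v : nat -> R) (l : R) : u N - v N @[N --> \oo] --> 0 ->
  v N @[N --> \oo] --> l -> u N @[N --> \oo] --> l.
Proof.
move=> huv hv.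
have -> : u = (fun N => u N - v N + v N) by apply/funext => N; rewrite subrK.
by rewrite -[l]add0r; exact: cvgD.
Qed.

Lemma exists_natSinv_le (e : R) : 0 < e -> exists m : nat, m.+1%:R^-1 <= e.
Proof.
move=> e0; have [m _ H] := near_infty_natSinv_lt (PosNum e0).
by exists m; exact: ltW (H m (leqnn m)).
Qed.

Context (k : nat) (nn : nat -> 'I_k -> nat) (p : nat -> nat).
Context (g : forall N, 'rV[R]_(\sum_(i < k) nn N i)).
Context (Z : forall N, 'M[R]_(\sum_(i < k) nn N i, p N)).
Context (a b : R) (gamma_ : 'I_k -> R) (gamma : R).
Context (G : probability R R) (G_ : 'I_k -> probability R R) (dl : 'I_k -> R).
Hypotheses (a0 : 0 < a) (gab : forall N j, a <= g N 0 j <= b).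
Hypotheses (hgamma_ : forall i, 0 < gamma_ i < 1).
Hypothesis hgamma : gamma^-1 = \sum_(i < k) (gamma_ i)^-1.
Hypothesis hn : forall i, nn N i @[N --> \oo] --> \oo.
Hypothesis hp : p N @[N --> \oo] --> \oo.
Hypothesis hratio : forall i, (p N)%:R / (nn N i)%:R @[N --> \oo] --> gamma_ i.
Hypothesis hG : weakly_cvg (fun N => esd (diag_mx (g N))) G.
Hypothesis hG_ : forall i, weakly_cvg (fun N => esd (diag_mx (submxrow (g N) i))) (G_ i).
Hypothesis dl0 : forall i, 0 < dl i.

Local Notation gi N i := (submxrow (g N) i).
Local Notation Zi N i := (submxcol (Z N) i).
Local Notation W N i := (blockmx (g N) (Z N) i).
Local Notation t N i := ((nn N i)%:R^-1 : R).

Hypothesis hgood : forall i (m : nat), \forall N \near \oo,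
  good_block (gi N i) (Zi N i) (dl i) m.+1%:R^-1.
Hypothesis hcross : forall i j, i != j -> forall m : nat, \forall N \near \oo,
  good_cross (W N i) (gi N j) (Zi N j) (dl i)^-1 m.+1%:R^-1.

Let giab N i j : a <= gi N i 0 j <= b.
Proof. by rewrite mxE. Qed.

Let n_gt0 i : \forall N \near \oo, (0 < nn N i)%N.
Proof. exact: (@hn i _ (nbhs_infty_gt 0%N)). Qed.

Let ab (i : 'I_k) : a <= b.
Proof.
have [N0 _ H] := n_gt0 i; have h := H N0 (leqnn _).
by have /andP[/le_trans H1 /H1] := giab (Ordinal h).
Qed.

Let p_le i : \forall N \near \oo, (p N <= nn N i)%N.
Proof.
have /andP[_ g1] := hgamma_ i.
have h : \forall N \near \oo, (p N)%:R / (nn N i)%:R < 1 :> R.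
  exact: (cvgr_lt _ (@hratio i)).
near=> N; have n0 : (0 < nn N i)%N by near: N; exact: n_gt0.
have : (p N)%:R / (nn N i)%:R < 1 :> R by near: N.
by rewrite ltr_pdivrMr ?ltr0n// mul1r ltr_nat => /ltnW.
Unshelve. all: by end_near. Qed.

Local Notation basic N i :=
  [/\ (0 < nn N i)%N, (p N <= nn N i)%N, 2 / dl i <= (nn N i)%:R &
      forall l, dl i * (nn N i)%:R <= schur (W N i) l (t N i)].

Let basics i : \forall N \near \oo, basic N i.
Proof.
near=> N; split; near: N; first exact: n_gt0; first exact: p_le.
  exact: (@hn i _ (nbhs_infty_ger _)).
by apply: filterS (hgood i 0) => N [].
Unshelve. all: by end_near. Qed.

Local Notation x N i := (\tr (invmx (gram (W N i)))).

Lemma block_trace_cvg i : x N i @[N --> \oo] --> f_eta (gamma_ i) (G_ i).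
Proof.
apply: (@f_eta_cvg R a b (fun N => nn N i) (fun N => gi N i) (G_ i) (gamma_ i) a0 (ab i)
  (fun N => @giab N i) (@hG_ i) (n_gt0 i) (hgamma_ i) p (fun N => x N i) (2 / dl i) (@hratio i)).
  near=> N; have [n0 pn nd h] : basic N i by near: N; exact: basics.
  exact: (block_tr_bound n0 pn (dl0 i) nd h).
apply/cvgrPdist_le => e e0.
pose C := b * (2 / dl i ^+ 2 + (dl i)^-1 ^+ 2 * (2 + b + b / dl i)) + 2 * b + (dl i)^-1.
have b0 : 0 <= b by rewrite (le_trans (ltW a0))// (ab i).
have di := dl0 i.
have C0 : 0 < C.
  rewrite ltr_wpDl ?invr_gt0// addr_ge0 ?mulr_ge0// addr_ge0// ?mulr_ge0// ?invr_ge0 ?exprn_ge0 ?addr_ge0 ?mulr_ge0 ?invr_ge0 ?(ltW di)//.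
have [m hm] := exists_natSinv_le (divr_gt0 e0 C0).
near=> N; have [n0 pn nd h] : basic N i by near: N; exact: basics.
have [_ h2 h3] : good_block (gi N i) (Zi N i) (dl i) m.+1%:R^-1 by near: N; exact: hgood.
have tau0 : 0 < m.+1%:R^-1 :> R by rewrite invr_gt0.
have tau1 : m.+1%:R^-1 <= 1 :> R by rewrite invf_le1// ler1n.
have [_ nt] : (0 < nn N i)%N /\ (nn N i)%:R^-1 <= m.+1%:R^-1 ^+ 2 :> R.
  by near: N; apply: near_inv_le => //; rewrite exprn_gt0.
have := block_eta a0 (@giab N i) n0 pn di tau0 tau1 nd nt h h2 h3.
rewrite -/C sub0r normrN => /le_trans; apply.
by rewrite -ler_pdivlMl// mulrC.
Unshelve. all: by end_near. Qed.

Let mean_j N j := (nn N j)%:R^-1 * \sum_l gi N j 0 l.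

Lemma cross_trace_cvg i j : i != j ->
  (nn N j)%:R^-1 * \tr (invmx (gram (W N i)) *m gram (W N j)) @[N --> \oo] -->
    f_eta (gamma_ i) (G_ i) * mean (G_ j).
Proof.
move=> ij.
have b0 : 0 <= b by rewrite (le_trans (ltW a0))// (ab i).
have di := dl0 i.
have hx : x N i * mean_j N j @[N --> \oo] --> f_eta (gamma_ i) (G_ i) * mean (G_ j).
  apply: cvgM; first exact: block_trace_cvg.
  exact: (@mean_limit R a b (fun N => nn N j) (fun N => gi N j) (G_ j) a0 (ab i)
    (fun N => @giab N j) (@hG_ j)).
suff hd : (nn N j)%:R^-1 * \tr (invmx (gram (W N i)) *m gram (W N j)) -
    x N i * mean_j N j @[N --> \oo] --> 0.
  exact: cvg_sub0_add hd hx.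
apply/cvgrPdist_le => e e0.
have e4 : 0 < e / 4 by rewrite divr_gt0.
have [m hm] := exists_natSinv_le e4.
(* The error [e] is split into twice [e / 4] for concentration and [e / 2] for the shift; [+ 1]
   keeps the divisor visibly positive. *)
pose e' := e / 2 / (2 / dl i * (b / dl i + 1)).
have D0 : 0 < 2 / dl i * (b / dl i + 1).
  by rewrite mulr_gt0 ?divr_gt0// ltr_wpDl// divr_ge0// ltW.
have e'0 : 0 < e' by rewrite !divr_gt0.
near=> N.
have [n0 pn nd h] : basic N i by near: N; exact: basics.
have nj0 : (0 < nn N j)%N by near: N; exact: n_gt0.
have njR : 0 < (nn N j)%:R :> R by rewrite ltr0n.
have niR : 0 < (nn N i)%:R :> R by rewrite ltr0n.
have rle := tr_res_le n0 pn di h.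
have gc : good_cross (W N i) (gi N j) (Zi N j) (dl i)^-1 m.+1%:R^-1.
  by near: N; exact: hcross.
have := gc rle.
have [_ nt] : (0 < nn N i)%N /\ (nn N i)%:R^-1 <= e' by near: N; exact: near_inv_le.
rewrite sub0r normrN.
have gj l : 0 <= gi N j 0 l by rewrite (le_trans (ltW a0))//; case/andP: (giab l).
rewrite (tr_gram_other (g := g N) _ _ _ a0); last by move=> l; case/andP: (gab l).
set r := \tr (res _ _) in rle *; set A := _^-1 * _; move=> cr.
pose q := (nn N j)%:R^-1 * \sum_l gi N j 0 l * qf (res (W N i) (t N i)) (row l (Zi N j)).
pose s := 2 * t N i / dl i.
have s0 : 0 <= s by rewrite /s divr_ge0 ?mulr_ge0 ?invr_ge0// ltW.
have := @sandwich_dist A q r (x N i) (mean_j N j) (e / 4) s b (dl i)^-1.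
have -> : 0 <= r <= (dl i)^-1 by rewrite rle andbT res_tr_ge0// invr_gt0.
have -> : 0 <= mean_j N j <= b.
  rewrite /mean_j mulr_ge0 ?invr_ge0 ?sumr_ge0//= ler_pdivrMl//.
  rewrite (le_trans (ler_sum _ (fun l _ => (andP (giab l)).2)))//.
  by rewrite sumr_const card_ord mulr_natl.
have -> : 0 <= s <= 1.
  by rewrite s0 /s mulrAC ler_pdivrMr// mul1r.
have -> : `|q - r * mean_j N j| <= e / 4.
  rewrite /q /mean_j mulrCA -mulrBr normrM ger0_norm ?invr_ge0// ler_pdivrMl//.
  have -> : \sum_l gi N j 0 l * qf (res (W N i) (t N i)) (row l (Zi N j)) -
      r * \sum_l gi N j 0 l = \sum_l gi N j 0 l *
      (qf (res (W N i) (t N i)) (row l (Zi N j)) - r).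
    by rewrite mulr_sumr -sumrB; apply: eq_bigr => l _; ring.
  by rewrite (le_trans cr)// ler_wpM2l.
have bq := block_qf n0 pn di nd h.
have -> : q <= A <= (1 + s) * q.
  rewrite /A /q /s mulrCA !ler_pM2l ?invr_gt0// mulr_sumr; apply/andP; split.
    by apply: ler_sum => l _; rewrite ler_wpM2l//; case/andP: (bq (row l (Zi N j))).
  by apply: ler_sum => l _; rewrite mulrCA ler_wpM2l//; case/andP: (bq (row l (Zi N j))).
rewrite (block_tr n0 pn di nd h) => /(_ isT isT isT).
rewrite divr_ge0 ?(ltW e0)// => /(_ isT isT isT isT) /le_trans; apply.
have : s * ((dl i)^-1 * b) <= e / 2.
  apply: (@le_trans _ _ (t N i * (2 / dl i * (b / dl i + 1)))).
    rewrite /s.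
    have -> : 2 * t N i / dl i * ((dl i)^-1 * b) = t N i * (2 / dl i * (b / dl i)) by ring.
    rewrite ler_wpM2l ?invr_ge0// ler_wpM2l ?divr_ge0 ?(ltW di)// lerDl//.
  by rewrite -ler_pdivlMr.
lra.
Unshelve. all: by end_near. Qed.

Lemma cvg_near (u v : nat -> R) (l : R) : (\forall N \near \oo, u N = v N) ->
  v N @[N --> \oo] --> l -> u N @[N --> \oo] --> l.
Proof.
by move=> uv; apply: cvg_trans; apply: near_eq_cvg; apply: filterS uv => N ->.
Qed.

Hypothesis hk : (0 < k)%N.

Local Notation n N := ((\sum_(i < k) nn N i)%:R : R).

Let gi0 i : 0 < gamma_ i. Proof. by case/andP: (hgamma_ i). Qed.

Lemma aspect_gt0_lt1 : 0 < gamma < 1.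
Proof.
have h i : 1 < (gamma_ i)^-1 by have /andP[h0 h1] := hgamma_ i; rewrite invf_gt1.
have : 1 < gamma^-1.
  rewrite hgamma (bigD1 (Ordinal hk))//= ltr_wpDr// sumr_ge0// => i _.
  by rewrite (le_trans ler01)// ltW.
move=> h1; have g0 : 0 < gamma by rewrite -invr_gt0 (lt_trans ltr01).
by rewrite g0/= -invf_gt1.
Qed.

Let gamma0 : gamma != 0. Proof. by rewrite gt_eqF//; case/andP: aspect_gt0_lt1. Qed.

Let all_gt0 : \forall N \near \oo, forall i, (0 < nn N i)%N.
Proof. by apply: filter_forall => i; exact: n_gt0. Qed.

Let n_pos : \forall N \near \oo, 0 < n N.
Proof.
apply: filterS all_gt0 => N H; rewrite ltr0n (bigD1 (Ordinal hk))//= ltn_addr//.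
Qed.

Lemma aspect_cvg : (p N)%:R / n N @[N --> \oo] --> gamma.
Proof.
have -> : (fun N => (p N)%:R / n N) = (fun N => (\sum_(i < k) ((p N)%:R / (nn N i)%:R)^-1)^-1).
  apply/funext => N; have -> : \sum_(i < k) ((p N)%:R / (nn N i)%:R)^-1 = n N / (p N)%:R.
    by rewrite natr_sum mulr_suml; apply: eq_bigr => i _; rewrite invf_div.
  by rewrite invf_div.
rewrite -[X in _ --> X]invrK hgamma; apply: cvgV; first by rewrite -hgamma invr_eq0.
apply: cvg_big => // [|i _]; first by exact: add_continuous.
by apply: cvgV; [rewrite gt_eqF|exact: hratio].
Qed.

Lemma share_cvg j : (nn N j)%:R / n N @[N --> \oo] --> gamma / gamma_ j.
Proof.
apply: (@cvg_near _ (fun N => (p N)%:R / n N * ((p N)%:R / (nn N j)%:R)^-1)).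
  near=> N; have p0 : (0 < p N)%N by near: N; exact: (@hp _ (nbhs_infty_gt 0%N)).
  have nj : (0 < nn N j)%N by near: N; exact: n_gt0.
  have n0 : 0 < n N by near: N; exact: n_pos.
  by field; rewrite !gt_eqF// ltr0n.
by apply: cvgM; [exact: aspect_cvg|apply: cvgV; [rewrite gt_eqF|exact: hratio]].
Unshelve. all: by end_near. Qed.

(** The limit [G] is a mixture of the [G_ j] with the limiting shares of the blocks as weights. For
    the means this follows from uniqueness of limits. *)
Lemma mean_blocks : mean G = \sum_j gamma / gamma_ j * mean (G_ j).
Proof.
have h1 := @mean_limit R a b (fun N => (\sum_(i < k) nn N i)%N) g G a0 (ab (Ordinal hk)) gab hG.
apply: (cvg_unique _ h1) => //.
apply: (@cvg_near _ (fun N => \sum_j (nn N j)%:R / n N * mean_j N j)).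
  near=> N; have H : forall i, (0 < nn N i)%N by near: N; exact: all_gt0.
  have -> : \sum_l g N 0 l = \sum_j \sum_l gi N j 0 l.
    transitivity ((g N *m (const_mx 1 : 'cV_(\sum_(i < k) nn N i))) 0 0).
      by rewrite mxE; apply: eq_bigr => l _; rewrite mxE mulr1.
    rewrite -{1}[g N]submxrowK -[const_mx 1]submxcolK mul_mxrow_mxcol summxE.
    apply: eq_bigr => j _; rewrite mxE; apply: eq_bigr => l _.
    by rewrite [X in _ * X](_ : _ = 1) ?mulr1// !mxE.
  rewrite mulr_sumr; apply: eq_bigr => j _; rewrite /mean_j.
  have nj : (nn N j)%:R != 0 :> R by rewrite pnatr_eq0 -lt0n.
  by rewrite mulrACA divff ?mul1r.
apply: cvg_big => // [|j _]; first exact: add_continuous.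
apply: cvgM; first exact: share_cvg.
exact: (@mean_limit R a b (fun N => nn N j) (fun N => gi N j) (G_ j) a0 (ab j)
    (fun N => @giab N j) (@hG_ j)).
Unshelve. all: by end_near. Qed.

Local Notation u N i := ((n N)^-1 * \sum_(j < k) \tr (invmx (gram (W N i)) *m gram (W N j))).

(** The diagonal term is [p / n], which gives the summand [gamma] of [psi]. The means of the other
    blocks, weighted by their shares, add up to the mean of [G] less the share of block [i]. *)
Lemma psi_inv_cvg i : u N i @[N --> \oo] --> (psi gamma G (gamma_ i) (G_ i))^-1.
Proof.
rewrite /psi invrK mean_blocks.
have -> : gamma + (\sum_j gamma / gamma_ j * mean (G_ j) - gamma / gamma_ i * mean (G_ i)) *
    f_eta (gamma_ i) (G_ i) = \sum_j (if j == i then gamma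
    else gamma / gamma_ j * (f_eta (gamma_ i) (G_ i) * mean (G_ j))).
  rewrite (bigD1 i)//= [RHS](bigD1 i)//= eqxx; congr (_ + _).
  rewrite [X in X - _]addrC addrK mulr_suml; apply: eq_bigr => j /negbTE ->.
  by rewrite -mulrA [f_eta _ _ * _]mulrC.
have -> : (fun N => u N i) = (fun N => \sum_(j < k)
    (n N)^-1 * \tr (invmx (gram (W N i)) *m gram (W N j))).
  by apply/funext => N; rewrite mulr_sumr.
apply: cvg_big => // [|j _]; first exact: add_continuous.
have [->|ji] := eqVneq j i.
  apply: (@cvg_near _ (fun N => (p N)%:R / n N)); last exact: aspect_cvg.
  near=> N; have [n0 pn nd h] : basic N i by near: N; exact: basics.
  by rewrite mulVmx ?(block_unit n0 pn (dl0 i) nd h)// mxtrace1 mulrC.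
apply: (@cvg_near _ (fun N => (nn N j)%:R / n N *
   ((nn N j)%:R^-1 * \tr (invmx (gram (W N i)) *m gram (W N j))))).
  near=> N; have nj : (nn N j)%:R != 0 :> R.
    by rewrite pnatr_eq0 -lt0n; near: N; exact: n_gt0.
  by rewrite mulrACA divff ?mul1r.
apply: cvgM; first exact: share_cvg.
by apply: cross_trace_cvg; rewrite eq_sym.
Unshelve. all: by end_near. Qed.

Let M := \sum_j mean (G_ j) / gamma_ j.

Let mean_gt0 i : 0 < mean (G_ i).
Proof.
have gi1 := hgamma_ i; have /andP[h0 h1] := gi1.
have [f [f0 _] fE] := @f_etaE R a b (fun N => nn N i) (fun N => gi N i) (G_ i) (gamma_ i) a0 (ab i)
  (fun N => @giab N i) (@hG_ i) (n_gt0 i) gi1.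
have := @f_eta_gt R a b (fun N => nn N i) (fun N => gi N i) (G_ i) (gamma_ i) a0 (ab i)
  (fun N => @giab N i) (@hG_ i) (n_gt0 i) gi1.
rewrite fE => H; have : 0 < f * mean (G_ i).
  by apply: lt_le_trans H; rewrite divr_gt0// subr_gt0.
move=> H1; have fp : 0 < f.
  by rewrite lt_neqAle f0 andbT; apply: contraTneq H1 => <-; rewrite mul0r ltxx.
by rewrite pmulr_rgt0 in H1.
Qed.

(* By Jensen, [f(gamma_i, G_i) * mean G_i >= gamma_i / (1 - gamma_i)]; this
   keeps the denominator of the limit positive. *)
Lemma psi_bounds i : 0 < psi gamma G (gamma_ i) (G_ i) <= gamma^-1 * (mean (G_ i) / gamma_ i / M).
Proof.
have /andP[h0 h1] := hgamma_ i; have /andP[g0 g1] := aspect_gt0_lt1.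
have m0 := mean_gt0 i.
have mi : 0 < mean (G_ i) / gamma_ i by rewrite divr_gt0.
have Mm : mean (G_ i) / gamma_ i <= M.
  rewrite /M [leRHS](bigD1 i)//= lerDl sumr_ge0// => j _.
  by rewrite divr_ge0 ?ltW.
have M0 := lt_le_trans mi Mm.
have := @f_eta_gt R a b (fun N => nn N i) (fun N => gi N i) (G_ i) (gamma_ i) a0 (ab i)
  (fun N => @giab N i) (@hG_ i) (n_gt0 i) (hgamma_ i).
rewrite /psi mean_blocks; set f := f_eta _ _ => H.
have {}H : (mean (G_ i) / gamma_ i)^-1 <= f.
  rewrite invf_div ler_pdivrMr//; apply: le_trans H.
  by rewrite ler_pdivlMr ?subr_gt0// ler_piMr ?(ltW h0)//; lra.
have -> : \sum_j gamma / gamma_ j * mean (G_ j) = gamma * M.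
  by rewrite /M mulr_sumr; apply: eq_bigr => j _; rewrite mulrAC -mulrA.
have -> : gamma / gamma_ i * mean (G_ i) = gamma * (mean (G_ i) / gamma_ i).
  by rewrite mulrAC -mulrA.
move: mi Mm H; move: (mean (G_ i) / gamma_ i) => m mi Mm H.
(* Equality would hold at [f = 1 / m], and Jensen gave [f >= 1 / m]. *)
have key : gamma * M / m <= gamma + (gamma * M - gamma * m) * f.
  have -> : gamma * M / m = gamma + (gamma * M - gamma * m) / m by field; rewrite gt_eqF.
  by rewrite lerD2l ler_wpM2l// -mulrBr mulr_ge0 ?(ltW g0)// subr_ge0.
have k0 : 0 < gamma * M / m by rewrite divr_gt0// mulr_gt0.
have k1 := lt_le_trans k0 key.
rewrite invr_gt0 k1/=.
have -> : gamma^-1 * (m / M) = (gamma * M / m)^-1 by field; rewrite !gt_eqF.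
by rewrite lef_pV2.
Qed.

(** The individual upper bounds are proportions of [gamma^-1] that sum to it. The denominator of the
    limit is thus at least [1 - 2 * gamma + gamma > 0]. *)
Lemma sum_psi_bounds : 0 < \sum_i psi gamma G (gamma_ i) (G_ i) <= gamma^-1.
Proof.
have /andP[g0 g1] := aspect_gt0_lt1.
have pg i : 0 < psi gamma G (gamma_ i) (G_ i) by case/andP: (psi_bounds i).
apply/andP; split.
  by rewrite (bigD1 (Ordinal hk))//= ltr_wpDr// sumr_ge0// => i _; rewrite ltW.
rewrite (le_trans (ler_sum _ (fun i _ => (andP (psi_bounds i)).2)))//.
rewrite -mulr_sumr -mulr_suml -/M divff ?mulr1//.
rewrite gt_eqF// /M (bigD1 (Ordinal hk))//= ltr_wpDr ?divr_gt0// sumr_ge0// => i _.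
by rewrite divr_ge0 ?ltW.
Qed.

Lemma IE_cvg (Sigma : forall N, 'M[R]_(p N)) : (forall N, posdef (Sigma N)) ->
  IE (fun i => submxcol (elliptical_data (g N) (Z N) (Sigma N)) i) @[N --> \oo] -->
  (1 - gamma) / (1 - 2 * gamma + (\sum_(i < k) psi gamma G (gamma_ i) (G_ i))^-1).
Proof.
move=> hS.
have /andP[g0 g1] := aspect_gt0_lt1; have /andP[s0 s1] := sum_psi_bounds.
apply: (@cvg_near _ (fun N => (1 - (p N)%:R / n N) /
   (1 - 2 * ((p N)%:R / n N) + (\sum_(i < k) (u N i)^-1)^-1))).
  near=> N; have n0 : 0 < n N by near: N; exact: n_pos.
  have un i : gram (W N i) \in unitmx.
    move: i; near: N; apply: filter_forall => i; apply: filterS (basics i) => N [n0 pn nd h].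
    exact: (block_unit n0 pn (dl0 i) nd h).
  rewrite /IE; set X := elliptical_data _ _ _.
  have -> : \sum_(i < k) (\tr (invmx ((submxcol X i)^T *m submxcol X i) *m
        ((\mxcol_(j < k) submxcol X j)^T *m \mxcol_(j < k) submxcol X j)))^-1 =
      (n N)^-1 * \sum_(i < k) (u N i)^-1.
    rewrite mulr_sumr; apply: eq_bigr => i _; rewrite tr_elliptical//.
    by rewrite invfM invrK mulrA mulVf ?gt_eqF// mul1r.
  move: (\sum_(i < k) (u N i)^-1) => s.
  rewrite invfM invrK.
  have -> : n N - (p N)%:R = n N * (1 - (p N)%:R / n N) by field; rewrite gt_eqF.
  have -> : n N - 2 * (p N)%:R + n N / s = n N * (1 - 2 * ((p N)%:R / n N) + s^-1).
    by rewrite mulrDr; congr (_ + _); field; rewrite gt_eqF.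
  by rewrite invfM mulrACA divff ?mul1r// gt_eqF.
apply: cvgM; first by apply: cvgB; [exact: cvg_cst|exact: aspect_cvg].
apply: cvgV.
  have : gamma <= (\sum_(i < k) psi gamma G (gamma_ i) (G_ i))^-1.
    by rewrite -[leLHS]invrK lef_pV2 ?posrE ?invr_gt0.
  by move=> H; rewrite gt_eqF//; lra.
apply: cvgD.
  apply: cvgB; first exact: cvg_cst.
  by apply: cvgM; [exact: cvg_cst|exact: aspect_cvg].
apply: cvgV; first by rewrite gt_eqF.
apply: cvg_big => // [|i _]; first exact: add_continuous.
rewrite -[psi _ _ _ _]invrK; apply: cvgV; last exact: psi_inv_cvg.
by rewrite invr_eq0 gt_eqF//; case/andP: (psi_bounds i).
Unshelve. all: by end_near. Qed.

End BlockLimits.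

(** * Almost sure validity of the good events *)

Section AlmostSure.
Context (R : realType) d (T : measurableType d) (P : probability T R).
Context (k : nat) (nn : nat -> 'I_k -> nat) (p : nat -> nat).
Context (g : forall N, 'rV[R]_(\sum_(i < k) nn N i)).
Context (Z : forall N, 'I_(\sum_(i < k) nn N i) -> 'I_(p N) -> {RV P >-> R}).
Context (law : probability R R) (C : nat) (C4 C6 mu a b : R).
Context (gamma_ : 'I_k -> R) (gamma : R).
Hypothesis hk : (0 < k)%N.
Hypothesis hidx : \forall N \near \oo, (N <= C * \sum_(i < k) nn N i)%N.
Hypothesis hZ : forall N, iid_with_law law
  (fun ij : 'I_(\sum_(i < k) nn N i) * 'I_(p N) => @Z N ij.1 ij.2).
Hypotheses (C40 : 0 <= C4) (C60 : 0 <= C6) (mu0 : 0 < mu).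
Hypothesis H4 : forall d (T : measurableType d) (P : probability T R) (I : finType)
  (X : I -> {RV P >-> R}) (M : I -> I -> R), iid_with_law law X ->
  (\int[P]_w ((quadform M (X^~ w) - \sum_i M i i) ^+ 4)%:E <= (C4 * frob2 M ^+ 2)%:E)%E.
Hypothesis H6 : forall d (T : measurableType d) (P : probability T R) (I : finType)
  (X : I -> {RV P >-> R}) (M : I -> I -> R), iid_with_law law X ->
  (forall i, 0 <= M i i) ->
  (P [set w | (quadform M (X^~ w) <= mu * \sum_i M i i)%R] * ((\sum_i M i i) ^+ 6)%:E <=
   (C6 * frob2 M ^+ 3)%:E)%E.
Hypotheses (a0 : 0 < a) (gab : forall N j, a <= g N 0 j <= b).
Hypotheses (hgamma_ : forall i, 0 < gamma_ i < 1).
Hypothesis hgamma : gamma^-1 = \sum_(i < k) (gamma_ i)^-1.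
Hypothesis hn : forall i, nn N i @[N --> \oo] --> \oo.
Hypothesis hp : p N @[N --> \oo] --> \oo.
Hypothesis hratio : forall i, (p N)%:R / (nn N i)%:R @[N --> \oo] --> gamma_ i.

Let Zmx N w : 'M[R]_(\sum_(i < k) nn N i, p N) := \matrix_(j, l) @Z N j l w.
Let X N (ij : 'I_(\sum_(i < k) nn N i) * 'I_(p N)) := @Z N ij.1 ij.2.
Let idx N i (j : 'I_(nn N i)) (l : 'I_(p N)) := (tagnat.Rank i j, l).
(** The constant of [lower_good], with half the limit of [1 - p / n_i] as the eventual lower bound
    on [(n_i - p) / n_i]. *)
Let dl i := mu * a * ((1 - gamma_ i) / 2).

Let idx_inj N i j l j' l' : @idx N i j l = @idx N i j' l' -> j = j' /\ l = l'.
Proof.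
move=> h; split; last exact: (congr1 snd h).
have /eqP := congr1 (fun u => nat_of_ord u.1) h.
by rewrite /= tagnat.eq_Rank eqxx/= => /eqP jj'; apply: val_inj.
Qed.

Let idx_neq N i i' j l j' l' : i != i' -> @idx N i j l <> @idx N i' j' l'.
Proof.
move=> /negbTE ii' h; have /eqP := congr1 (fun u => nat_of_ord u.1) h.
by rewrite /= tagnat.eq_Rank ii'.
Qed.

Let ZmE N i w : Zm (@X N) (@idx N i) w = submxcol (Zmx N w) i.
Proof. by apply/matrixP => j l; rewrite !mxE. Qed.

Let giab N i j : a <= submxrow (g N) i 0 j <= b.
Proof. by rewrite mxE. Qed.

Let n_gt0 i : \forall N \near \oo, (0 < nn N i)%N.
Proof. exact: (@hn i _ (nbhs_infty_gt 0%N)). Qed.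

(** Each block has a positive limiting share, so growth of the total sample size passes to every
    block, where the probability bounds are stated. *)
Lemma index_le_block i : exists D : nat, \forall N \near \oo, (N <= D * nn N i)%N.
Proof.
have /andP[h0 h1] := hgamma_ i.
have /andP[g0 g1] := aspect_gt0_lt1 hgamma_ hgamma hk.
have sg : 0 < gamma / gamma_ i / 2 by rewrite !divr_gt0.
have sh : gamma / gamma_ i / 2 < gamma / gamma_ i.
  by rewrite ltr_pdivrMr// ltr_pMr ?divr_gt0// ltr1n.
have H : \forall N \near \oo, gamma / gamma_ i / 2 < (nn N i)%:R / (\sum_(i < k) nn N i)%:R.
  have h : (nn N i)%:R / (\sum_(i < k) nn N i)%:R @[N --> \oo] --> gamma / gamma_ i.
    exact: (@share_cvg R k nn p gamma_ gamma hgamma_ hgamma hn hp hratio hk i).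
  exact: (cvgr_gt _ h _ sh).
exists (C * Num.bound (gamma / gamma_ i / 2)^-1)%N.
near=> N.
have n0 : (0 < nn N i)%N by near: N; exact: n_gt0.
have N1 : (N <= C * \sum_(i < k) nn N i)%N by near: N.
rewrite (leq_trans N1)// -mulnA leq_mul2l; apply/orP; right.
have s0 : 0 < (\sum_(i < k) nn N i)%:R :> R.
  by rewrite ltr0n (bigD1 i)//= ltn_addr.
have : gamma / gamma_ i / 2 < (nn N i)%:R / (\sum_(i < k) nn N i)%:R by near: N.
rewrite ltr_pdivlMr// mulrC -ltr_pdivlMr// => H1.
rewrite -(ler_nat R) natrM mulrC (le_trans (ltW H1))// ler_wpM2l//.
by rewrite ltW// archi_boundP// invr_ge0 ltW.
Unshelve. all: by end_near. Qed.

Lemma good_block_ae i m : {ae P, forall w, \forall N \near \oo,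
  good_block (submxrow (g N) i) (submxcol (Zmx N w) i) (dl i) m.+1%:R^-1}.
Proof.
have /andP[h0 h1] := hgamma_ i.
have [D hD] := index_le_block i.
have th0 : 0 < (1 - gamma_ i) / 2 by rewrite divr_gt0// subr_gt0.
pose K := block_const C4 C6 a b ((1 - gamma_ i) / 2) (m.+1%:R^-1).
apply: (@ae_eventually _ _ _ _ _ (fun N => nn N i) K D) => //.
  have bb : 0 <= b ^+ 2 := sqr_ge0 b.
  have e n (y : R) : 0 <= y -> 0 <= y ^+ n := @exprn_ge0 R n y.
  have at0 : 0 <= a * ((1 - gamma_ i) / 2) by rewrite mulr_ge0 ?(ltW a0) ?(ltW th0).
  have tau0 : 0 <= m.+1%:R^-1 :> R by rewrite invr_ge0.
  apply: addr_ge0; [apply: addr_ge0|]; apply: divr_ge0; try exact: e; try exact: C40;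
    by apply: mulr_ge0 => //; apply: e => //; apply: mulr_ge0.
have hlt : gamma_ i < 1 - (1 - gamma_ i) / 2 by lra.
have H : \forall N \near \oo, (p N)%:R / (nn N i)%:R < 1 - (1 - gamma_ i) / 2.
  exact: (cvgr_lt _ (@hratio i) _ hlt).
near=> N.
have n0 : (0 < nn N i)%N by near: N; exact: n_gt0.
have pn : (1 - gamma_ i) / 2 * (nn N i)%:R <= (nn N i)%:R - (p N)%:R.
  have : (p N)%:R / (nn N i)%:R < 1 - (1 - gamma_ i) / 2 by near: N.
  by rewrite ltr_pdivrMr ?ltr0n// mulrBl mul1r => /ltW; lra.
have tau0 : 0 < m.+1%:R^-1 :> R by rewrite invr_gt0.
have [E EP HE] := block_bad C40 C60 mu0 H4 H6 (@hZ N) (@idx_inj N i) a0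
  (@giab N i) n0 th0 pn tau0.
by exists E => // w /HE; rewrite -/(@X N) ZmE.
Unshelve. all: by end_near. Qed.

Lemma cross_block_ae i j m : i != j -> {ae P, forall w, \forall N \near \oo,
  good_cross (blockmx (g N) (Zmx N w) i) (submxrow (g N) j) (submxcol (Zmx N w) j)
    (dl i)^-1 m.+1%:R^-1}.
Proof.
move=> ij; have /andP[h0 h1] := hgamma_ i.
have [D hD] := index_le_block j.
have c0 : 0 <= (dl i)^-1.
  rewrite invr_ge0 /dl mulr_ge0//; first by rewrite mulr_ge0// ltW.
  by rewrite divr_ge0// subr_ge0 ltW.
have tau0 : 0 < m.+1%:R^-1 :> R by rewrite invr_gt0.
pose K := C4 * (b * (dl i)^-1) ^+ 4 / m.+1%:R^-1 ^+ 4.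
apply: (@ae_eventually _ _ _ _ _ (fun N => nn N j) K D) => //.
  apply: divr_ge0; last by apply: exprn_ge0; exact: ltW.
  by apply: mulr_ge0 => //; apply: exprn_even_ge0.
near=> N.
have ni0 : (0 < nn N i)%N by near: N; exact: n_gt0.
have nj0 : (0 < nn N j)%N by near: N; exact: n_gt0.
have t0 : 0 < (nn N i)%:R^-1 :> R by rewrite invr_gt0 ltr0n.
have gb l : 0 <= submxrow (g N) j 0 l <= b.
  by have /andP[h ->] := giab l; rewrite (le_trans (ltW a0)).
have [E EP HE] := cross_bad C40 H4 (@hZ N) (submxrow (g N) i) (@idx_inj N j)
  (fun j1 l j2 l' => @idx_neq N i j j1 l j2 l' ij) gb t0 c0 tau0 nj0.
by exists E => // w /HE; rewrite /crossdev -/(@X N) !ZmE.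
Unshelve. all: by end_near. Qed.

Context (G : probability R R) (G_ : 'I_k -> probability R R).
Hypothesis hG : weakly_cvg (fun N => esd (diag_mx (g N))) G.
Hypothesis hG_ : forall i, weakly_cvg (fun N => esd (diag_mx (submxrow (g N) i))) (G_ i).

(** Finitely many blocks and countably many values of [m] leave one negligible set, off which
    [IE_cvg] applies. *)
Lemma IE_ae_cvg (Sigma : forall N, 'M[R]_(p N)) : (forall N, posdef (Sigma N)) ->
  {ae P, forall w, IE (fun i => submxcol (elliptical_data (g N)
       (\matrix_(j, l) @Z N j l w) (Sigma N)) i) @[N --> \oo] -->
   (1 - gamma) / (1 - 2 * gamma + (\sum_(i < k) psi gamma G (gamma_ i) (G_ i))^-1)}.
Proof.
move=> hS.
have good : {ae P, forall w, forall i m, \forall N \near \oo,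
  good_block (submxrow (g N) i) (submxcol (Zmx N w) i) (dl i) m.+1%:R^-1}.
  by apply: filter_forall => i; apply: ae_foralln => m; exact: good_block_ae.
have cross : {ae P, forall w, forall i j, i != j -> forall m, \forall N \near \oo,
  good_cross (blockmx (g N) (Zmx N w) i) (submxrow (g N) j) (submxcol (Zmx N w) j)
    (dl i)^-1 m.+1%:R^-1}.
  apply: filter_forall => i; apply: filter_forall => j.
  have [->|ij] := eqVneq i j; first by apply: nearW => w.
  have h : {ae P, forall w, forall m, \forall N \near \oo,
    good_cross (blockmx (g N) (Zmx N w) i) (submxrow (g N) j) (submxcol (Zmx N w) j)
    (dl i)^-1 m.+1%:R^-1}.
    by apply: ae_foralln => m; exact: cross_block_ae.
  by apply: filterS h => w h _.
have dl0 i : 0 < dl i.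
  by have /andP[_ h1] := hgamma_ i; rewrite /dl !mulr_gt0// subr_gt0.
apply: filterS2 good cross => w hgood hcross.
exact: (@IE_cvg R k nn p g (fun N => Zmx N w) a b gamma_ gamma G G_ dl a0 gab hgamma_ hgamma
  hn hp hratio hG hG_ dl0 hgood hcross hk Sigma hS).
Qed.

End AlmostSure.

(** * The Marchenko-Pastur case *)

Section MarchenkoPastur.
Context (R : realType).

(** For unit weights the empirical quantities are eventually constant, so their limits are read off
    without identifying [G] as a Dirac mass. *)
Lemma one_eta_mean (m : nat -> nat) (g : forall N, 'rV[R]_(m N)) (G : probability R R) :
  (\forall N \near \oo, (0 < m N)%N) -> (forall N j, g N 0 j = 1) ->
  weakly_cvg (fun N => esd (diag_mx (g N))) G ->
  mean G = 1 /\ forall x, 0 <= x -> Defs.eta G x = (1 + x)^-1.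
Proof.
move=> m0 g1 hG.
have gab N j : 1 <= g N 0 j <= 1 by rewrite g1 lexx.
have avg N (y : R) : (0 < m N)%N -> (m N)%:R^-1 * \sum_(j < m N) y = y.
  move=> mN; rewrite sumr_const card_ord -[y *+ _]mulr_natl mulrA mulVf ?mul1r//.
  by rewrite pnatr_eq0 -lt0n.
have const (u : nat -> R) (y l : R) : (\forall N \near \oo, u N = y) ->
    u N @[N --> \oo] --> l -> l = y.
  move=> uy ul; have uy' : u N @[N --> \oo] --> y by apply: (cvg_near uy); exact: cvg_cst.
  exact: (cvg_unique _ ul uy').
split=> [|x x0].
  apply: (const _ _ _ _ (@mean_limit R 1 1 m g G ltr01 (lexx 1) gab hG)).
  by apply: filterS m0 => N mN; under eq_bigr do rewrite g1; rewrite avg.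
apply: (const _ _ _ _ (@eta_limit R 1 1 m g G ltr01 (lexx 1) gab hG x x0)).
by apply: filterS m0 => N mN; rewrite /eta_emp; under eq_bigr do rewrite g1 mulr1; rewrite avg.
Qed.

Lemma one_f_eta (m : nat -> nat) (g : forall N, 'rV[R]_(m N)) (G : probability R R) (gam : R) :
  (\forall N \near \oo, (0 < m N)%N) -> (forall N j, g N 0 j = 1) ->
  weakly_cvg (fun N => esd (diag_mx (g N))) G -> 0 < gam < 1 ->
  f_eta gam G = gam / (1 - gam).
Proof.
move=> m0 g1 hG hgam; have [_ etaE] := one_eta_mean m0 g1 hG.
have gab N j : 1 <= g N 0 j <= 1 by rewrite g1 lexx.
have [f [f0 ef] ->] := @f_etaE R 1 1 m g G gam ltr01 (lexx 1) gab hG m0 hgam.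
have /andP[h0 h1] := hgam.
have fE : 1 + f = (1 - gam)^-1 by rewrite -ef etaE// invrK.
have -> : f = (1 - gam)^-1 - 1 by rewrite -fE addrAC subrr add0r.
by field; rewrite gt_eqF// subr_gt0.
Qed.

Context (k : nat) (gamma_ : 'I_k -> R) (gamma : R).
Hypotheses (hk : (0 < k)%N) (hgamma_ : forall i, 0 < gamma_ i < 1).
Hypothesis hgamma : gamma^-1 = \sum_(i < k) (gamma_ i)^-1.

(** Each [1 / gamma_i] exceeds 1, so their sum [1 / gamma] exceeds [k]. *)
Lemma card_aspect_lt1 : k%:R * gamma < 1.
Proof.
have /andP[g0 g1] := aspect_gt0_lt1 hgamma_ hgamma hk.
rewrite -ltr_pdivlMr// mul1r hgamma.
have -> : k%:R = \sum_(i < k) (1 : R) by rewrite sumr_const card_ord.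
apply: ltr_sum => [|i _]; first by apply/hasP; exists (Ordinal hk); rewrite ?mem_index_enum.
by have /andP[h0 h1] := hgamma_ i; rewrite invf_gt1.
Qed.

Lemma sum_psi_one (G : probability R R) (G_ : 'I_k -> probability R R) :
  mean G = 1 -> (forall i, mean (G_ i) = 1) ->
  (forall i, f_eta (gamma_ i) (G_ i) = gamma_ i / (1 - gamma_ i)) ->
  (\sum_(i < k) psi gamma G (gamma_ i) (G_ i))^-1 =
  gamma * (1 - gamma) / (1 - k%:R * gamma).
Proof.
move=> mG mGi fi; have /andP[g0 g1] := aspect_gt0_lt1 hgamma_ hgamma hk.
have -> : \sum_(i < k) psi gamma G (gamma_ i) (G_ i) =
    \sum_(i < k) ((gamma_ i)^-1 - 1) / (1 - gamma).
  apply: eq_bigr => i _; have /andP[h0 h1] := hgamma_ i.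
  rewrite /psi mG mGi fi mulr1.
  have -> : gamma + (1 - gamma / gamma_ i) * (gamma_ i / (1 - gamma_ i)) =
      gamma_ i * (1 - gamma) / (1 - gamma_ i).
    by field; rewrite !gt_eqF// subr_gt0.
  by field; rewrite !gt_eqF// ?subr_gt0.
rewrite -mulr_suml sumrB -hgamma sumr_const card_ord invf_div.
have := card_aspect_lt1; rewrite -subr_gt0 => h.
have -> : gamma^-1 - k%:R = (1 - k%:R * gamma) / gamma by field; rewrite gt_eqF.
by rewrite invf_div mulrA [gamma * _]mulrC.
Qed.

Lemma mp_limit_identity :
  (1 - gamma) / (1 - 2 * gamma + gamma * (1 - gamma) / (1 - k%:R * gamma)) =
  1 / (1 + (k%:R - 1) * gamma ^+ 2 / ((1 - k%:R * gamma) * (1 - gamma))).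
Proof.
have /andP[g0 g1] := aspect_gt0_lt1 hgamma_ hgamma hk.
have h := card_aspect_lt1; have k1 : 1 <= k%:R :> R by rewrite ler1n.
move: (k%:R : R) h k1 => K h K1.
have p1 : 0 < 1 - K * gamma by rewrite subr_gt0.
have p2 : 0 < 1 - gamma by rewrite subr_gt0.
have D : 0 < (1 - K * gamma) * (1 - gamma) + (K - 1) * gamma ^+ 2.
  by rewrite ltr_wpDr ?mulr_gt0// mulr_ge0 ?sqr_ge0// subr_ge0.
have -> : 1 - 2 * gamma + gamma * (1 - gamma) / (1 - K * gamma) =
    ((1 - K * gamma) * (1 - gamma) + (K - 1) * gamma ^+ 2) / (1 - K * gamma).
  by field; rewrite gt_eqF.
have -> : 1 + (K - 1) * gamma ^+ 2 / ((1 - K * gamma) * (1 - gamma)) =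
    ((1 - K * gamma) * (1 - gamma) + (K - 1) * gamma ^+ 2) / ((1 - K * gamma) * (1 - gamma)).
  by field; rewrite !gt_eqF.
by rewrite div1r !invf_div mulrA [(1 - gamma) * _]mulrC.
Qed.

End MarchenkoPastur.

Theorem theorem5p3
  (R : realType) (d : measure_display) (T : measurableType d)
  (P : probability T R)
  (k : nat) (hk : (0 < k)%N)
  (* the sequence of problems, indexed by N *)
  (nn : nat -> 'I_k -> nat) (p : nat -> nat)
  (g : forall N, 'rV[R]_(\sum_(i < k) nn N i))
  (Sigma : forall N, 'M[R]_(p N))
  (Z : forall N, 'I_(\sum_(i < k) nn N i) -> 'I_(p N) -> {RV P >-> R})
  (hg0 : forall N j, 0 <= g N 0 j)
  (hSigma : forall N, posdef (Sigma N))
  (* No joint law is imposed across the problems, and almost sure convergence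
     fails if the dimensions grow arbitrarily slowly in the index N. This holds
     whenever the total sample size, or p, or some block size, is strictly
     increasing; indexing by the total sample size is the case C = 1. *)
  (hidx : exists C : nat, \forall N \near \oo, (N <= C * \sum_(i < k) nn N i)%N)
  (law : probability R R) (c : R) (hc : 0 < c)
  (hZ : forall N, iid_with_law law
     (fun ij : 'I_(\sum_(i < k) nn N i) * 'I_(p N) => Z N ij.1 ij.2))
  (hmom : (\int[law]_x ((`|x| `^ (8 + c))%:E) < +oo)%E)
  (hmean : (\int[law]_x (x%:E) = 0)%E)
  (hvar : (\int[law]_x ((x ^+ 2)%:E) = 1)%E)
  (a b : R) (ha : 0 < a)
  (hSigmab : forall N x, eigenvalue (Sigma N) x -> a <= x <= b)
  (hgb : forall N j, a <= g N 0 j <= b)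
  (gamma_ : 'I_k -> R) (gamma : R)
  (hgamma_ : forall i, 0 < gamma_ i < 1)
  (hgamma : gamma^-1 = \sum_(i < k) (gamma_ i)^-1)
  (hn : forall i, nn N i @[N --> \oo] --> \oo)
  (hp : p N @[N --> \oo] --> \oo)
  (hratio : forall i, (p N)%:R / (nn N i)%:R @[N --> \oo] --> gamma_ i)
  (G : probability R R) (G_ : 'I_k -> probability R R) (H : probability R R)
  (hG : weakly_cvg (fun N => esd (diag_mx (g N))) G)
  (hG_ : forall i, weakly_cvg (fun N => esd (diag_mx (submxrow (g N) i))) (G_ i))
  (hH : weakly_cvg (fun N => esd (Sigma N)) H)
  (hHsupp : compactly_supported_off0 H)
  (hGsupp : compactly_supported G)
  (hGatom : G [set 0] = 0%E) :
  let X N (w : T) :=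
    elliptical_data (g N) (\matrix_(j, l) Z N j l w) (Sigma N) in
  let IE_ N (w : T) := IE (fun i => submxcol (X N w) i) in
  {ae P, forall w, IE_ N w @[N --> \oo] -->
     (1 - gamma) /
     (1 - 2 * gamma + (\sum_(i < k) psi gamma G (gamma_ i) (G_ i))^-1)} /\
  ((forall N, diag_mx (g N) = 1%:M) ->
   {ae P, forall w, IE_ N w @[N --> \oo] -->
     (1 - gamma) /
     (1 - 2 * gamma + gamma * (1 - gamma) / (1 - k%:R * gamma))} /\
   (1 - gamma) / (1 - 2 * gamma + gamma * (1 - gamma) / (1 - k%:R * gamma)) =
   1 / (1 + (k%:R - 1) * gamma ^+ 2 / ((1 - k%:R * gamma) * (1 - gamma)))).
Proof.
(* These constants depend on the law alone and are fixed before the index [N]. *)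
have [C4 C40 H4] := quadform_moment4 hc hmom hmean hvar.
have [C6 [mu [C60 mu0 H6]]] := quadform_lower_tail hc hmom hmean hvar.
have [C hC] := hidx.
have main := @IE_ae_cvg R d T P k nn p g Z law C C4 C6 mu a b gamma_ gamma hk hC hZ C40 C60
  mu0 H4 H6 ha hgb hgamma_ hgamma hn hp hratio G G_ hG hG_ Sigma hSigma.
split; first exact: main.
move=> g1; split; last exact: (mp_limit_identity hk hgamma_ hgamma).
have g1' N j : g N 0 j = 1.
  by have /matrixP/(_ j j) := g1 N; rewrite !mxE eqxx.
have gi1 i N j : submxrow (g N) i 0 j = 1 by rewrite mxE.
have n0 i : \forall N \near \oo, (0 < nn N i)%N by exact: (@hn i _ (nbhs_infty_gt 0%N)).
have n0' : \forall N \near \oo, (0 < \sum_(i < k) nn N i)%N.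
  by apply: filterS (n0 (Ordinal hk)) => N h; rewrite (bigD1 (Ordinal hk))//= ltn_addr.
have [mG _] := one_eta_mean n0' g1' hG.
have mGi i := (one_eta_mean (n0 i) (gi1 i) (@hG_ i)).1.
have fGi i := one_f_eta (n0 i) (gi1 i) (@hG_ i) (hgamma_ i).
by rewrite -(sum_psi_one hk hgamma_ hgamma mG mGi fGi).
Qed.
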